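(* Let $\Lambda$ be an $\mathbb{R}^d$-valued Lévy basis on $M_d^-\times\mathbb{R}$ with generating quadruple $(\gamma,0,\nu,\pi)$ such that $\int_{\|x\|\le 1}\|x\|\,\nu(dx)<\infty$. Suppose that the (measurable) kernel function $f:M_d^-\times\mathbb{R}\to M_{n,d}$ is such that $f(A,s)$ is continuous and differentiable in $s$ for all $s\in\mathbb{R}\setminus\{0\}$, and $f(A,0^-)=\lim_{s\nearrow 0}f(A,s)=C_1\in M_{n,d}$ as well as $f(A,0^+)=\lim_{s\searrow 0}f(A,s)=C_2\in M_{n,d}$ for all $A\in M_d^-$. Set $$f'(A,s):=\begin{cases}\frac{d}{ds}f(A,s) & \text{if } s\neq 0,\\ \lim_{s\searrow 0}\frac{d}{ds}f(A,s) & \text{if } s=0.\end{cases}$$ Assume that for some $\delta>0$ and for every $t_1,t_2\in\mathbb{R}$ with $t_1\le t_2$ and $t_2-t_1\le\delta$ the function $h_{t_1,t_2}(A,s):=\sup_{t\in[t_1,t_2]}\|f'(A,t-s)\|$ satisfies $$\int_{M_d^-}\int_{\mathbb{R}}h_{t_1,t_2}(A,s)\,ds\,\pi(dA)<\infty\quad\text{and}\quad\int_{M_d^-}\int_{\mathbb{R}}\int_{\mathbb{R}}\bigl(1\wedge |h_{t_1,t_2}(A,s)\,y|\bigr)\,\nu_T(dy)\,ds\,\pi(dA)<\infty,$$ where $\nu_T(\cdot)=\nu(T^{-1}(\cdot))$ with $T(x)=\|x\|$. If the process $X_t=\int_{M_d^-}\int_{\mathbb{R}}f(A,t-s)\,\Lambda(dA,ds)$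 exists in the sense that $$\int_{M_d^-}\int_{\mathbb{R}}\|f(A,s)\|\,ds\,\pi(dA)<\infty\quad\text{and}\quad\int_{M_d^-}\int_{\mathbb{R}}\int_{\mathbb{R}^d}\bigl(1\wedge\|f(A,s)x\|\bigr)\,\nu(dx)\,ds\,\pi(dA)<\infty,$$ then, setting $Z_t:=\int_{M_d^-}\int_{\mathbb{R}}f'(A,t-s)\,\Lambda(dA,ds)$, we have $$X_t=X_0+\int_0^t Z_u\,du+(C_1-C_2)\,L_t,$$ and consequently $X_t$ has sample paths in $\mathbb{D}$ (i.e. càdlàg sample paths) which are of finite variation on compacts.
   Context: $M_{n,d}$ is the set of real $n\times d$ matrices; $M_d^-$ is the set of real $d\times d$ matrices all of whose eigenvalues have strictly negative real part; $\|\cdot\|$ is the Euclidean norm (and the induced matrix norm). $\mathbb{D}$ is the space of càdlàg (right-continuous with left limits) functions on $[0,1]$ with values in the Euclidean space in which the process takes its values (here $\mathbb{R}^n$). An $\mathbb{R}^d$-valued Lévy basis $\Lambda$ on $M_d^-\times\mathbb{R}$ with generating quadruple $(\gamma,\Sigma,\nu,\pi)$ is a family of infinitely divisible $\mathbb{R}^d$-valued random variables $\Lambda(B)$, $B$ a bounded Borel subset of $M_d^-\times\mathbb{R}$, which is independently scattered (values on pairwise disjoint sets are independent), a.s. $\sigma$-additive (on pairwise disjoint sequences whose union is bounded), and satisfies $\mathbb{E}(e^{iu^T\Lambda(B)})=e^{\varphi(u)(\pi\times\lambda)(B)}$ for all $u\in\mathbb{R}^d$, where $\pi$ is a probability measure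 on $M_d^-$, $\lambda$ is Lebesgue measure on $\mathbb{R}$, and $$\varphi(u)=iu^T\gamma-\tfrac12u^T\Sigma u+\int_{\mathbb{R}^d}\bigl(e^{iu^Tx}-1-iu^Tx\,\mathbf 1_{[0,1]}(\|x\|)\bigr)\nu(dx)$$ is the characteristic exponent of an infinitely divisible law with characteristic triplet $(\gamma,\Sigma,\nu)$. The underlying Lévy process $L$ is given by $L_t=\Lambda(M_d^-\times(0,t])$ and $L_{-t}=\Lambda(M_d^-\times[-t,0))$ for $t>0$. All Lévy bases are assumed to be already modified so that they have a Lévy–Itô decomposition; in the case $\Sigma=0$, $\int_{\|x\|\le1}\|x\|\nu(dx)<\infty$ this reads $\Lambda(B)=\gamma_0(\pi\times\lambda)(B)+\int_{\mathbb{R}^d}\int_B x\,N(dx,dA,ds)$ with $\gamma_0=\gamma-\int_{\|x\|\le1}x\,\nu(dx)$ and $N$ a Poisson random measure on $\mathbb{R}^d\times M_d^-\times\mathbb{R}$ with intensity $\nu\times\pi\times\lambda$. For a kernel $g$ satisfying the two integrability conditions above (with $g$ in place of $f$), $\int_{M_d^-}\int_{\mathbb{R}} g\,d\Lambda=\int_{M_d^-}\int_{\mathbb{R}}g(A,s)\gamma_0\,ds\,\pi(dA)+\int_{\mathbb{R}^d}\int_{M_d^-}\int_{\mathbb{R}}g(A,s)x\,N(dx,dA,ds)$, where the integrals on the right-hand side exist as Lebesgue integrals for every $\omega\in\Omega$.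
   Formalization: For t≥0 the coefficient of L_t is C_2−C_1, not the false C_1−C_2 (kept for t<0). For arbitrary f(A,0) the identity is a.s. at each fixed t and a modification of X is càdlàg of finite variation; if f(A,0)=C_2, a.s. X itself is, with the identity for all t≥0 at once. *)

(* Defs.v *)
From HB Require Import structures.
From mathcomp Require Import all_boot all_order all_algebra.
From mathcomp Require Import all_classical all_reals all_analysis.
From mathcomp Require Import measurable_realfun complex.

Set Implicit Arguments.
Unset Strict Implicit.
Unset Printing Implicit Defensive.

Import Order.TTheory GRing.Theory Num.Theory.
Import numFieldNormedType.Exports.

Local Open Scope classical_set_scope.
Local Open Scope ring_scope.
Local Open Scope complex_scope.

HB.instance Definition _ (R : realType) (m n : nat) :=
  @isMeasurable.Build (sigma_display (@open 'M[R]_(m, n))) 'M[R]_(m, n)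
    <<s @open 'M[R]_(m, n) >>
    (@sigma_algebra0 _ setT (@open 'M[R]_(m, n)))
    (@sigma_algebraC _ (@open 'M[R]_(m, n)))
    (@sigma_algebra_bigcup _ setT (@open 'M[R]_(m, n))).

Section euclidean.
Variable R : realType.

Definition dotv (d : nat) (u x : 'cV[R]_d) : R := (u^T *m x) 0 0.

(* The library norm on matrices is the max norm, hence these two. *)
Definition enorm (d : nat) (x : 'cV[R]_d) : R :=
  Num.sqrt (\sum_i x i 0 ^+ 2).

Definition opnorm (m n : nat) (A : 'M[R]_(m, n)) : R :=
  sup [set enorm (A *m x) | x in [set x : 'cV[R]_n | enorm x <= 1]].

Definition Mminus (d : nat) : set 'M[R]_d :=
  [set A | forall z : R[i],
     eigenvalue (map_mx (real_complex R) A) z -> complex.Re z < 0].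

End euclidean.

Section integrals.
Context (R : realType).

Definition cexp (z : R[i]) : R[i] :=
  (expR (complex.Re z))%:C * (cos (complex.Im z) +i* sin (complex.Im z)).

Definition cintegral dT (T : measurableType dT)
    (mu : {measure set T -> \bar R}) (g : T -> R[i]) : R[i] :=
  (\int[mu]_x complex.Re (g x)) +i* (\int[mu]_x complex.Im (g x)).

Definition vintegral dT (T : measurableType dT)
    (mu : {measure set T -> \bar R}) (D : set T) (k : nat)
    (g : T -> 'cV[R]_k) : 'cV[R]_k :=
  \col_i \int[mu]_(x in D) g x i 0.

Definition time_integral (k : nat) (z : R -> 'cV[R]_k) (t : R) : 'cV[R]_k :=
  if 0 <= t then vintegral (@lebesgue_measure R) `[0, t] z
  else - vintegral (@lebesgue_measure R) `[t, 0] z.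

End integrals.

Section random_variables.
Context (R : realType).

Definition independent_rvs dO (Omega : measurableType dO)
    (P : probability Omega R) dT (T : measurableType dT)
    (k : nat) (X : 'I_k -> Omega -> T) : Prop :=
  forall A : 'I_k -> set T, (forall i, measurable (A i)) ->
    P (\bigcap_(i in [set: 'I_k]) (X i @^-1` A i)) =
    (\prod_(i < k) P (X i @^-1` A i))%E.

Definition infinitely_divisible dO (Omega : measurableType dO)
    (P : probability Omega R) (d : nat) (X : Omega -> 'cV[R]_d) : Prop :=
  forall k : nat, (0 < k)%N ->
  exists (dO' : measure_display) (Omega' : measurableType dO')
         (P' : probability Omega' R) (Y : 'I_k -> Omega' -> 'cV[R]_d),
  [/\ forall i, measurable_fun [set: Omega'] (Y i),
      independent_rvs P' Y,
      forall i j (B : set 'cV[R]_d), measurable B ->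
        P' (Y i @^-1` B) = P' (Y j @^-1` B) &
      forall B : set 'cV[R]_d, measurable B ->
        P (X @^-1` B) = P' ((fun w => \sum_i Y i w) @^-1` B)].

(* A Poisson random measure with intensity mu.  [poisson_prob 0] is the Dirac
   mass at 0. *)
Definition poisson_random_measure dO (Omega : measurableType dO)
    (P : probability Omega R) dE (E : measurableType dE)
    (mu : set E -> \bar R) (N : Omega -> {measure set E -> \bar R}) : Prop :=
  [/\ forall B, measurable B -> measurable_fun [set: Omega] (fun w => N w B),
      forall B, measurable B -> (mu B < +oo)%E -> forall j : nat,
        P [set w | N w B = j%:R%:E] = poisson_prob (fine (mu B)) j [set j],
      forall B, measurable B -> mu B = +oo%E ->
        P [set w | N w B = +oo%E] = 1%E &
      forall (k : nat) (B : 'I_k -> set E), (forall i, measurable (B i)) ->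
        trivIset [set: 'I_k] B -> independent_rvs P (fun i w => N w (B i))].

End random_variables.

Section levy_bases.
Context (R : realType) (d : nat).
Variables (gamma : 'cV[R]_d) (Sigma : 'M[R]_d)
  (nu : {measure set 'cV[R]_d -> \bar R}) (pi : probability 'M[R]_d R).

Definition characteristic_triplet : Prop :=
  [/\ Sigma^T = Sigma, forall u : 'cV[R]_d, 0 <= dotv u (Sigma *m u),
      nu [set 0] = 0%E &
      (\int[nu]_x (Num.min 1 (enorm x ^+ 2))%:E < +oo)%E].

Definition characteristic_exponent (u : 'cV[R]_d) : R[i] :=
  'i * (dotv u gamma)%:C - (dotv u (Sigma *m u) / 2)%:C
  + cintegral nu (fun x => cexp ('i * (dotv u x)%:C) - 1
      - 'i * (dotv u x)%:C * ((enorm x <= 1)%R : nat)%:R).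

(* pi lives on all d x d matrices and is concentrated on Mminus d. *)
Definition base_measure : set ('M[R]_d * R) -> \bar R :=
  (pi \x (@lebesgue_measure R))%E.

Definition bounded_borel (B : set ('M[R]_d * R)) : Prop :=
  [/\ measurable B, B `<=` @Mminus R d `*` setT &
      exists K : R, forall p, B p -> opnorm p.1 <= K /\ `|p.2| <= K].

Definition levy_basis dO (Omega : measurableType dO)
    (P : probability Omega R)
    (Lambda : set ('M[R]_d * R) -> Omega -> 'cV[R]_d) : Prop :=
  [/\ characteristic_triplet /\ pi (@Mminus R d) = 1%E,
      forall B, bounded_borel B ->
        measurable_fun [set: Omega] (Lambda B) /\
        infinitely_divisible P (Lambda B),
      forall (k : nat) (B : 'I_k -> set ('M[R]_d * R)),
        (forall i, bounded_borel (B i)) -> trivIset [set: 'I_k] B ->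
        independent_rvs P (fun i => Lambda (B i)),
      forall B : nat -> set ('M[R]_d * R),
        (forall i, bounded_borel (B i)) -> trivIset [set: nat] B ->
        bounded_borel (\bigcup_i B i) ->
        {ae P, forall w, \sum_(i < k) Lambda (B i) w @[k --> \oo]
                           --> Lambda (\bigcup_i B i) w} &
      forall (B : set ('M[R]_d * R)) (u : 'cV[R]_d), bounded_borel B ->
        cintegral P (fun w => cexp ('i * (dotv u (Lambda B w))%:C)) =
        cexp (characteristic_exponent u * (fine (base_measure B))%:C)].

End levy_bases.

Section finite_variation_case.
Context (R : realType) (d : nat).
Variables (gamma : 'cV[R]_d) (nu : {measure set 'cV[R]_d -> \bar R})
  (pi : probability 'M[R]_d R).
Context dO (Omega : measurableType dO).

Definition drift : 'cV[R]_d :=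
  gamma - vintegral nu [set x | enorm x <= 1] id.

(* The Levy-Ito decomposition when Sigma = 0 and small jumps are summable. *)
Definition levy_ito (P : probability Omega R)
    (Lambda : set ('M[R]_d * R) -> Omega -> 'cV[R]_d)
    (N : Omega -> {measure set ('cV[R]_d * ('M[R]_d * R)) -> \bar R}) : Prop :=
  poisson_random_measure P (nu \x base_measure pi)%E N /\
  forall w (B : set ('M[R]_d * R)), bounded_borel B ->
    (\int[N w]_(p in setT `*` B) (enorm p.1)%:E < +oo)%E /\
    Lambda B w = fine (base_measure pi B) *: drift
                 + vintegral (N w) (setT `*` B) fst.

(* The integral of g with respect to Lambda, computed pathwise.  For a fixed g
   satisfying the integrability conditions, the integral against N w is a
   Lebesgue integral for almost every w; where it is not, it takes a
   conventional value.  (Absolute convergence for every w and every g at once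
   would be contradictory as soon as N has infinitely many atoms.) *)
Definition stoch_integral
    (N : Omega -> {measure set ('cV[R]_d * ('M[R]_d * R)) -> \bar R})
    (n : nat) (g : 'M[R]_d -> R -> 'M[R]_(n, d)) (w : Omega) : 'cV[R]_n :=
  \col_i (\int[pi]_(A in @Mminus R d)
            \int[@lebesgue_measure R]_s (g A s *m drift) i 0)
  + vintegral (N w) (setT `*` (@Mminus R d `*` setT))
      (fun p => g p.2.1 p.2.2 *m p.1).

(* L_t is the mass given by Lambda to Mminus d * ]0, t] for t >= 0, and to
   Mminus d * [t, 0[ (without change of sign) for t < 0.  These slabs are not
   bounded, so their mass is the integral of their indicator function.
   Since t |-> f A (t - s) jumps by f A 0+ - f A 0- when t increases through s,
   the process t |-> stoch_integral N (fun A s => f A (t - s)) moves away from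
   its value at 0 by + (f A 0+ - f A 0-) *m L_t for t >= 0, and by
   - (f A 0+ - f A 0-) *m L_t for t < 0, on top of its absolutely continuous
   part. *)
Definition levy_process
    (N : Omega -> {measure set ('cV[R]_d * ('M[R]_d * R)) -> \bar R})
    (t : R) : Omega -> 'cV[R]_d :=
  stoch_integral N (fun _ s =>
    ((if 0 <= t then \1_(`]0, t] : set R) else \1_(`[t, 0[ : set R)) s)%:M).

End finite_variation_case.

Section kernels.
Context (R : realType) (n d : nat).

Definition kernel_derivative (f : 'M[R]_d -> R -> 'M[R]_(n, d))
    (A : 'M[R]_d) (s : R) : 'M[R]_(n, d) :=
  if s == 0 then lim (derive1 (f A) x @[x --> 0^'+]) else derive1 (f A) s.

Definition kernel_sup (g : 'M[R]_d -> R -> 'M[R]_(n, d)) (t1 t2 : R)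
    (A : 'M[R]_d) (s : R) : \bar R :=
  ereal_sup [set (opnorm (g A (t - s)))%:E | t in `[t1, t2]].

End kernels.

Section paths.
Context (R : realType) (k : nat).

(* On the whole line; the restriction of such a path to [0, 1] is in D. *)
Definition cadlag (y : R -> 'cV[R]_k) : Prop :=
  forall t : R, (y x @[x --> t^'+] --> y t) /\ cvg (y x @[x --> t^'-]).

Definition finite_variation_on_compacts (y : R -> 'cV[R]_k) : Prop :=
  forall (a b : R) (i : 'I_k), a <= b ->
    bounded_variation a b (fun t => y t i 0).

End paths.

(* Main.v *)
(* For fixed A, the path t |-> f(A, t - s) x is absolutely continuous apart from
   the jump (C2 - C1) x at t = s, so its increment over ]a, b] is the time
   integral of f'(A, u - s) x plus (C2 - C1) x if a < s <= b.  Integrating this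
   identity against the measure m = N(w) of the jumps, and against
   pi x Lebesgue for the drift, and exchanging the integrals gives the formula
   for X; dominated convergence then gives the cadlag property, and the
   variation is bounded by the integral of |Z| plus the mass of the jumps.
   Almost every N(w) integrates the functions involved because, by Campbell's
   formula, the integral of F against N is almost surely finite as soon as
   min(1, F) is integrable for the intensity.  The supremum h need not be
   measurable, but the integral of a nonnegative function is monotone
   regardless; and the matrices A for which f'(A, .) is locally unbounded form a
   measurable null set, since h is infinite on a whole interval of times there.
   Where f(A, 0) is not C2, X is only modified at the times t = s of the jumps,
   which is invisible at a fixed t. *)
Require Import Defs.
From HB Require Import structures.
From mathcomp Require Import all_boot all_order all_algebra.
From mathcomp Require Import all_classical all_reals all_analysis.
From mathcomp Require Import measurable_realfun complex.
From mathcomp Require Import ring lra.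

Set Implicit Arguments.
Unset Strict Implicit.
Unset Printing Implicit Defensive.

Import Order.TTheory GRing.Theory Num.Theory.
Import numFieldNormedType.Exports.

Local Open Scope classical_set_scope.
Local Open Scope ring_scope.

(** * One-dimensional calculus *)

(** Drift and jumps obey one argument. Both are superpositions of paths [f(a(p), t - s(p)) x(p)]
    over a sigma-finite measure in [p]: [pi \x leb] with a constant vector [x] for the drift, [N w]
    for the jumps. The increment formula is therefore proved once, for an abstract measure. The
    obstacle is uniformity in time: the formula must hold for all times outside a single null set,
    while an almost sure statement about [N] concerns one function at a time. Two devices leave only
    countably many functions. The kernel is replaced by a version equal to [C2] at time 0 and to 0
    for the exceptional matrices, whose superposition is right continuous everywhere. The time axis
    is cut into windows of length [min(delta, 1)]: at most [delta], so that the hypotheses on h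
    apply, and at most 1, so that the integral of the slope over a window stays below its supremum.
    Fubini's theorem needs [N w] sigma-finite; this too holds only almost surely, and comes from the
    integrability of the jump sizes over bounded times. *)

Section integrals_without_measurability.
Local Open Scope ereal_scope.
Context dT (T : measurableType dT) (R : realType).
Variable mu : {measure set T -> \bar R}.

(* The integral of a nonnegative function is a supremum over the simple
   functions below it, hence monotone without any measurability. *)
Lemma le_lower_integral (D : set T) (f g : T -> \bar R) :
  (forall x, D x -> 0 <= f x) -> (forall x, D x -> f x <= g x) ->
  \int[mu]_(x in D) f x <= \int[mu]_(x in D) g x.
Proof.
move=> f0 fg; have g0 x : D x -> 0 <= g x by move=> Dx; exact: le_trans (f0 _ Dx) (fg _ Dx).
rewrite integral_mkcond [leRHS]integral_mkcond.
have le_fg x : (f \_ D) x <= (g \_ D) x.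
  by rewrite !patchE; case: ifPn => // /set_mem; exact: fg.
have fD0 x : 0 <= (f \_ D) x.
  by rewrite patchE; case: ifPn => // /set_mem; exact: f0.
have gD0 x : 0 <= (g \_ D) x by exact: le_trans (fD0 x) (le_fg x).
rewrite !ge0_integralTE//; apply: le_ereal_sup => _ [h /= hf <-].
by exists h => //= x; exact: le_trans (hf x) (le_fg x).
Qed.

(** [g] may fail to be measurable, so its integral is bounded below by that of the measurable
    function equal to [+oo] on [S] and to 0 elsewhere, which is infinite as soon as [mu S] is
    positive. *)
Lemma null_of_integral_lt (D S : set T) (g : T -> \bar R) :
  measurable D -> measurable S -> S `<=` D ->
  (forall x, D x -> 0 <= g x) -> (forall x, S x -> g x = +oo) ->
  \int[mu]_(x in D) g x < +oo -> mu S = 0.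
Proof.
move=> mD mS SD g0 gS gD; apply/eqP; rewrite eq_le measure_ge0 andbT.
rewrite leNgt; apply/negP => S0; move: gD; apply/negP; rewrite -leNgt.
have : \int[mu]_(x in D) (cst +oo \_ S) x <= \int[mu]_(x in D) g x.
  apply: le_lower_integral => x Dx; rewrite patchE.
    by case: ifPn => // _; rewrite leey.
  by case: ifPn => [/set_mem Sx|_]; [rewrite gS|exact: g0].
apply: le_trans; rewrite -integral_mkcondr (_ : D `&` S = S); last first.
  by apply/seteqP; split => [x []//|x Sx]; split => //; exact: SD.
by rewrite integral_cst// gt0_mulye.
Qed.

End integrals_without_measurability.

Section fundamental_theorem.
Context (R : realType).
Notation leb := (@lebesgue_measure R).

(** A derivative becomes the limit of one sequence of difference quotients, a form that suits
    dominated convergence as well as the measurability of limits of measurable functions. *)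
Lemma is_derive_cvg_harmonic (H : R -> R) (x l : R) : is_derive x 1 H l ->
  (n.+1%:R^-1)^-1 * (H (x + n.+1%:R^-1) - H x) @[n --> \oo] --> l.
Proof.
move=> [dH <-].
have hcvg : (n.+1%:R^-1 : R) @[n --> \oo] --> (0 : R)^'.
  move=> /= U [e /= e0 eU]; have := @cvg_harmonic R.
  move/cvgrPdist_lt => /(_ _ e0); apply: filterS => n nU; exact: eU.
rewrite (_ : (fun n => _) =
    (fun k : R => k^-1 *: (H (k *: (1 : R) + x) - H x)) \o (fun n => n.+1%:R^-1)).
  exact: cvg_comp hcvg dH.
by apply/funext => n /=; rewrite /GRing.scale/= mulr1 (addrC x).
Qed.

Lemma mean_value_bound (F G : R -> R) (x y K : R) : x <= y ->
  (forall z, z \in `[x, y] -> is_derive z 1 F (G z)) ->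
  (forall z, z \in `]x, y[ -> `|G z| <= K) ->
  `|F y - F x| <= K * (y - x).
Proof.
rewrite le_eqVlt => /predU1P[-> _ _|xy dF GK]; first by rewrite !subrr normr0 mulr0.
have dF' z : z \in `]x, y[ -> is_derive z 1 F (G z).
  by move=> /subset_itv_oo_cc; exact: dF.
have cF : {within `[x, y], continuous F}.
  by apply: derivable_within_continuous => z /dF [].
have [z zxy e] := MVT xy dF' cF.
rewrite e normrM (ger0_norm (_ : 0 <= y - x)); last by rewrite subr_ge0 ltW.
by apply: ler_wpM2r; [rewrite subr_ge0 ltW|exact: GK].
Qed.

Lemma antiderivative (F : R -> R) (a b : R) : continuous F ->
  exists G : R -> R, forall x, x \in `]a, b[ -> is_derive x 1 G (F x).
Proof.
move=> cF; exists (fun x => (\int[leb]_(t in [set` `[a, x]]) F t)%R) => x.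
rewrite in_itv/= => /andP[ax xb].
have iF : leb.-integrable `[a, b] (EFin \o F).
  apply: continuous_compact_integrable; first exact: segment_compact.
  exact: continuous_subspaceT.
have [d1 d2] := continuous_FTC1_closed xb iF ax (cF x).
by apply: DeriveDef; [exact: d1|rewrite -derive1E; exact: d2].
Qed.

(** The mean value theorem asks for a derivative only in the open interval, so [c] may be an
    endpoint; an interval with [c] inside is cut at [c], where continuity of [F] is enough. *)
Lemma lipschitz_of_bounded_derivative (F g : R -> R) (a b c K : R) :
  continuous F -> 0 <= K ->
  (forall x, x \in `]a, b[ -> x != c -> is_derive x 1 F (g x)) ->
  (forall x, x \in `]a, b[ -> x != c -> `|g x| <= K) ->
  forall x y, a < x -> y < b -> x <= y -> `|F y - F x| <= K * (y - x).
Proof.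
move=> cF K0 dF gK.
have off x y : a < x -> y < b -> x < y -> (y <= c) || (c <= x) ->
    `|F y - F x| <= K * (y - x).
  move=> ax yb xy cxy.
  have sub z : z \in `]x, y[ -> (z \in `]a, b[) /\ z != c.
    rewrite !in_itv/= => /andP[xz zy]; split; first by apply/andP; split; lra.
    by apply/eqP => zc; case/orP: cxy => ?; lra.
  have [||z zxy ->] := @MVT _ F g x y xy.
  - by move=> z /sub[]; exact: dF.
  - exact: continuous_subspaceT.
  have [zab zc] := sub _ zxy.
  rewrite normrM (ger0_norm (_ : 0 <= y - x)); last by rewrite subr_ge0 ltW.
  by apply: ler_wpM2r; [rewrite subr_ge0 ltW|exact: gK].
move=> x y ax yb; rewrite le_eqVlt => /predU1P[->|xy].
  by rewrite !subrr normr0 mulr0.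
have [yc|cy] := leP y c; first by apply: off => //; rewrite yc.
have [cx|xc] := leP c x; first by apply: off => //; rewrite cx orbT.
rewrite (_ : F y - F x = (F y - F c) + (F c - F x)); last by rewrite addrA subrK.
rewrite (_ : y - x = (y - c) + (c - x)); last by rewrite addrA subrK.
rewrite mulrDr; apply: le_trans (ler_normD _ _) _; apply: lerD.
  by apply: off => //; [exact: lt_trans xc|rewrite lexx orbT].
by apply: off => //; [exact: lt_trans yb|rewrite lexx].
Qed.

(* Dominated convergence for the derivatives of the averages of [F] over
   intervals of length [1/(n+1)]. *)
Lemma bounded_derivative_FTC (F g : R -> R) (a b c K : R) : a <= b ->
  continuous F -> measurable_fun [set: R] g -> 0 <= K ->
  (forall x, x \in `]a - 1, b + 2[ -> x != c -> is_derive x 1 F (g x)) ->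
  (forall x, x \in `]a - 1, b + 2[ -> x != c -> `|g x| <= K) ->
  leb.-integrable `[a, b] (EFin \o g) /\
  (\int[leb]_(x in `[a, b]) (g x)%:E = (F b - F a)%:E)%E.
Proof.
rewrite le_eqVlt => /predU1P[<- _ mg _ _ _|ab cF mg K0 dF gK].
  rewrite subrr set_itv1 integral_set1 ?measurable_set1//; split => //.
  apply/integrableP; split; last by rewrite integral_set1 ?ltry.
  by apply/measurable_EFinP; exact: measurable_funTS.
(* The steps [h n] lie in []0, 1]]: the margins [a - 1] and [b + 2] keep [x] and [x + h n] strictly
   inside the interval for every [x] in [[a, b]]. *)
have [G dG] := antiderivative (a - 1) (b + 2) cF.
pose h (n : nat) : R := n.+1%:R^-1.
have h0 n : 0 < h n by rewrite invr_gt0.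
have h1 n : h n <= 1 by rewrite invf_le1// ler1n.
pose q n x := (h n)^-1 * (F (x + h n) - F x).
pose A n x := (h n)^-1 * (G (x + h n) - G x).
have cq n : continuous (q n).
  move=> x; rewrite /q; apply: cvgM; first exact: cvg_cst.
  apply: cvgB; last exact: cF.
  apply: (@continuous_comp _ _ _ (fun x => x + h n) F); last exact: cF.
  by apply: cvgD; [exact: cvg_id|exact: cvg_cst].
have dA n x : x \in `[a, b] -> is_derive x 1 (A n) (q n x).
  rewrite in_itv/= => /andP[ax xb].
  have d1 : is_derive x 1 G (F x).
    by apply: dG; rewrite in_itv/=; apply/andP; split; lra.
  have d2 : is_derive (x + h n) 1 G (F (x + h n)).
    apply: dG; rewrite in_itv/=; have := h0 n; have := h1 n => ? ?.
    by apply/andP; split; lra.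
  have d3 : is_derive x 1 (fun x => G (x + h n)) (F (x + h n)).
    have := @is_derive1_comp _ G (fun x => x + h n) x (F (x + h n)) 1 d2 _.
    rewrite mulr1; apply.
    by apply: is_derive_eq; rewrite addr0.
  have d4 : is_derive x 1 (fun x => (h n)^-1 *: (G (x + h n) - G x)) (q n x).
    by apply: is_deriveZ.
  by [].
have qE n : (\int[leb]_(x in `[a, b]) (q n x)%:E = (A n b - A n a)%:E)%E.
  rewrite EFinB -(continuous_FTC2 ab (f := q n)) //.
  - by apply: continuous_subspaceT.
  - have cA x : x \in `[a, b] -> {for x, continuous (A n)}.
      move=> /(dA n) dx; apply: differentiable_continuous.
      by apply/derivable1_diffP; case: dx.
    split.
    + by move=> x xab; case: (dA n x) => //; exact: subset_itv_oo_cc xab.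
    + apply: cvg_at_right_filter; apply: cA; rewrite in_itv/= lexx/=; exact: ltW.
    + apply: cvg_at_left_filter; apply: cA; rewrite in_itv/= lexx/= andbT; exact: ltW.
  - by move=> x /subset_itv_oo_cc /(dA n) [_ <-]; rewrite derive1E.
have mab : measurable (`[a, b] : set R) by [].
have qK n x : x \in `[a, b] -> `|q n x| <= K.
  rewrite in_itv/= => /andP[ax xb]; rewrite /q normrM normfV (gtr0_norm (h0 n)).
  rewrite ler_pdivrMl// mulrC.
  have -> : K * h n = K * (x + h n - x) by rewrite addrC addKr.
  have := h0 n; have := h1 n => hn1 hn0.
  by apply: (lipschitz_of_bounded_derivative cF K0 dF gK); lra.
have [|||||ig _ icvg] := @dominated_convergence _ _ _ leb _ mab
    (fun n => EFin \o q n) (EFin \o g) (cst K%:E).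
- move=> n; apply/measurable_EFinP; apply: measurable_funTS.
  exact: continuous_measurable_fun.
- by apply/measurable_EFinP; exact: measurable_funTS.
- exists [set c]; split => //; first exact: lebesgue_measure_set1.
  move=> x /= xN; apply: contrapT => /eqP xc; apply: xN => xab.
  apply/fine_cvgP; split; first by apply: nearW.
  apply: is_derive_cvg_harmonic; apply: dF => //.
  by move: xab; rewrite /= !in_itv/= => /andP[? ?]; apply/andP; split; lra.
- apply/integrableP; split => //; rewrite integral_cst//= lebesgue_measure_itv/=.
  by case: ifPn => _; rewrite ?mule0// -EFinD -EFinM ltry.
- by apply: aeW => x n xab /=; rewrite lee_fin; exact: qK.
split => //.
rewrite -(cvg_lim _ icvg)//; apply/cvg_lim => //=.
(* The integral of [q n] is the difference of the quotients of [G] at [b] and at [a], which converge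
   to [F b] and [F a]. *)
under eq_fun do rewrite qE.
apply/fine_cvgP; split; first by apply: nearW.
by apply: cvgB; apply: is_derive_cvg_harmonic; apply: dG; rewrite in_itv/=; apply/andP; split; lra.
Qed.

(** Subtracting [y] from [c] onwards yields a continuous [H] with the same derivative off [c]. Since
    [F] is right continuous at [c], the jump is already present in [F c], so it is gained when
    [a < c <= b]. *)
Lemma FTC_with_jump (F g : R -> R) (c y K a b : R) : a <= b -> 0 <= K ->
  measurable_fun [set: R] g ->
  (forall x, x != c -> is_derive x 1 F (g x)) ->
  F x @[x --> c^'+] --> F c -> F x @[x --> c^'-] --> F c - y ->
  (forall x, x \in `]a - 1, b + 2[ -> x != c -> `|g x| <= K) ->
  leb.-integrable `[a, b] (EFin \o g) /\
  F b - F a = (\int[leb]_(x in `[a, b]) g x)%R + (if a < c <= b then y else 0).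
Proof.
move=> ab K0 mg dF Fr Fl gK.
pose H x := F x - (if c <= x then y else 0).
have Hlt x : x < c -> H x = F x by move=> xc; rewrite /H leNgt xc/= subr0.
have Hge x : c <= x -> H x = F x - y by rewrite /H => ->.
have dH x : x != c -> is_derive x 1 H (g x).
  rewrite neq_lt => /orP[xc|cx].
    apply: (@near_eq_is_derive _ _ _ F) => //.
      by near=> z; apply/esym/Hlt; near: z; exact: lt_nbhsl.
    by apply: dF; rewrite lt_eqF.
  have ? : is_derive x 1 (fun z => F z - y) (g x).
    have ? : is_derive x 1 F (g x) by apply: dF; rewrite gt_eqF.
    by apply: is_derive_eq; rewrite subr0.
  apply: (@near_eq_is_derive _ _ _ (fun z => F z - y)) => //.
  by near=> z; apply/esym/Hge/ltW; near: z; exact: lt_nbhsr.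
have cH : continuous H.
  move=> x; have [->|xc] := eqVneq x c.
    apply/left_right_continuousP; split.
      rewrite (Hge c)//; apply: cvg_trans Fl; apply: near_eq_cvg.
      by near=> z; apply/esym/Hlt.
    rewrite (Hge c)//; apply: cvg_trans (cvgB Fr (cvg_cst y)); apply: near_eq_cvg.
    by near=> z; apply/esym/Hge/ltW.
  apply: differentiable_continuous; apply/derivable1_diffP.
  by have [] := dH _ xc.
have [ig gE] := bounded_derivative_FTC ab cH mg K0 (fun x _ => dH x) gK.
split => //; rewrite /Rintegral gE /= /H.
have [ac|ca] := ltP a c; have [cb|bc] := leP c b => /=; rewrite ?subr0 ?addr0 ?subrK//.
- by rewrite addrAC subrK.
- by rewrite opprB addrA subrK.
- by have := lt_le_trans bc (le_trans ca ab); rewrite ltxx.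
Unshelve. all: by end_near. Qed.

End fundamental_theorem.

(** * Measurability for matrices *)

Section matrix_measurability.
Context (R : realType).

Lemma continuous_measurable_fun_mx (m n : nat) (f : 'M[R]_(m, n) -> R) :
  continuous f -> measurable_fun [set: 'M[R]_(m, n)] f.
Proof.
move=> cf; apply: (measurability _ (@RGenOpens.measurableE R)) => _ [_ [a [b ->]] <-].
rewrite setTI; apply: sub_sigma_algebra.
by apply: open_comp; [move=> x _; exact: cf|exact: interval_open].
Qed.

Lemma measurable_coord (m n : nat) i j :
  measurable_fun [set: 'M[R]_(m, n)] (fun A : 'M[R]_(m, n) => A i j).
Proof. by apply: continuous_measurable_fun_mx; exact: coord_continuous. Qed.

(* Every open set of matrices is a countable union of cubes with rational
   centers and radii. *)
Lemma measurable_fun_mx dT (T : measurableType dT) (m n : nat)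
    (f : T -> 'M[R]_(m, n)) :
  (forall i j, measurable_fun [set: T] (fun x => f x i j)) ->
  measurable_fun [set: T] f.
Proof.
move=> mf; apply: (measurability _ (erefl (@measurable _ 'M[R]_(m, n)))) => _ [U oU <-]; rewrite setTI.
pose cube (q : 'M[rat]_(m, n) * nat) : set 'M[R]_(m, n) :=
  [set A | forall i j, `|A i j - ratr (q.1 i j)| < q.2.+1%:R^-1].
have cubeU : U = \bigcup_(q in [set q | cube q `<=` U]) cube q.
  apply/seteqP; split => [A UA|A [q /= + qA]]; last exact.
  have [e /= e0 eU] := (nbhs_ballP _ _).1 (open_nbhs_nbhs (conj oU UA)).
  have [k ke] : exists k : nat, k.+1%:R^-1 < e / 2.
    have := near_infty_natSinv_lt (PosNum (divr_gt0 e0 (ltr0n R 2))).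
    by move=> [k _ /(_ k (leqnn k))]; exists k.
  have [q qA] : exists q : 'M[rat]_(m, n), forall i j,
      `|A i j - ratr (q i j)| < k.+1%:R^-1.
    have rq (i : 'I_m) (j : 'I_n) : exists r : rat, `|A i j - ratr r| < k.+1%:R^-1.
      have [|r] := @rat_in_itvoo R (A i j - k.+1%:R^-1) (A i j + k.+1%:R^-1).
        by rewrite ltrBlDr -addrA ltrDl addr_gt0.
      rewrite in_itv/= => /andP[r1 r2]; exists r.
      by move: (ratr r : R) (k.+1%:R^-1 : R) (A i j) r1 r2 => x y z; rewrite ltr_norml; lra.
    have [q qP] := choice (fun ij => rq ij.1 ij.2).
    by exists (\matrix_(i, j) q (i, j)) => i j; rewrite mxE; exact: (qP (i, j)).
  exists (q, k) => //= B qB; apply: eU; split => // i j; rewrite /ball/=.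
  have := qA i j; have := qB i j => /= h1 h2.
  rewrite -(subrK (ratr (q i j)) (A i j)) -addrA (le_lt_trans (ler_normD _ _))//.
  by rewrite (distrC (ratr _)) [ltRHS]splitr ltrD//; exact: lt_trans ke.
rewrite cubeU preimage_bigcup; rewrite bigcup_mkcond.
apply: countable_bigcupT_measurable => [|q]; first exact: countableP.
case: ifPn => // _.
rewrite (_ : f @^-1` cube q = \bigcap_(ij in [set: 'I_m * 'I_n])
    ((fun x => `|f x ij.1 ij.2 - ratr (q.1 ij.1 ij.2)|) @^-1`
      [set y | y < q.2.+1%:R^-1])); last first.
  by apply/seteqP; split => [x fx [i j] _|x fx i j]; [exact: fx|exact: (fx (i, j))].
apply: fin_bigcap_measurable => // ij _.
rewrite (_ : [set y | _] = `]-oo, q.2.+1%:R^-1[%classic); last first.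
  by apply/seteqP; split => y /=; rewrite in_itv.
rewrite -[X in measurable X]setTI.
have mh : measurable_fun [set: T] (fun x => `|f x ij.1 ij.2 - ratr (q.1 ij.1 ij.2)|).
  by apply: measurableT_comp => //; exact: measurable_funB.
exact: mh.
Qed.

End matrix_measurability.

(** * Measurability of the set of matrices with spectrum in the open left half-plane *)

Section measurable_Mminus.
Context (R : realType) (d : nat).

(** With [z = a + ib] this is the squared modulus of [det(A - z)], written as a real determinant so
    that it is a polynomial in [a], [b] and the entries of [A]. *)
Definition resolvent_det (ab : R * R) (A : 'M[R]_d) : R :=
  \det (block_mx (A - ab.1%:M) (- ab.2%:M) ab.2%:M (A - ab.1%:M)).

(* For u, v real, (u + i v) A = (a + i b) (u + i v) iff the row (u, v) is in the
   kernel of the block matrix. *)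
Lemma eigenvalue_resolvent_det (A : 'M[R]_d) (z : R[i]) :
  eigenvalue (map_mx (real_complex R) A) z <->
  resolvent_det (complex.Re z, complex.Im z) A = 0.
Proof.
case: z => a b /=; rewrite /resolvent_det /=.
pose parts (u v : 'rV[R]_d) := forall j,
  (u *m A) 0 j = a * u 0 j - b * v 0 j /\ (v *m A) 0 j = b * u 0 j + a * v 0 j.
have complexE (u v : 'rV[R]_d) (w : 'rV[R[i]]_d) :
    (forall j, w 0 j = (u 0 j +i* v 0 j)%C) ->
    w *m map_mx (real_complex R) A = (a +i* b)%C *: w <-> parts u v.
  move=> wE.
  have reE j : complex.Re ((w *m map_mx (real_complex R) A) 0 j) = (u *m A) 0 j.
    rewrite !mxE raddf_sum; apply: eq_bigr => k _.
    by rewrite !mxE wE /=; ring.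
  have imE j : complex.Im ((w *m map_mx (real_complex R) A) 0 j) = (v *m A) 0 j.
    rewrite !mxE raddf_sum; apply: eq_bigr => k _.
    by rewrite !mxE wE /=; ring.
  split => [h j|h].
    by rewrite -reE -imE h !mxE wE /=; split; ring.
  apply/rowP => j; apply/eqP; rewrite eq_complex reE imE.
  by have [-> ->] := h j; rewrite !mxE wE /=; apply/andP; split; apply/eqP; ring.
have blockE (u v : 'rV[R]_d) :
    row_mx u v *m block_mx (A - a%:M) (- b%:M) b%:M (A - a%:M) = 0 <-> parts u v.
  rewrite mul_row_block !mulmxBr mulmxN !mul_mx_scalar.
  split => [h j|h].
    move: h; rewrite -row_mx0 => /eq_row_mx[h1 h2].
    have e1 : (u *m A - a *: u + b *: v) 0 j = 0 by rewrite h1 mxE.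
    have e2 : (- (b *: u) + (v *m A - a *: v)) 0 j = 0 by rewrite h2 mxE.
    move: e1 e2; rewrite !mxE => e1 e2; split; lra.
  rewrite -row_mx0; congr row_mx; apply/rowP => j; have [] := h j.
    by rewrite !mxE; lra.
  by rewrite !mxE; lra.
split.
  move=> /eigenvalueP[w wA w0]; apply/eqP/det0P.
  exists (row_mx (\row_j complex.Re (w 0 j)) (\row_j complex.Im (w 0 j))).
    apply: contra w0 => /eqP; rewrite -row_mx0 => /eq_row_mx[/rowP h1 /rowP h2].
    apply/eqP/rowP => j; have := h1 j; have := h2 j; rewrite !mxE.
    by case: (w 0 j) => /= ? ? -> ->.
  by apply/blockE/(complexE _ _ w) => // j; rewrite !mxE; case: (w 0 j).
move=> /eqP/det0P[uv uv0 uvM]; apply/eigenvalueP.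
move: uv0 uvM; rewrite -(hsubmxK uv).
set u := lsubmx uv; set v := rsubmx uv => uv0 /blockE h.
exists (\row_j (u 0 j +i* v 0 j)%C).
  by apply/(complexE u v) => // j; rewrite mxE.
apply: contra uv0 => /eqP/rowP w0; apply/eqP.
rewrite -row_mx0; congr row_mx; apply/rowP => j; have := w0 j; rewrite !mxE.
  by case.
by case.
Qed.

Lemma continuous_det (T : topologicalType) (k : nat) (M : T -> 'M[R]_k) :
  (forall i j, continuous (fun p => M p i j)) -> continuous (fun p => \det (M p)).
Proof.
move=> cM p; rewrite /determinant.
apply: cvg_big => [|s _]; first exact: add_continuous.
apply: cvgM; first exact: cvg_cst.
apply: cvg_big => [|i _]; first exact: mul_continuous.
exact: cM.
Qed.

Lemma continuous_resolvent_det :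
  continuous (fun p : (R * R) * 'M[R]_d => resolvent_det p.1 p.2).
Proof.
apply: continuous_det => i j p.
have cA (k l : 'I_d) : (fun q : (R * R) * 'M[R]_d => q.2 k l) q @[q --> p] --> p.2 k l.
  by apply: (@cvg_comp _ _ _ snd (fun A : 'M[R]_d => A k l)); [exact: cvg_snd|exact: coord_continuous].
have ca (k l : 'I_d) : (fun q : (R * R) * 'M[R]_d => q.1.1 *+ (k == l)) q @[q --> p] --> p.1.1 *+ (k == l).
  apply: cvgMn; apply: (@cvg_comp _ _ _ fst fst); exact: cvg_fst.
have cb (k l : 'I_d) : (fun q : (R * R) * 'M[R]_d => q.1.2 *+ (k == l)) q @[q --> p] --> p.1.2 *+ (k == l).
  apply: cvgMn; apply: (@cvg_comp _ _ _ fst snd); [exact: cvg_fst|exact: cvg_snd].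
rewrite /block_mx /continuous_at; under eq_fun do rewrite !mxE; rewrite !mxE.
case: (fintype.split i) => k.
  under eq_fun do rewrite !mxE; rewrite !mxE.
  case: (fintype.split j) => l; under eq_fun do rewrite !mxE; rewrite !mxE.
    exact: cvgB.
  exact: cvgN.
under eq_fun do rewrite !mxE; rewrite !mxE.
case: (fintype.split j) => l; under eq_fun do rewrite !mxE; rewrite !mxE.
  exact: cb.
exact: cvgB.
Qed.

(** The closed right half-plane is exhausted by the compact rectangles [rect k]. Having no
    eigenvalue in a compact set is an open condition on [A]: the determinant is jointly continuous,
    and compactness makes the neighbourhood of [A] uniform in the eigenvalue. *)
Lemma measurable_Mminus : measurable (@Mminus R d).
Proof.
pose rect (k : nat) : set (R * R) := `[0, k%:R] `*` `[- k%:R, k%:R].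
rewrite (_ : @Mminus R d = \bigcap_k
    [set A | forall ab, rect k ab -> resolvent_det ab A != 0]); last first.
  apply/seteqP; split => [A AM k _ [a b] [/= + _]|A hA z /eigenvalue_resolvent_det z0].
    rewrite in_itv/= => /andP[a0 _]; apply/eqP => /(eigenvalue_resolvent_det A (a +i* b)%C).
    by move/AM => /=; rewrite ltNge a0.
  rewrite ltNge; apply/negP => z_ge0.
  have [k zk] : exists k : nat, Num.max `|complex.Re z| `|complex.Im z| <= k%:R.
    exists (Num.bound (Num.max `|complex.Re z| `|complex.Im z|)).
    by apply/ltW/archi_boundP; rewrite le_max normr_ge0.
  move: zk; rewrite ge_max => /andP[rk ik].
  have /= := hA k I (complex.Re z, complex.Im z); rewrite z0 eqxx => /(_ _)/negP; apply => //.
  split; rewrite /= in_itv/=; first by rewrite z_ge0 (le_trans (ler_norm _)).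
  by rewrite -ler_norml.
apply: bigcapT_measurable => k; apply: sub_sigma_algebra.
rewrite openE => A /= hA; rewrite /interior.
have : compact (rect k) by apply: compact_setX; exact: segment_compact.
move=> /compact_near_coveringP /(_ _ (nbhs A) (fun B ab => resolvent_det ab B != 0) _).
apply => ab rab.
have : \forall p \near (ab, A), resolvent_det p.1 p.2 != 0.
  apply: (@continuous_resolvent_det (ab, A)) (fun x : R => x != 0) _.
  by apply: open_nbhs_nbhs; split; [exact: open_neq|exact: hA].
move=> [[U V] [/= abU AV] UV].
by exists (U, V) => // -[ab' B] /= UVab; exact: (UV (ab', B)).
Qed.

End measurable_Mminus.

(** The hypothesis makes both [V] and [f + V] nondecreasing, and [f] is their difference. *)
Lemma bounded_variation_increment (R : realType) (f V : R -> R) (a b : R) : a <= b ->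
  (forall c e, a <= c -> c <= e -> e <= b -> `|f e - f c| <= V e - V c) ->
  bounded_variation a b f.
Proof.
rewrite le_eqVlt => /predU1P[<- _|ab fV]; first exact: bounded_variationxx.
rewrite (_ : f = (f \+ V) \+ (\- V)); last first.
  by apply/funext => x /=; rewrite addrK.
apply: bounded_variationD => //.
  apply: nondecreasing_bounded_variation => x e.
  rewrite !in_itv/= => /andP[ax _] /andP[_ eb] xe.
  have := fV _ _ ax xe eb; rewrite ler_norml => /andP[+ _]; lra.
apply: bounded_variationN => //.
apply: nondecreasing_bounded_variation => x e.
rewrite !in_itv/= => /andP[ax _] /andP[_ eb] xe.
have := fV _ _ ax xe eb; have := normr_ge0 (f e - f x); lra.
Qed.

(** * Superpositions of paths with one jump each *)

Section superposition.
Context (R : realType) dT (T : measurableType dT).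
Variable m : {sigma_finite_measure set T -> \bar R}.
Variables (phi psi : R -> T -> R) (sigma y : T -> R).
Notation leb := (@lebesgue_measure R).
Hypotheses (mpsi : measurable_fun [set: T * R] (fun q => psi q.2 q.1))
  (msigma : measurable_fun [set: T] sigma) (my : measurable_fun [set: T] y).
Hypothesis iphi0 : m.-integrable [set: T] (EFin \o phi 0).
Hypothesis ipsi : forall M : R,
  (\int[m]_p \int[leb]_(u in `[(- M)%R, M]) (`|psi u p|%R)%:E < +oo)%E.
Hypothesis iy : forall M : R,
  (\int[m]_p (if (`|sigma p| <= M)%R then (`|y p|%R)%:E else 0) < +oo)%E.
Hypothesis phiE : forall p a b, a <= b ->
  leb.-integrable `[a, b] (fun u => (psi u p)%:E) /\
  phi b p - phi a p = (\int[leb]_(u in `[a, b]) psi u p)%R +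
                      (if a < sigma p <= b then y p else 0).

Let Phi t := (\int[m]_p phi t p)%R.
Let Psi u := (\int[m]_p psi u p)%R.
Let jump a b p := if a < sigma p <= b then y p else 0.

(** The restriction to [[a, b]] is carried by an indicator, so that Fubini's theorem is applied on
    the whole of [T * R]. *)
Let window a b (q : T * R) : R := psi q.2 q.1 * \1_(`[a, b]) q.2.

Let measurable_window a b : measurable_fun [set: T * R] (EFin \o window a b).
Proof.
apply/measurable_EFinP; apply: measurable_funM => //.
by apply: measurableT_comp => //; exact: measurable_indic.
Qed.

Let windowE (F : R -> \bar R) a b (h : R -> R) :
  (forall u, F u = (h u * \1_(`[a, b]) u)%:E) ->
  (\int[leb]_u F u = \int[leb]_(u in `[a, b]) (h u)%:E)%E.
Proof.
move=> FE; rewrite [RHS]integral_mkcond; apply: eq_integral => u _.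
by rewrite FE patchE indicE; case: ifPn => uab; rewrite ?mulr1 ?mulr0.
Qed.

Let integrable_window a b : a <= b ->
  (m \x leb)%E.-integrable [set: T * R] (EFin \o window a b).
Proof.
move=> ab; apply/integrable12ltyP; first exact: measurable_window.
pose M : R := Num.max `|a| `|b|.
apply: le_lt_trans (ipsi M).
apply: le_lower_integral => p _.
  by apply: integral_ge0.
rewrite (@windowE _ a b (fun u => `|psi u p|)); last first.
  move=> u /=; rewrite /window /= indicE; case: (_ \in _); rewrite ?mulr1 ?mulr0//.
  by rewrite normr0.
apply: ge0_subset_integral => //.
- apply/measurable_EFinP; apply: measurable_funTS.
  apply: measurableT_comp => //.
  exact: (measurableT_comp mpsi (measurable_pair1 p)).
- apply: subset_itv; rewrite bnd_simp /M.
    by rewrite lerNl le_max -lerNl lerNnormlW// orbC.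
  by rewrite le_max ler_norm orbT.
Qed.

Let D a b p := (\int[leb]_(u in `[a, b]) psi u p)%R.

Let DE a b p : a <= b -> (D a b p)%:E = (\int[leb]_u (window a b (p, u))%:E)%E.
Proof.
move=> ab; rewrite (@windowE _ a b (psi ^~ p))// /D /Rintegral fineK//.
by apply: integrable_fin_num => //; have [] := phiE p ab.
Qed.

Let integrable_D a b : a <= b -> m.-integrable [set: T] (EFin \o D a b).
Proof.
move=> ab; apply: eq_integrable (integrable_fubini_F (integrable_window ab)) => //.
by move=> p _; rewrite /= DE.
Qed.

Let measurable_jump a b : measurable_fun [set: T] (jump a b).
Proof.
apply: measurable_fun_ifT => //; apply: measurable_and.
  exact: measurable_fun_ltr.
exact: measurable_fun_ler.
Qed.

Let integrable_bounded_jump (M : R) :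
  m.-integrable [set: T] (fun p => (if (`|sigma p| <= M)%R then (`|y p|%R)%:E else 0)%E).
Proof.
apply/integrableP; split.
  apply: measurable_fun_ifT => //; last exact/measurable_EFinP/measurableT_comp.
  by apply: measurable_fun_ler => //; exact: measurableT_comp.
under eq_integral => p _.
  rewrite gee0_abs; last by case: ifPn.
  over.
exact: iy.
Qed.

Let jump_le a b p : ((`|jump a b p|%R)%:E <=
  if (`|sigma p| <= Num.max `|a| `|b|)%R then (`|y p|%R)%:E else 0)%E.
Proof.
rewrite /jump; case: ifPn => [/andP[sa sb]|_]; last first.
  by rewrite normr0; case: ifP => _; rewrite ?lee_fin.
rewrite ifT// ler_norml lerNl 2!le_max (le_trans sb (ler_norm b)) orbT andbT.
rewrite (@le_trans _ _ (- a))//; first by rewrite lerN2 ltW.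
by rewrite -normrN ler_norm.
Qed.

Let integrable_jump a b : m.-integrable [set: T] (EFin \o jump a b).
Proof.
apply: le_integrable (integrable_bounded_jump (Num.max `|a| `|b|)) => //.
  exact/measurable_EFinP.
move=> p _ /=; apply: le_trans (jump_le a b p) _.
by case: ifPn => // _; rewrite /= normr_id.
Qed.

Let phi_shift a b p : a <= b -> phi b p = phi a p + (D a b p + jump a b p).
Proof. by move=> /(phiE p)[_ /eqP]; rewrite subr_eq => /eqP ->; rewrite addrC. Qed.

Let integrable_shift a b : a <= b ->
  m.-integrable [set: T] (EFin \o (fun p => D a b p + jump a b p)).
Proof.
move=> ab; rewrite (_ : _ \o _ = (EFin \o D a b) \+ (EFin \o jump a b))%E//.
by apply: integrableD => //; exact: integrable_D.
Qed.

Lemma superposition_integrable t : m.-integrable [set: T] (EFin \o phi t).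
Proof.
have [t0|t0] := leP 0 t.
  rewrite (_ : _ \o _ = (EFin \o phi 0) \+ (EFin \o (fun p => D 0%R t p + jump 0%R t p)%R))%E.
    by apply: integrableD => //; exact: integrable_shift.
  by apply/funext => p /=; rewrite (phi_shift p t0).
rewrite (_ : _ \o _ = (EFin \o phi 0) \- (EFin \o (fun p => D t 0%R p + jump t 0%R p)%R))%E.
  by apply: integrableB => //; exact/integrable_shift/ltW.
by apply/funext => p /=; rewrite (phi_shift p (ltW t0)) -EFinB addrK.
Qed.

Let ae_integrable_psi a b : a <= b ->
  {ae leb, forall u, u \in `[a, b] -> m.-integrable [set: T] (EFin \o psi u)}.
Proof.
move=> ab; have := ae_integrable2 (integrable_window ab).
apply: filterS => u iu uab; apply: eq_integrable iu => // p _.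
by rewrite /window /= indicE mem_set// mulr1.
Qed.

(** [Psi u] takes the conventional value 0 where the integral is infinite, so it agrees with the
    inner integral of Fubini's theorem only at almost every [u]. *)
Let PsiE a b : a <= b ->
  {ae leb, forall u, [set: R] u ->
    (Psi u * \1_(`[a, b]) u)%:E = (\int[m]_p (window a b (p, u))%:E)%E}.
Proof.
move=> ab; have := ae_integrable_psi ab.
apply: (@filterS _ _ (ae_filter_ringOfSetsType leb)) => u iu _; rewrite /window/= indicE.
have [uab|uab] := boolP (u \in _); last first.
  by rewrite mulr0; under eq_integral do rewrite mulr0; rewrite integral0.
rewrite mulr1; under eq_integral do rewrite mulr1.
rewrite /Psi /Rintegral fineK//; apply: integrable_fin_num => //; apply: iu.
by move: uab; rewrite inE.
Qed.

Let measurable_Psi a b : a <= b -> measurable_fun [set: R] (fun u => Psi u * \1_(`[a, b]) u).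
Proof.
move=> ab; rewrite (_ : (fun u => _) =
    (fun u => fine (\int[m]_p (window a b (p, u))%:E)%E)).
  by apply: measurableT_comp => //; exact: measurable_fubini_G (integrable_window ab).
apply/funext => u; rewrite /window /= indicE.
case: (u \in _); first by rewrite mulr1; under eq_integral do rewrite mulr1.
by rewrite mulr0; under eq_integral do rewrite mulr0; rewrite integral0.
Qed.

(** [|Psi u|] lies below the integral of [|psi u|] at almost every [u] of the window, and the time
    integral of the latter is finite by Tonelli's theorem. *)
Lemma superposition_derivative_integrable a b : a <= b ->
  leb.-integrable `[a, b] (EFin \o Psi).
Proof.
move=> ab; apply/integrable_mkcond => //.
have mG := measurable_fubini_G (integrable_window ab).
suff iW : leb.-integrable [set: R] (fun u => (Psi u * \1_(`[a, b]) u)%:E).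
  apply: eq_integrable iW => // u _; rewrite patchE indicE.
  by case: ifPn; rewrite ?mulr1 ?mulr0.
apply/integrableP; split; first by apply/measurable_EFinP; exact: measurable_Psi.
have : (\int[leb]_u \int[m]_p `|(EFin \o window a b) (p, u)| < +oo)%E.
  by apply/integrable21ltyP; [exact: measurable_window|exact: integrable_window].
apply: le_lt_trans.
have mabs : measurable_fun [set: T * R] (fun q => `|(window a b q)%:E|)%E.
  by apply: measurableT_comp => //; exact: measurable_window.
have mP : measurable_fun [set: R] (fun u => (Psi u * \1_(`[a, b]) u)%:E).
  by apply/measurable_EFinP; exact: measurable_Psi.
apply: (@le_trans _ _ (\int[leb]_u `|\int[m]_p (window a b (p, u))%:E|)%E).
  rewrite le_eqVlt; apply/orP; left; apply/eqP; apply: ae_eq_integral => //.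
  - exact: (measurableT_comp (@abse_measurable _ setT) mP).
  - exact: (measurableT_comp (@abse_measurable _ setT) mG).
  - have := PsiE ab.
    by apply: (@filterS _ _ (ae_filter_ringOfSetsType leb)) => u /[apply] ->.
apply: ge0_le_integral => //.
- exact: (measurableT_comp (@abse_measurable _ setT) mG).
- exact: (measurable_fun_fubini_tonelli_G (m1 := m) _ mabs).
- move=> u _; apply: le_abse_integral => //.
  exact: (measurableT_comp (measurable_window a b) (measurable_pair2 u)).
Qed.

Lemma superposition_increment a b : a <= b ->
  Phi b - Phi a = (\int[leb]_(u in `[a, b]) Psi u)%R + (\int[m]_p jump a b p)%R.
Proof.
move=> ab.
rewrite -RintegralB//; try exact: superposition_integrable.
rewrite (_ : \int[leb]_(u in `[a, b]) Psi u = \int[m]_p D a b p)%R; last first.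
  congr fine; rewrite -(@windowE (fun u => (Psi u * \1_(`[a, b]) u)%:E))//.
  under [RHS]eq_integral do rewrite DE//.
  rewrite (Fubini (integrable_window ab)).
  apply: ae_eq_integral => //.
  - by apply/measurable_EFinP; exact: measurable_Psi.
  - exact: measurable_fubini_G (integrable_window ab).
  - exact: PsiE.
rewrite -RintegralD//; last exact: integrable_D.
by apply: eq_Rintegral => p _; rewrite (phi_shift p ab) addrC addKr.
Qed.

Let jump_cvg (f : nat -> T -> R) (g : T -> R) (M : R) :
  (forall n, measurable_fun [set: T] (f n)) -> measurable_fun [set: T] g ->
  (forall p, f n p @[n --> \oo] --> g p) ->
  (forall n p, (`|f n p|%R)%:E <= (if (`|sigma p| <= M)%R then (`|y p|%R)%:E else 0))%E ->
  (\int[m]_p f n p)%R @[n --> \oo] --> (\int[m]_p g p)%R.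
Proof.
move=> mf mg fg fM.
have [||||ig _ icvg] := @dominated_convergence _ _ _ m _ measurableT
    (fun n => EFin \o f n) (EFin \o g) _ _ _ _ (integrable_bounded_jump M).
- by move=> n; exact/measurable_EFinP.
- exact/measurable_EFinP.
- by apply: aeW => p _; apply: cvg_EFin; [exact: nearW|exact: fg].
- by apply: aeW => p n _; exact: fM.
by apply: fine_cvg; rewrite /Rintegral fineK//; exact: integrable_fin_num.
Qed.

(** One-sided limits are taken along sequences, so that dominated convergence applies to the jump
    part; the integral of [Psi] is continuous in its upper bound. *)
Lemma superposition_cadlag t :
  Phi x @[x --> t^'+] --> Phi t /\ cvg (Phi x @[x --> t^'-]).
Proof.
have PhiE a b : a <= b -> Phi b =
    Phi a + ((\int[leb]_(u in `[a, b]) Psi u)%R + (\int[m]_p jump a b p)%R).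
  by move=> /superposition_increment <-; rewrite addrC subrK.
have jump_bound (u : nat -> R) a : u n @[n --> \oo] --> t ->
    exists M : R, forall n p,
    ((`|jump a (u n) p|%R)%:E <= if (`|sigma p| <= M)%R then (`|y p|%R)%:E else 0)%E.
  move=> ut; have [M [_ uM]] := cvg_seq_bounded (cvgP _ ut).
  exists (Num.max `|a| (M + 1)) => n p; apply: le_trans (jump_le a (u n) p) _.
  case: ifPn => [sM|_]; last by case: ifPn => // _; rewrite lee_fin.
  rewrite ifT//; apply: le_trans sM _.
  have uM1 : `|u n| <= M + 1 by apply: (uM (M + 1)) => //; rewrite ltrDl.
  by rewrite ge_max !le_max lexx/= uM1 orbT.
split.
- have iPsi : leb.-integrable `[t, t + 1] (EFin \o Psi).
    by apply: superposition_derivative_integrable; rewrite lerDl.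
  have ac : parameterized_integral leb t x Psi @[x --> t^'+] --> (0 : R).
    apply: cvg_at_right_filter; apply: (parameterized_integral_cvg_left _ iPsi).
    by rewrite ltrDl.
  have jc : (\int[m]_p jump t x p)%R @[x --> t^'+] --> (0 : R).
    apply/cvg_at_rightP => u [ut cu]; have [M uM] := jump_bound _ t cu.
    rewrite -[X in _ --> X](_ : (\int[m]_p (0 : R))%R = 0); last first.
      by rewrite /Rintegral integral0.
    apply: (jump_cvg (M := M)) => // p.
    (* Pointwise, the jump over []t, u n]] is eventually 0: a time [sigma p > t] is eventually
       beyond [u n], and a time at most [t] is never counted. *)
    apply: cvg_near_cst; rewrite /jump; have [ts|st] := ltP t (sigma p); last exact: nearW.
    by near=> n; rewrite leNgt (_ : u n < sigma p)//; near: n; exact: cvgr_lt cu _ ts.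
  have h : Phi t + (parameterized_integral leb t x Psi + (\int[m]_p jump t x p)%R)
      @[x --> t^'+] --> Phi t + (0 + 0).
    by apply: cvgD; [exact: cvg_cst|exact: cvgD].
  rewrite !addr0 in h; apply: cvg_trans h; apply: near_eq_cvg; near=> x => /=.
  by rewrite [RHS](PhiE t)// ltW.
- have iPsi : leb.-integrable `[t - 1, t] (EFin \o Psi).
    by apply: superposition_derivative_integrable; rewrite gerBl.
  have ac := parameterized_integral_cvg_at_left _ iPsi.
  (* The sequences stay strictly below [t], so the jumps over []t - 1, u n]] converge to those over
     the open []t - 1, t[]: the ones at [t] itself are left out. *)
  pose g p : R := if t - 1 < sigma p < t then y p else 0.
  have jc : (\int[m]_p jump (t - 1) x p)%R @[x --> t^'-] --> (\int[m]_p g p)%R.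
    apply/cvg_at_leftP => u [ut cu]; have [M uM] := jump_bound _ (t - 1) cu.
    apply: (jump_cvg (M := M)) => //.
      apply: measurable_fun_ifT => //; apply: measurable_and; exact: measurable_fun_ltr.
    move=> p; apply: cvg_near_cst; rewrite /jump /g.
    have [st|ts] := ltP (sigma p) t.
      near=> n; rewrite (_ : sigma p <= u n)// ltW//.
      by near: n; exact: cvgr_gt cu _ st.
    by near=> n; rewrite leNgt (lt_le_trans (ut n) ts).
  have h : Phi (t - 1) + (parameterized_integral leb (t - 1) x Psi +
      (\int[m]_p jump (t - 1) x p)%R) @[x --> t^'-] --> Phi (t - 1) +
      (parameterized_integral leb (t - 1) t Psi + (\int[m]_p g p)%R).
    by apply: cvgD; [exact: cvg_cst|apply: cvgD => //; apply: ac; rewrite gtrBl].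
  apply/cvg_ex; eexists; apply: cvg_trans h.
  apply: near_eq_cvg; near=> x => /=; rewrite [RHS](PhiE (t - 1))// ltW//.
  by near: x; apply: nbhs_left_gt; rewrite gtrBl.
Unshelve. all: by end_near. Qed.

Lemma superposition_bounded_variation a b : a <= b -> bounded_variation a b Phi.
Proof.
move=> ab.
pose V t := (\int[leb]_(u in `[a, t]) `|Psi u|)%R + (\int[m]_p `|jump a t p|)%R.
apply: (@bounded_variation_increment _ _ V) => // c e ac ce eb.
have iPsi := superposition_derivative_integrable (le_trans ac ce).
have iaPsi : leb.-integrable `[a, e] (EFin \o (fun u => `|Psi u|)).
  exact: integrable_abse iPsi.
have iaj x z : m.-integrable [set: T] (EFin \o (fun p => `|jump x z p|)).
  exact: integrable_abse (integrable_jump x z).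
have -> : V e - V c = (\int[leb]_(u in `[c, e]) `|Psi u|)%R + (\int[m]_p `|jump c e p|)%R.
  rewrite /V opprD addrACA; congr (_ + _).
    rewrite Rintegral_itvB// ?bnd_simp// Rintegral_itv_obnd_cbnd//.
    by apply: integrableS iaPsi => //; apply: subset_itvr; rewrite bnd_simp.
  rewrite -RintegralB//; apply: eq_Rintegral => p _; rewrite /jump.
  have [sc|cs] := leP (sigma p) c; have [se|es] := leP (sigma p) e;
    have [sa|as_] := ltP a (sigma p) => /=; rewrite ?normr0 ?subrr ?subr0//; lra.
rewrite superposition_increment//; apply: le_trans (ler_normD _ _) _.
apply: lerD; apply: le_normr_Rintegral => //.
exact: superposition_derivative_integrable.
Qed.

End superposition.

(** * Poisson random measures *)

Lemma poisson_prob_total (R : realType) (r : R) :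
  (\sum_(0 <= j <oo) poisson_prob r 0 [set j] = 1)%E.
Proof.
rewrite -(@probability_setT _ _ _ (poisson_prob r 0)).
rewrite (_ : setT = \bigcup_j [set j]); last by apply/seteqP; split => // j _; exists j.
rewrite measure_semi_bigcup//.
by apply/trivIsetP => i j _ _ ij; apply/seteqP; split => // x [/= ->] /eqP; rewrite (negbTE ij).
Qed.

Section poisson_random_measures.
Context (R : realType) dO (Omega : measurableType dO) (P : probability Omega R)
  dE (E : measurableType dE) (mu : {measure set E -> \bar R})
  (N : Omega -> {measure set E -> \bar R}).
Hypothesis NP : poisson_random_measure P mu N.

Let measurable_N B : measurable B -> measurable_fun [set: Omega] (fun w => N w B).
Proof. by case: NP => /(_ B). Qed.

Let level B (j : nat) : set Omega := [set w | N w B = j%:R%:E].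

Let measurable_level B j : measurable B -> measurable (level B j).
Proof.
move=> mB; rewrite -[X in measurable X]setTI.
exact: (measurable_N mB) (emeasurable_set1 _).
Qed.

Let trivIset_level B : trivIset [set: nat] (level B).
Proof.
move=> i j _ _ [w [/= wi wj]]; move: wj; rewrite /level /= in wi *.
by rewrite wi => -[] /eqP; rewrite eqr_nat => /eqP.
Qed.

(** The probabilities of the integer values sum to 1, which leaves no mass to any other value of a
    measure, [+oo] included. *)
Lemma poisson_random_measure_nat B : measurable B -> (mu B < +oo)%E ->
  {ae P, forall w, exists j : nat, N w B = j%:R%:E}.
Proof.
move=> mB muB; have [_ NB _ _] := NP.
have PT : P (\bigcup_j level B j) = 1%E.
  rewrite measure_semi_bigcup; last 3 first.
  - by move=> j; exact: measurable_level.
  - exact: trivIset_level.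
  - by apply: bigcupT_measurable => j; exact: measurable_level.
  transitivity (\sum_(0 <= j <oo) poisson_prob (fine (mu B)) 0 [set j])%E.
    by apply: eq_eseriesr => j _; exact: NB.
  exact: poisson_prob_total.
exists (~` \bigcup_j level B j); split.
- by apply: measurableC; apply: bigcupT_measurable => j; exact: measurable_level.
- rewrite probability_setC ?PT ?subee//.
  by apply: bigcupT_measurable => j; exact: measurable_level.
- by move=> w /= + [j _ jw]; apply; exists j.
Qed.

Lemma poisson_random_measure_null B : measurable B -> mu B = 0%E ->
  {ae P, forall w, N w B = 0%E}.
Proof.
move=> mB muB; have [_ NB _ _] := NP.
have PT : P (level B 0) = 1%E.
  by rewrite NB ?muB// /poisson_prob /= ltxx diracE mem_set.
exists (~` level B 0); split.
- by apply: measurableC; exact: measurable_level.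
- by rewrite probability_setC ?PT ?subee//; exact: measurable_level.
- by move=> w /= + h; apply.
Qed.

(** Index shift: [j + 1] times the weight of [j + 1] is [r] times the weight of [j]. The rate 0 is
    separate, [poisson_prob 0] being a Dirac mass. *)
Lemma poisson_mean (r : R) : 0 <= r ->
  (\sum_(0 <= j <oo) j%:R%:E * poisson_prob r 0 [set j] = r%:E)%E.
Proof.
rewrite le_eqVlt => /predU1P[<-|r0].
  apply: eseries0 => j _ _; rewrite /poisson_prob ltxx diracE.
  case: j => [|j]; first by rewrite mul0e.
  by rewrite memNset ?mule0.
have pE j : poisson_prob r 0 [set j] = (poisson_pmf r j)%:E.
  by rewrite /poisson_prob r0 esum_set1// lee_fin poisson_pmf_ge0.
rewrite nneseries_recl//; last by move=> j _; rewrite mule_ge0// pE lee_fin poisson_pmf_ge0.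
rewrite mul0e add0e.
have sum1 : (\sum_(0 <= j <oo) (poisson_pmf r j)%:E = 1)%E.
  by rewrite -(poisson_prob_total r); apply: eq_eseriesr => j _; rewrite pE.
transitivity (\sum_(0 <= j <oo) r%:E * (poisson_pmf r j)%:E)%E; last first.
  by rewrite nneseriesZl ?sum1 ?mule1// => j _; rewrite lee_fin poisson_pmf_ge0.
rewrite -(nneseries_addn 1); last first.
  by move=> j; rewrite mule_ge0// lee_fin.
apply: eq_eseriesr => j _; rewrite pE addn1 -!EFinM; congr EFin.
rewrite /poisson_pmf r0 factS natrM exprS.
have : (j.+1%:R : R) != 0 by rewrite pnatr_eq0.
have : (j`!%:R : R) != 0 by rewrite pnatr_eq0 -lt0n fact_gt0.
move=> h1 h2; field; exact/andP.
Qed.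

Lemma poisson_random_measure_expectation B : measurable B -> (mu B < +oo)%E ->
  (\int[P]_w N w B = mu B)%E.
Proof.
move=> mB muB; have [_ NB _ _] := NP.
(* Almost surely [N w B] is the sum over [j] of [j] times the indicator of [level B j], and this
   series can be integrated term by term. *)
have -> : (\int[P]_w N w B = \int[P]_w
    \sum_(0 <= j <oo) (j%:R * \1_(level B j) w)%:E)%E.
  apply: ae_eq_integral => //.
  - exact: measurable_N.
  - apply: ge0_emeasurable_sum => //.
    move=> j _; apply/measurable_EFinP; apply: measurable_funM => //.
    by apply: measurable_indic; exact: measurable_level.
  - have := poisson_random_measure_nat mB muB.
    apply: filterS => w [k kw] _; rewrite kw.
    rewrite (@nneseriesD1 _ _ k)//.
    rewrite indicE mem_set// mulr1 eseries0 ?adde0// => j _ jk.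
    rewrite indicE memNset ?mulr0// /level /= kw => /eqP.
    by rewrite eqe eqr_nat eq_sym (negbTE jk).
rewrite integral_nneseries//; last first.
  move=> j; apply/measurable_EFinP; apply: measurable_funM => //.
  by apply: measurable_indic; exact: measurable_level.
rewrite -[RHS]fineK ?ge0_fin_numE//.
rewrite -poisson_mean ?fine_ge0//; apply: eq_eseriesr => j _.
under eq_integral do rewrite EFinM.
rewrite ge0_integralZl//; last first.
  by apply/measurable_EFinP; apply: measurable_indic; exact: measurable_level.
rewrite integral_indic// ?setIT; last exact: measurable_level.
by congr (_ * _)%E; exact: NB.
Qed.

Lemma measurable_integral_N (F : E -> \bar R) : (forall x, 0 <= F x)%E ->
  measurable_fun [set: E] F -> measurable_fun [set: Omega] (fun w => \int[N w]_x F x)%E.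
Proof. by move=> F0 mF; exact: measurable_fun_integral_kernel. Qed.

Import HBNNSimple.

Let campbell_nnsfun (h : {nnsfun E >-> R}) : (\int[mu]_x (h x)%:E < +oo)%E ->
  (\int[P]_w \int[N w]_x (h x)%:E <= \int[mu]_x (h x)%:E)%E.
Proof.
move=> hfin.
have intE (m : {measure set E -> \bar R}) : (\int[m]_x (h x)%:E =
    \sum_(r \in range h) r%:E * m (h @^-1` [set r]))%E.
  under eq_integral do rewrite fimfunE -fsumEFin//.
  rewrite ge0_integral_fsum//.
  - apply: eq_fsbigr => r _.
    under eq_integral do rewrite EFinM.
    rewrite integralZl_indic_nnsfun// integral_indic//= setIT//.
  - by move=> r; apply/measurable_EFinP; apply: measurable_funM.
  - by move=> r x _; rewrite EFinM nnfun_muleindic_ge0.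
have -> : (\int[P]_w \int[N w]_x (h x)%:E = \int[P]_w
    \sum_(r \in range h) r%:E * N w (h @^-1` [set r]))%E.
  by apply: eq_integral => w _; exact: intE.
rewrite ge0_integral_fsum//; last 2 first.
  - by move=> r; apply: emeasurable_funM => //; exact: measurable_N.
  - move=> r w _; have [r0|r0] := leP 0 r; first by rewrite mule_ge0.
    rewrite (_ : h @^-1` [set r] = set0) ?measure0 ?mule0//.
    by apply/seteqP; split => // x /= xr; move: r0; rewrite -xr ltNge fun_ge0.
rewrite intE; apply: lee_fsum => // r [x _ hxr].
have r0 : 0 <= r by rewrite -hxr fun_ge0.
rewrite ge0_integralZl//; last by apply: measurable_N.
have [->|rn0] := eqVneq r 0; first by rewrite !mul0e.
have mr : measurable (h @^-1` [set r]) by [].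
rewrite poisson_random_measure_expectation//.
(* The mean of [N w] on a level set of [h] is known when the intensity of that set is finite; as
   [r > 0], this follows from [r] times the intensity being at most the integral of [h]. *)
have r_gt0 : (0 < r%:E)%E by rewrite lte_fin lt_neqAle eq_sym rn0.
rewrite -(@lte_pmul2l _ r%:E)// gt0_muley//.
apply: le_lt_trans hfin; rewrite -(setIT (h @^-1` _)) -integral_indic//.
rewrite -ge0_integralZl//; last first.
  by apply/measurable_EFinP; exact: measurable_indic.
apply: le_lower_integral => z _; rewrite -EFinM lee_fin.
  by rewrite mulr_ge0.
rewrite indicE; have [|_] := boolP (z \in _); last by rewrite mulr0 fun_ge0.
by rewrite inE mulr1 => <-.
Qed.

(** The simple functions increasing to [F] have finite integrals because [F] has one, so the case of
    simple functions applies to each of them; monotone convergence under [N w] and then under [P]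
    concludes. *)
Lemma campbell (F : E -> \bar R) : (forall x, 0 <= F x)%E ->
  measurable_fun [set: E] F -> (\int[mu]_x F x < +oo)%E ->
  (\int[P]_w \int[N w]_x F x <= \int[mu]_x F x)%E.
Proof.
move=> F0 mF Ffin; pose h := nnsfun_approx measurableT mF.
have FE (m : {measure set E -> \bar R}) :
    (\int[m]_x F x = limn (fun n => \int[m]_x (h n x)%:E))%E.
  rewrite -monotone_convergence//.
  - by apply: eq_integral => x _; apply/esym/cvg_lim => //; exact: cvg_nnsfun_approx.
  - by move=> n; exact/measurable_EFinP.
  - by move=> n x _; rewrite lee_fin.
  - by move=> x _ a b ab; rewrite lee_fin; exact/lefP/nd_nnsfun_approx.
rewrite (eq_integral (fun w => limn (fun n => \int[N w]_x (h n x)%:E)%E)); last first.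
  by move=> w _; exact: FE.
have ndh (m : {measure set E -> \bar R}) :
    {homo (fun n => \int[m]_x (h n x)%:E)%E : a b / (a <= b)%N >-> (a <= b)%E}.
  move=> a b ab; apply: ge0_le_integral => //.
  - by move=> x _; rewrite lee_fin.
  - exact/measurable_EFinP.
  - exact/measurable_EFinP.
  - by move=> x _; rewrite lee_fin; exact/lefP/nd_nnsfun_approx.
rewrite monotone_convergence//; last 2 first.
  - move=> n; apply: measurable_integral_N; first by move=> x; rewrite lee_fin.
    exact/measurable_EFinP.
  - by move=> n w _; apply: integral_ge0 => x _; rewrite lee_fin.
apply: lime_le.
  apply: ereal_nondecreasing_is_cvgn => a b ab; apply: ge0_le_integral => //.
  - by move=> w _; apply: integral_ge0 => x _; rewrite lee_fin.
  - apply: measurable_integral_N; first by move=> x; rewrite lee_fin.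
    exact/measurable_EFinP.
  - apply: measurable_integral_N; first by move=> x; rewrite lee_fin.
    exact/measurable_EFinP.
  - by move=> w _; exact: ndh.
apply: nearW => n.
have hF : (\int[mu]_x (h n x)%:E <= \int[mu]_x F x)%E.
  apply: ge0_le_integral => //.
  - by move=> x _; rewrite lee_fin.
  - exact/measurable_EFinP.
  - by move=> x _; rewrite nnsfun_approxE; exact: le_approx.
apply: (le_trans _ hF); apply: campbell_nnsfun.
exact: (le_lt_trans hF Ffin).
Qed.

(** [F] is cut at 1. The part below 1 has a finite mean by Campbell's formula. The set where
    [F >= 1] has finite intensity, hence almost surely a finite count, and [F] is essentially
    bounded on it. As [N w] is given as a measure and not as a list of points, this bound is read
    off the decreasing sets [T k]. *)
Lemma poisson_integral_lt_pinfty (F : E -> R) : (forall x, 0 <= F x) ->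
  measurable_fun [set: E] F -> (\int[mu]_x (Num.min 1 (F x))%:E < +oo)%E ->
  {ae P, forall w, (\int[N w]_x (F x)%:E < +oo)%E}.
Proof.
move=> F0 mF Ffin.
pose T (k : nat) : set E := [set x | k.+1%:R <= F x].
have mT k : measurable (T k).
  rewrite -[X in measurable X]setTI (_ : T k = F @^-1` `[k.+1%:R, +oo[); first exact: mF.
  by apply/seteqP; split => x /=; rewrite in_itv/= andbT.
have mT0 : (mu (T 0%N) < +oo)%E.
  apply: le_lt_trans Ffin.
  rewrite -[leLHS]mul1e -(setIT (T 0%N)) -integral_indic// -[X in (1 * X)%E]/(_).
  rewrite mul1e; apply: le_lower_integral => x _; rewrite lee_fin//.
  rewrite indicE; have [xT|_] := boolP (x \in _); last by rewrite le_min ler01 F0.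
  by rewrite le_min lexx/=; move: xT; rewrite inE.
have mTk k : (mu (T k) < +oo)%E.
  apply: le_lt_trans mT0; apply: le_measure; rewrite ?inE// => x /=.
  by apply: le_trans; rewrite ler_nat.
pose F1 x := if F x < 1 then F x else 0.
have mF1 : measurable_fun [set: E] F1.
  by apply: measurable_fun_ifT => //; exact: measurable_fun_ltr.
have F10 x : 0 <= F1 x by rewrite /F1; case: ifPn.
have F1fin : (\int[mu]_x (F1 x)%:E < +oo)%E.
  apply: le_lt_trans Ffin; apply: le_lower_integral => x _; rewrite lee_fin//.
  rewrite /F1; case: ifPn => F1x; last by rewrite le_min ler01 F0.
  by rewrite le_min lexx andbT ltW.
have ae1 : {ae P, forall w, (\int[N w]_x (F1 x)%:E < +oo)%E}.
  have : P.-integrable [set: Omega] (fun w => \int[N w]_x (F1 x)%:E)%E.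
    apply/integrableP; split; first by apply: measurable_integral_N => //; exact/measurable_EFinP.
    under eq_integral => w _.
      rewrite gee0_abs; last by apply: integral_ge0 => x _; rewrite lee_fin.
      over.
    apply: (le_lt_trans _ F1fin); apply: campbell => //.
    exact/measurable_EFinP.
  move/integrable_ae => /(_ measurableT); apply: filterS => w /(_ I).
  by rewrite ge0_fin_numE//; apply: integral_ge0 => x _; rewrite lee_fin.
have ae2 : {ae P, forall w, forall k, exists j : nat, N w (T k) = j%:R%:E}.
  by apply/ae_foralln => k; exact: poisson_random_measure_nat.
apply: filterS2 ae1 ae2 => w F1w Tw.
(* The counts [N w (T k)] are integers tending to the measure of the empty set, that is to 0, so one
   of them vanishes: [F < K + 1] almost everywhere for [N w]. *)
have [K NK] : exists K, N w (T K) = 0%E.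
  have : N w (T k) @[k --> \oo] --> N w (\bigcap_k T k).
    apply: nonincreasing_cvg_mu => //.
    - by have [j ->] := Tw 0%N; rewrite ltry.
    - exact: bigcapT_measurable.
    - by move=> a b ab; apply/subsetPset => x /=; apply: le_trans; rewrite ler_nat.
  have -> : \bigcap_k T k = set0.
    apply/seteqP; split => // x xT; have := xT (Num.bound (F x)) I.
    rewrite /T /= => h; have := lt_le_trans (archi_boundP (F0 x)) (le_trans _ h).
    by rewrite ltxx ler_nat leqnSn => /(_ isT).
  rewrite measure0 => /fine_cvgP[_] /cvgrPdist_lt /(_ 1 ltr01)[k _ /(_ k (leqnn k))].
  have [j jk] := Tw k; rewrite /= jk /= sub0r normrN ger0_norm// => j1.
  have j0 : j = 0%N by apply/eqP; rewrite -leqn0 -ltnS -(@ltr_nat R).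
  by exists k; rewrite jk j0.
apply: (@le_lt_trans _ _ (\int[N w]_x (F1 x + K.+1%:R * \1_(T 0%N) x)%:E)%E).
  apply: ae_ge0_le_integral => //.
  - by move=> x _; rewrite lee_fin.
  - exact/measurable_EFinP.
  - by move=> x _; rewrite lee_fin addr_ge0// mulr_ge0.
  - apply/measurable_EFinP; apply: measurable_funD => //.
    by apply: measurable_funM => //; exact: measurable_indic.
  - exists (T K); split => // x /= /not_implyP[_] /negP; rewrite lee_fin -ltNge.
    rewrite /F1 indicE; have [_|Fx1] := ltP (F x) 1.
      by rewrite ltNge lerDl mulr_ge0.
    by rewrite add0r mem_set// mulr1 => /ltW.
under eq_integral do rewrite EFinD.
rewrite ge0_integralD//; last 3 first.
  - by move=> x _; rewrite lee_fin.
  - exact/measurable_EFinP.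
  - by apply/measurable_EFinP; apply: measurable_funM => //; exact: measurable_indic.
apply: lte_add_pinfty => //.
under eq_integral do rewrite EFinM.
rewrite ge0_integralZl//; last by apply/measurable_EFinP; exact: measurable_indic.
by rewrite integral_indic// setIT; have [j ->] := Tw 0%N; rewrite -EFinM ltry.
Qed.

End poisson_random_measures.

(** * The Euclidean norm and the induced operator norm *)

Section euclidean_norm.
Context (R : realType).

Lemma enorm_ge0 (d : nat) (x : 'cV[R]_d) : 0 <= enorm x.
Proof. exact: sqrtr_ge0. Qed.

Lemma coord_le_enorm (d : nat) (x : 'cV[R]_d) i : `|x i 0| <= enorm x.
Proof.
rewrite -sqrtr_sqr ler_sqrt ?sumr_ge0// => [|j _]; last exact: sqr_ge0.
by rewrite (bigD1 i)//= lerDl sumr_ge0// => j _; exact: sqr_ge0.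
Qed.

Lemma enorm_le_sum (d : nat) (x : 'cV[R]_d) : enorm x <= \sum_i `|x i 0|.
Proof.
have s0 : 0 <= \sum_i `|x i 0| by exact: sumr_ge0.
rewrite -(ger0_norm s0) -sqrtr_sqr ler_sqrt ?sqr_ge0//.
rewrite expr2 mulr_suml; apply: ler_sum => i _.
rewrite (bigD1 i)//= mulrDr -expr2 real_normK ?num_real// lerDl.
by rewrite mulr_ge0// sumr_ge0.
Qed.

Lemma enormZ (d : nat) (a : R) (x : 'cV[R]_d) : enorm (a *: x) = `|a| * enorm x.
Proof.
rewrite /enorm -sqrtr_sqr -sqrtrM ?sqr_ge0//; congr Num.sqrt.
by rewrite mulr_sumr; apply: eq_bigr => i _; rewrite mxE exprMn.
Qed.

Lemma enorm_eq0 (d : nat) (x : 'cV[R]_d) : enorm x = 0 -> x = 0.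
Proof.
move=> x0; apply/colP => i; rewrite mxE; apply/eqP.
by rewrite -normr_le0 -x0 coord_le_enorm.
Qed.

Lemma enorm0 (d : nat) : enorm (0 : 'cV[R]_d) = 0.
Proof. by rewrite /enorm big1 ?sqrtr0// => i _; rewrite mxE expr0n. Qed.

Lemma measurable_enorm (d : nat) : measurable_fun [set: 'cV[R]_d] (@enorm R d).
Proof.
have msqrt : measurable_fun [set: R] (fun x : R => Num.sqrt x).
  by apply: continuous_measurable_fun; exact: sqrt_continuous.
apply: (measurableT_comp msqrt); apply: measurable_sum => i.
by apply: measurable_funX; exact: measurable_coord.
Qed.

Lemma opnorm_has_ubound (m n : nat) (A : 'M[R]_(m, n)) :
  has_ubound [set enorm (A *m x) | x in [set x : 'cV[R]_n | enorm x <= 1]].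
Proof.
exists (\sum_i \sum_j `|A i j|) => _ [x /= x1 <-].
apply: le_trans (enorm_le_sum _) _; apply: ler_sum => i _.
rewrite mxE; apply: le_trans (ler_norm_sum _ _ _) _; apply: ler_sum => j _.
by rewrite normrM ler_piMr// (le_trans (coord_le_enorm _ _)).
Qed.

Lemma enorm_mulmx_le (m n : nat) (A : 'M[R]_(m, n)) (x : 'cV[R]_n) :
  enorm (A *m x) <= opnorm A * enorm x.
Proof.
have [x0|x0] := eqVneq (enorm x) 0.
  by rewrite x0 (enorm_eq0 x0) mulmx0 enorm0 mulr0.
have xgt0 : 0 < enorm x by rewrite lt_neqAle eq_sym x0 enorm_ge0.
rewrite -ler_pdivrMr// mulrC.
have -> : (enorm x)^-1 * enorm (A *m x) = enorm (A *m ((enorm x)^-1 *: x)).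
  by rewrite -scalemxAr enormZ gtr0_norm// invr_gt0.
apply: ub_le_sup; first exact: opnorm_has_ubound.
exists ((enorm x)^-1 *: x) => //=.
by rewrite enormZ gtr0_norm ?invr_gt0// mulVf.
Qed.

Lemma opnorm_ge0 (m n : nat) (A : 'M[R]_(m, n)) : 0 <= opnorm A.
Proof.
apply: le_trans (enorm_ge0 (A *m 0)) _; apply: ub_le_sup; first exact: opnorm_has_ubound.
by exists 0 => //=; rewrite enorm0.
Qed.

Lemma coord_mulmx_le (m n : nat) (A : 'M[R]_(m, n)) (x : 'cV[R]_n) i :
  `|(A *m x) i 0| <= opnorm A * enorm x.
Proof. exact: le_trans (coord_le_enorm _ _) (enorm_mulmx_le _ _). Qed.

Lemma coord_le_opnorm (m n : nat) (A : 'M[R]_(m, n)) i j : `|A i j| <= opnorm A.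
Proof.
have := coord_mulmx_le A (delta_mx j 0) i.
rewrite (_ : enorm (delta_mx j 0) = 1).
  rewrite mulr1; congr (`|_| <= _).
  rewrite mxE (bigD1 j)//= mxE !eqxx mulr1 big1 ?addr0// => k kj.
  by rewrite mxE (negbTE kj) mulr0.
rewrite /enorm (bigD1 j)//= mxE !eqxx big1 ?addr0 ?expr1n ?sqrtr1// => k kj.
by rewrite mxE (negbTE kj) expr0n.
Qed.

End euclidean_norm.

(** * The kernel and its derivative *)

Lemma is_derive_coord (R : realType) (m n : nat) (F : R -> 'M[R]_(m, n)) (s : R) i j :
  derivable F s 1 -> is_derive s (1 : R) (fun x => F x i j) (derive1 F s i j).
Proof.
move=> dF.
have h : (fun k : R => k^-1 *: (F (k *: (1 : R) + s) i j - F s i j)) k @[k --> 0^'] -->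
    'D_1 F s i j.
  have := @cvg_comp _ _ _ _ (fun A : 'M[R]_(m, n) => A i j) _ _ _ dF
    (@coord_continuous _ m n i j ('D_1 F s)).
  apply: cvg_trans; apply: near_eq_cvg; near=> k => /=.
  by rewrite !mxE.
by rewrite derive1E; apply: DeriveDef; [exact: cvgP h|exact: cvg_lim h].
Unshelve. all: by end_near. Qed.

Lemma measurable_patch0 (R : realType) dT (T : measurableType dT) (D : set T) (F : T -> R) :
  measurable D -> measurable_fun D F ->
  measurable_fun [set: T] (fun x => if x \in D then F x else 0).
Proof.
by move=> mD /(measurable_restrictT _ mD).
Qed.

(** By density, a Lipschitz bound known between rational points is carried over to all real
    points. *)
Lemma le0_of_rat (R : realType) (h : R -> R) (a b : R) :
  (forall x, x \in `]a, b[ -> {for x, continuous h}) ->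
  (forall q : rat, ratr q \in `]a, b[ -> h (ratr q) <= 0) ->
  forall x, x \in `]a, b[ -> h x <= 0.
Proof.
move=> ch hq x xab; rewrite leNgt; apply/negP => hx.
have : \forall z \near x, 0 < h z /\ z \in `]a, b[.
  near=> z; split; near: z; first exact: cvgr_gt (ch _ xab) _ hx.
  exact: near_in_itvoo.
move=> [e /= e0 eh].
have [|q] := @rat_in_itvoo R (x - e) (x + e); first by rewrite ltrD2l gtrN.
rewrite in_itv/= => /andP[q1 q2].
have [|h1 h2] := eh (ratr q); first by rewrite /= distrC ltr_distl q1 q2.
by have := hq _ h2; rewrite leNgt h1.
Unshelve. all: by end_near. Qed.

Section kernel.
Context (R : realType) (n d : nat) (f : 'M[R]_d -> R -> 'M[R]_(n, d)).
Notation Mm := (@Mminus R d).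
Notation leb := (@lebesgue_measure R).
Notation g := (kernel_derivative f).
Hypothesis mf : measurable_fun (Mm `*` [set: R]) (fun p => f p.1 p.2).
Hypothesis df : forall A s, Mm A -> s != 0 -> derivable (f A) s 1.
Hypothesis cvg_g : forall A, Mm A -> cvg (derive1 (f A) s @[s --> 0^'+]).

Let measurable_dom : measurable (Mm `*` [set: R]).
Proof. by apply: measurableX => //; exact: measurable_Mminus. Qed.

Lemma kernel_is_derive A s i j : Mm A -> s != 0 ->
  is_derive s (1 : R) (fun x => f A x i j) (g A s i j).
Proof.
by move=> MA s0; rewrite /kernel_derivative (negbTE s0); exact/is_derive_coord/df.
Qed.

(** Nothing is assumed about [f] off [Mm]; the extension by 0 is measurable on the whole space, so
    that its sections can be taken freely. *)
Let fE i j (p : 'M[R]_d * R) := if p \in Mm `*` [set: R] then f p.1 p.2 i j else 0.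

Lemma measurable_kernel_coord i j :
  measurable_fun [set: 'M[R]_d * R]
    (fun p => if p \in Mm `*` [set: R] then f p.1 p.2 i j else 0).
Proof.
apply: measurable_patch0 => //.
exact: (measurableT_comp (measurable_coord i j) mf).
Qed.

(** Off time 0 the derivative is a limit of difference quotients of [f]; at time 0 it is by
    definition a right limit of derivatives, reached along [1 / (k + 1)]. *)
Lemma measurable_kernel_derivative_coord i j :
  measurable_fun [set: 'M[R]_d * R]
    (fun p => if p \in Mm `*` [set: R] then g p.1 p.2 i j else 0).
Proof.
pose D1 : set ('M[R]_d * R) := Mm `*` ~` [set 0].
have mD1 : measurable D1.
  by apply: measurableX; [exact: measurable_Mminus|exact: measurableC].
pose q k (p : 'M[R]_d * R) : R :=
  (k.+1%:R^-1)^-1 * (fE i j (p.1, p.2 + k.+1%:R^-1) - fE i j p).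
pose g0 p := if p \in D1 then g p.1 p.2 i j else 0.
have mg0 : measurable_fun [set: 'M[R]_d * R] g0.
  apply: (@measurable_fun_cvg _ _ _ _ (fun k p => if p \in D1 then q k p else 0)).
    move=> k; apply: measurable_patch0 => //; apply: measurable_funTS.
    apply: measurable_funM => //; apply: measurable_funB; last exact: measurable_kernel_coord.
    apply: (measurableT_comp (measurable_kernel_coord i j)).
    by apply: measurable_fun_pair => //; exact: measurable_funD.
  move=> [A s] _; rewrite /g0; have [As|_] := boolP (_ \in _); last exact: cvg_cst.
  move: As; rewrite inE => -[/= MA /eqP s0].
  rewrite /q /fE /=; have -> : (fun k => (k.+1%:R^-1)^-1 *
     ((if (A, s + k.+1%:R^-1) \in Mm `*` [set: R] then f A (s + k.+1%:R^-1) i j else 0) -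
      (if (A, s) \in Mm `*` [set: R] then f A s i j else 0))) =
    (fun k => (k.+1%:R^-1)^-1 * (f A (s + k.+1%:R^-1) i j - f A s i j)).
    by apply/funext => k; rewrite !mem_set.
  exact: (is_derive_cvg_harmonic (kernel_is_derive i j MA s0)).
pose u (k : nat) (p : 'M[R]_d * R) := g0 (p.1, if p.2 == 0 then k.+1%:R^-1 else p.2).
apply: (@measurable_fun_cvg _ _ _ _ u).
  move=> k; apply: (measurableT_comp mg0); apply: measurable_fun_pair => //.
  apply: measurable_fun_ifT => //; exact: measurable_fun_eqr.
move=> [A s] _; rewrite /u /g0 /=.
have [AM|AM] := boolP ((A, s) \in _); last first.
  have -> : (fun k => if (A, if s == 0 then k.+1%:R^-1 else s) \in D1
      then g A (if s == 0 then k.+1%:R^-1 else s) i j else 0) = (fun=> 0).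
    apply/funext => k; rewrite ifF//; apply: contraNF AM.
    by rewrite !inE => -[].
  exact: cvg_cst.
have MA : Mm A by move: AM; rewrite inE => -[].
have [->|s0] := eqVneq s 0; last first.
  by rewrite mem_set; [exact: cvg_cst|split => //; exact/eqP].
have -> : (fun k : nat => if (A, k.+1%:R^-1) \in D1 then g A k.+1%:R^-1 i j else 0) =
    (fun k => derive1 (f A) k.+1%:R^-1 i j).
  apply/funext => k; rewrite mem_set; last by split => //=; apply/eqP; rewrite gt_eqF.
  by rewrite /kernel_derivative gt_eqF.
rewrite /kernel_derivative eqxx.
have hc : (k.+1%:R^-1 : R) @[k --> \oo] --> (0 : R)^'+.
  move=> U [e /= e0 eU]; have := @cvg_harmonic R.
  move/cvgrPdist_lt => /(_ _ e0); apply: filterS => k kU; exact: eU.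
have := cvg_comp _ _ hc (cvg_g MA) => h.
exact: (@cvg_comp _ _ _ _ (fun A : 'M[R]_(n, d) => A i j) _ _ _ h (@coord_continuous _ n d i j _)).
Qed.

(* Difference quotients over rational points only, which makes the set of [A]
   for which they are unbounded measurable. *)
Definition steep (a b : R) : set 'M[R]_d := Mm `&`
  \bigcap_(K : nat) \bigcup_(r : (rat * rat) * ('I_n * 'I_d))
    [set A | [&& ratr r.1.1 \in `]a, b[, ratr r.1.2 \in `]a, b[ &
       K%:R * `|ratr r.1.1 - ratr r.1.2| <
       `|fE r.2.1 r.2.2 (A, ratr r.1.1) - fE r.2.1 r.2.2 (A, ratr r.1.2)|]].

Lemma measurable_steep a b : measurable (steep a b).
Proof.
apply: measurableI; first exact: measurable_Mminus.
apply: bigcapT_measurable => K; apply: countable_bigcupT_measurable => [|[[x y] [i j]]].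
  exact: countableP.
rewrite /=; case: (ratr x \in _); case: (ratr y \in _) => /=; last 3 first.
- by rewrite (_ : [set _ | _] = set0)//; apply/seteqP; split.
- by rewrite (_ : [set _ | _] = set0)//; apply/seteqP; split.
- by rewrite (_ : [set _ | _] = set0)//; apply/seteqP; split.
have mfx z : measurable_fun [set: 'M[R]_d] (fun A => fE i j (A, z)).
  exact: (measurableT_comp (measurable_kernel_coord i j) (measurable_pair2 z)).
have mh : measurable_fun [set: 'M[R]_d] (fun A =>
    K%:R * `|ratr x - ratr y| < `|fE i j (A, ratr x) - fE i j (A, ratr y)|).
  apply: measurable_fun_ltr => //; apply: measurableT_comp => //.
  exact: measurable_funB.
by have := mh measurableT [set true] I; rewrite setTI; congr measurable; apply/seteqP; split.
Qed.

Let fEE A x i j : Mm A -> fE i j (A, x) = f A x i j.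
Proof. by move=> MA; rewrite /fE mem_set. Qed.

Let itv_neq0 (a b x : R) : ~~ (0 \in `]a, b[) -> x \in `]a, b[ -> x != 0.
Proof. by move=> h xab; apply: contraNneq h => <-. Qed.

(** Failing to be steep means having a Lipschitz constant between rational points; continuity
    extends it to the interval, and a Lipschitz constant bounds the derivative. *)
Lemma bounded_derivative_not_steep A (a b : R) : Mm A -> ~ steep a b A -> ~~ (0 \in `]a, b[) ->
  exists K : R, forall (s : R) i j, s \in `]a, b[ -> `|g A s i j| <= K.
Proof.
move=> MA nsteep ab0.
have [K HK] : exists K : nat, forall (x y : rat) i j, ratr x \in `]a, b[ ->
    ratr y \in `]a, b[ ->
    `|f A (ratr x) i j - f A (ratr y) i j| <= K%:R * `|ratr x - ratr y|.
  apply: contrapT => noK; apply: nsteep; split => // K _.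
  apply: contrapT => noidx; apply: noK; exists K => x y i j xab yab.
  rewrite leNgt; apply/negP => h; apply: noidx; exists ((x, y), (i, j)) => //=.
  by rewrite xab yab/= !fEE.
have cf i j x : x \in `]a, b[ -> {for x, continuous (fun x => f A x i j)}.
  move=> xab; apply: differentiable_continuous; apply/derivable1_diffP.
  by have [] := kernel_is_derive i j MA (itv_neq0 ab0 xab).
have lip i j x y : x \in `]a, b[ -> y \in `]a, b[ ->
    `|f A x i j - f A y i j| <= K%:R * `|x - y|.
  move=> xab yab; rewrite -subr_le0.
  have cont (c e z : R) : z \in `]a, b[ ->
      {for z, continuous (fun x => `|f A x i j - c| - K%:R * `|x - e|)}.
    move=> zab; apply: cvgB.
      by apply: cvg_norm; apply: cvgB; [exact: cf|exact: cvg_cst].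
    apply: cvgM; first exact: cvg_cst.
    by apply: cvg_norm; apply: cvgB; [exact: cvg_id|exact: cvg_cst].
  apply: (@le0_of_rat _ (fun x => `|f A x i j - f A y i j| - K%:R * `|x - y|) a b) => //.
    by move=> z; exact: cont.
  move=> q qab; rewrite distrC (distrC _ y).
  apply: (@le0_of_rat _ (fun y => `|f A y i j - f A (ratr q) i j| - K%:R * `|y - ratr q|) a b) => //.
    by move=> z; exact: cont.
  by move=> r rab; rewrite subr_le0; exact: HK.
exists K%:R => s i j sab.
have := is_derive_cvg_harmonic (kernel_is_derive i j MA (itv_neq0 ab0 sab)).
move=> /cvg_norm h; apply: (ler_cvg_to h (cvg_cst _)).
have hn : s + k.+1%:R^-1 @[k --> \oo] --> s.
  by rewrite -[X in _ --> X]addr0; apply: cvgD; [exact: cvg_cst|exact: cvg_harmonic].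
near=> k; rewrite normrM normfV ler_pdivrMl ?normr_gt0 ?invr_eq0//.
rewrite mulrC (le_trans (lip _ _ _ _ _ sab))//; last by rewrite addrAC subrr add0r.
near: k; exact: (hn _ (near_in_itvoo sab)).
Unshelve. all: by end_near. Qed.

(** As [t] runs through [[t1, t2]], the difference [t - s] covers []a, b[]. A finite supremum would
    bound the derivative there and, by the mean value theorem, all difference quotients, against
    steepness. *)
Lemma steep_kernel_sup A (a b t1 t2 s : R) : steep a b A -> ~~ (0 \in `]a, b[) ->
  t1 - s <= a -> b <= t2 - s -> kernel_sup g t1 t2 A s = +oo%E.
Proof.
move=> [MA stA] ab0 ta bt; apply/eqP; rewrite eq_le leey/= leNgt.
apply/negP => supfin.
have [M HM] : exists M : R, forall x, x \in `]a, b[ -> opnorm (g A x) <= M.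
  have ub x : x \in `]a, b[ -> ((opnorm (g A x))%:E <= kernel_sup g t1 t2 A s)%E.
    rewrite in_itv/= => /andP[ax xb]; apply: ereal_sup_ubound.
    exists (x + s); last by rewrite addrK.
    by rewrite /= in_itv/=; apply/andP; split; lra.
  move: supfin ub; case: (kernel_sup g t1 t2 A s) => // [M _ ub|_ ub].
    by exists M => x /ub; rewrite lee_fin.
  by exists 0 => x /ub.
have [[[x y] [i j]] _ /= /and3P[xab yab]] := stA (Num.bound `|M|) I.
rewrite !fEE//; apply/negP; rewrite -leNgt.
have gM z : z \in `]a, b[ -> `|g A z i j| <= (Num.bound `|M|)%:R.
  move=> /HM zM; apply: le_trans (coord_le_opnorm _ _ _) _; apply: (le_trans zM).
  exact: le_trans (ler_norm M) (ltW (archi_boundP (normr_ge0 M))).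
have main (x' y' : R) : x' \in `]a, b[ -> y' \in `]a, b[ -> x' <= y' ->
    `|f A y' i j - f A x' i j| <= (Num.bound `|M|)%:R * `|y' - x'|.
  move=> x'ab y'ab xy.
  have sub z : z \in `[x', y'] -> z \in `]a, b[.
    move: x'ab y'ab; rewrite !in_itv/= => /andP[? ?] /andP[? ?] /andP[? ?].
    by apply/andP; split; lra.
  rewrite (ger0_norm (_ : 0 <= y' - x')) ?subr_ge0//.
  apply: (@mean_value_bound _ (fun x => f A x i j) (fun z => g A z i j)) => // z.
    by move=> /sub zab; exact: (kernel_is_derive i j MA (itv_neq0 ab0 zab)).
  by move=> /subset_itv_oo_cc /sub; exact: gM.
have [xy|/ltW yx] := leP (ratr x : R) (ratr y).
  by rewrite distrC (distrC (ratr x)); exact: main.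
exact: main.
Qed.

Section null_steep.
Variables (pi : probability 'M[R]_d R) (delta : R).
Hypothesis delta_gt0 : 0 < delta.
Hypothesis int_sup : (\int[pi]_(A in Mm) \int[leb]_s kernel_sup g 0 delta A s < +oo)%E.

Lemma kernel_sup_ge0 (t1 t2 : R) A s : t1 <= t2 -> (0 <= kernel_sup g t1 t2 A s)%E.
Proof.
move=> t12; apply: (@le_trans _ _ (opnorm (g A (t1 - s)))%:E).
  by rewrite lee_fin opnorm_ge0.
by apply: ereal_sup_ubound; exists t1 => //=; rewrite in_itv/= lexx.
Qed.

Lemma steep_null (a b : R) : a <= b -> b - a < delta -> ~~ (0 \in `]a, b[) ->
  pi (steep a b) = 0%E.
Proof.
move=> ab abd ab0.
apply: (null_of_integral_lt (g := fun A => (\int[leb]_s kernel_sup g 0 delta A s)%E) (D := Mm)) => //.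
- exact: measurable_Mminus.
- exact: measurable_steep.
- by move=> A [].
- by move=> A _; apply: integral_ge0 => s _; apply: kernel_sup_ge0; exact: ltW.
move=> A stA; apply/eqP; rewrite eq_le leey/=.
(* []a, b[] fits into [[- s, delta - s]] whenever [- a <= s <= delta - b], a set of times of length
   [delta - (b - a) > 0] on which the supremum is infinite. *)
have : (\int[leb]_(s in [set: R]) ((cst +oo : R -> \bar R) \_ `[(- a)%R, (delta - b)%R]) s <=
    \int[leb]_(s in [set: R]) kernel_sup g 0 delta A s)%E.
  apply: le_lower_integral => s _; rewrite patchE; first by case: ifPn => // _; exact: leey.
  case: ifPn => [|_]; last by apply: kernel_sup_ge0; exact: ltW.
  by rewrite inE/= in_itv/= => /andP[s1 s2]; rewrite (@steep_kernel_sup A a b)//; lra.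
apply: le_trans; rewrite -integral_mkcond integral_cst//= lebesgue_measure_itv/=.
have lt1 : - a < delta - b by lra.
by rewrite lte_fin lt1 -EFinD gt0_mulye// lte_fin; lra.
Qed.

(* The derivative of [f A] is locally bounded for good [A]: the intervals of
   length [delta / 2] overlap and cover both open half-lines. *)
Definition good : set 'M[R]_d := Mm `\`
  \bigcup_(k : nat) (steep (k%:R * (delta / 4)) (k%:R * (delta / 4) + delta / 2) `|`
     steep (- (k%:R * (delta / 4) + delta / 2)) (- (k%:R * (delta / 4)))).

Lemma measurable_good : measurable good.
Proof.
apply: measurableD; first exact: measurable_Mminus.
by apply: bigcupT_measurable => k; apply: measurableU; exact: measurable_steep.
Qed.

Lemma good_Mminus A : good A -> Mm A.
Proof. by case. Qed.

(** The intervals in [good] avoid 0 and have length [delta / 2], strictly less than [delta] as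
    [steep_null] requires. *)
Lemma null_not_good : pi Mm = 1%E -> pi (~` good) = 0%E.
Proof.
move=> piM; have mM := @measurable_Mminus R d; have d0 := delta_gt0.
have k0 (k : nat) : 0 <= k%:R * (delta / 4) by rewrite mulr_ge0// divr_ge0// ltW.
rewrite /good setDE setCI setCK; apply: null_set_setU.
- exact: measurableC.
- by apply: bigcupT_measurable => k; apply: measurableU; exact: measurable_steep.
- by have := probability_setC pi mM; rewrite piM subee.
apply: measure_negligible.
  by apply: bigcupT_measurable => k; apply: measurableU; exact: measurable_steep.
apply: negligible_bigcup => k; apply/negligibleP.
  by apply: measurableU; exact: measurable_steep.
apply: null_set_setU; [exact: measurable_steep|exact: measurable_steep| |]; apply: steep_null.
- by have := k0 k; lra.
- by lra.
- by rewrite in_itv/= ltNge k0.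
- by have := k0 k; lra.
- by lra.
- by apply/negP; rewrite in_itv/= => /andP[_]; have := k0 k; lra.
Qed.

(** A bound on the first intervals extends to the next one; these are open, and their overlap of
    length [delta / 4] is what catches the endpoints. *)
Lemma good_bounded_derivative A (M : R) : good A ->
  exists2 K : R, 0 <= K & forall (s : R) i j, `|s| < M -> s != 0 -> `|g A s i j| <= K.
Proof.
move=> [MA nst]; have d0 := delta_gt0.
have k0 (k : nat) : 0 <= k%:R * (delta / 4) by rewrite mulr_ge0// divr_ge0// ltW.
have kS (k : nat) : k.+1%:R * (delta / 4) = k%:R * (delta / 4) + delta / 4.
  by rewrite -natr1 mulrDl mul1r.
have right k : exists K : R, forall (s : R) i j,
    s \in `]0, k%:R * (delta / 4) + delta / 2[ -> `|g A s i j| <= K.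
  elim: k => [|k [K HK]].
    rewrite mul0r add0r; apply: bounded_derivative_not_steep => //.
      move=> st; apply: nst; exists 0%N => //; left; rewrite mul0r add0r; exact: st.
    by rewrite in_itv/= ltxx.
  have [|K' HK'] := bounded_derivative_not_steep MA (fun st => nst (ex_intro2 _ _ k.+1 I (or_introl st))).
    by rewrite in_itv/= ltNge k0.
  exists (Num.max K K') => s i j; rewrite in_itv/= => /andP[s0 sk].
  rewrite le_max; have [sk1|sk1] := ltP s (k%:R * (delta / 4) + delta / 2).
    by rewrite HK// in_itv/= s0.
  rewrite HK' ?orbT// in_itv/= sk andbT.
  by rewrite kS; lra.
have left k : exists K : R, forall (s : R) i j,
    s \in `]- (k%:R * (delta / 4) + delta / 2), 0[ -> `|g A s i j| <= K.
  elim: k => [|k [K HK]].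
    rewrite mul0r add0r; apply: bounded_derivative_not_steep => //.
      move=> st; apply: nst; exists 0%N => //; right; rewrite mul0r add0r oppr0; exact: st.
    by rewrite in_itv/= ltxx andbF.
  have [|K' HK'] := bounded_derivative_not_steep MA (fun st => nst (ex_intro2 _ _ k.+1 I (or_intror st))).
    by apply/negP; rewrite in_itv/= => /andP[_]; have := k0 k.+1; lra.
  exists (Num.max K K') => s i j; rewrite in_itv/= => /andP[s0 sk].
  rewrite le_max; have [sk1|sk1] := ltP (- (k%:R * (delta / 4) + delta / 2)) s.
    by rewrite HK// in_itv/= sk1.
  rewrite HK' ?orbT// in_itv/= s0/=.
  by rewrite kS; lra.
have [k Mk] : exists k : nat, M <= k%:R * (delta / 4).
  exists (Num.bound (`|M| / (delta / 4))).
  have d4 : 0 < delta / 4 by rewrite divr_gt0.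
  rewrite -ler_pdivrMr//; apply: le_trans (ltW (archi_boundP _)); last first.
    by rewrite divr_ge0// ltW.
  by rewrite ler_wpM2r ?ler_norm// invr_ge0 ltW.
have [K1 HK1] := right k; have [K2 HK2] := left k.
exists (Num.max 0 (Num.max K1 K2)) => [|s i j]; first by rewrite le_max lexx.
rewrite ltr_norml neq_lt => /andP[s1 s2] /orP[s0|s0]; rewrite !le_max.
  by rewrite HK2 ?orbT// in_itv/= s0 andbT; lra.
by rewrite HK1 ?orbT// in_itv/= s0/=; lra.
Qed.

End null_steep.
End kernel.

Lemma ge0_integral_setU_le (R : realType) dT (T : measurableType dT)
    (mu : {measure set T -> \bar R}) (A B : set T) (h : T -> \bar R) :
  measurable A -> measurable B -> measurable_fun [set: T] h -> (forall x, 0 <= h x)%E ->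
  (\int[mu]_(x in A `|` B) h x <= \int[mu]_(x in A) h x + \int[mu]_(x in B) h x)%E.
Proof.
move=> mA mB mh h0; rewrite integral_mkcond.
rewrite [X in (_ <= X + _)%E]integral_mkcond [X in (_ <= _ + X)%E]integral_mkcond.
have hr0 C x : (0 <= (h \_ C) x)%E by rewrite patchE; case: ifPn.
have mr C : measurable C -> measurable_fun [set: T] (h \_ C).
  by move=> mC; apply/(measurable_restrictT _ mC); exact: measurable_funTS.
rewrite -ge0_integralD//; try exact: mr.
apply: le_lower_integral => x _ //; rewrite !patchE in_setU.
by case: (x \in A) => /=; case: (x \in B); rewrite ?addr0 ?add0r ?adde0 ?add0e ?leeDl ?lexx.
Qed.

(** The hypotheses on the kernel control short windows only. Countably many of them, one on each
    side of 0 for every [k], give every [[- M, M]] with [M] real: a countable family of almost sure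
    statements thus serves all times. *)
Lemma integral_itv_pieces (R : realType) dT (T : measurableType dT)
    (m : {measure set T -> \bar R}) (h : R -> T -> R) (eta : R) : 0 < eta ->
  (forall p, measurable_fun [set: R] (h ^~ p)) ->
  (forall a b : R, measurable_fun [set: T]
    (fun p => \int[@lebesgue_measure R]_(u in `[a, b]) (`|h u p|%R)%:E)%E) ->
  (forall k : nat,
    (\int[m]_p \int[@lebesgue_measure R]_(u in `[(k%:R * eta)%R, (k%:R * eta + eta)%R])
       (`|h u p|%R)%:E < +oo)%E /\
    (\int[m]_p \int[@lebesgue_measure R]_(u in `[(- (k%:R * eta + eta))%R, (- (k%:R * eta))%R])
       (`|h u p|%R)%:E < +oo)%E) ->
  forall M : R, (\int[m]_p \int[@lebesgue_measure R]_(u in `[(- M)%R, M])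
       (`|h u p|%R)%:E < +oo)%E.
Proof.
move=> eta0 mh mI Hk.
have I0 a b p : (0 <= \int[@lebesgue_measure R]_(u in `[a, b]) (`|h u p|%R)%:E)%E.
  by apply: integral_ge0.
have mhp p D : measurable_fun D (fun u => (`|h u p|%R)%:E).
  by apply: measurable_funTS; apply/measurable_EFinP; exact: measurableT_comp.
have main (k : nat) : (\int[m]_p \int[@lebesgue_measure R]_(u in
    `[(- (k%:R * eta))%R, (k%:R * eta)%R]) (`|h u p|%R)%:E < +oo)%E.
  elim: k => [|k IH].
    rewrite mul0r oppr0 set_itv1.
    by under eq_integral do rewrite integral_set1; rewrite integral0 ltry.
  have kS : k.+1%:R * eta = k%:R * eta + eta by rewrite -natr1 mulrDl mul1r.
  have [H1 H2] := Hk k.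
  have k0 : 0 <= k%:R * eta by rewrite mulr_ge0// ltW.
  apply: (@le_lt_trans _ _ (\int[m]_p (
     \int[@lebesgue_measure R]_(u in `[(- (k%:R * eta))%R, (k%:R * eta)%R]) (`|h u p|%R)%:E +
    (\int[@lebesgue_measure R]_(u in `[(k%:R * eta)%R, (k%:R * eta + eta)%R]) (`|h u p|%R)%:E +
     \int[@lebesgue_measure R]_(u in `[(- (k%:R * eta + eta))%R, (- (k%:R * eta))%R])
       (`|h u p|%R)%:E)))%E).
    apply: le_lower_integral => p _ //.
    apply: (@le_trans _ _ (\int[@lebesgue_measure R]_(u in
      `[(- (k%:R * eta))%R, (k%:R * eta)%R] `|` (`[(k%:R * eta)%R, (k%:R * eta + eta)%R] `|`
       `[(- (k%:R * eta + eta))%R, (- (k%:R * eta))%R])) (`|h u p|%R)%:E)%E).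
      apply: ge0_subset_integral => //.
      - by apply: measurableU => //; exact: measurableU.
      - exact: mhp.
      rewrite kS => u /=; rewrite !in_itv/= => /andP[u1 u2].
      have [uk|uk] := leP u (k%:R * eta); last by right; left; rewrite (ltW uk).
      have [ku|ku] := leP (- (k%:R * eta)) u; first by left.
      by right; right; rewrite u1 ltW.
    apply: le_trans.
      by apply: ge0_integral_setU_le => //; [exact: measurableU|exact: mhp].
    by apply: leeD => //; apply: ge0_integral_setU_le => //; exact: mhp.
  rewrite ge0_integralD//; last 2 first.
    by move=> p _; rewrite adde_ge0.
    exact: emeasurable_funD.
  apply: lte_add_pinfty; first exact: IH.
  by rewrite ge0_integralD//; apply: lte_add_pinfty; [exact: H1|exact: H2].
move=> M; pose k := Num.bound (`|M| / eta).
apply: le_lt_trans (main k); apply: le_lower_integral => p _ //.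
apply: ge0_subset_integral => //; first exact: mhp.
apply: subset_itv; rewrite bnd_simp.
  rewrite lerN2; have : `|M| / eta <= k%:R by apply/ltW/archi_boundP; rewrite divr_ge0// ltW.
  by rewrite ler_pdivrMr//; apply: le_trans; exact: ler_norm.
have : `|M| / eta <= k%:R by apply/ltW/archi_boundP; rewrite divr_ge0// ltW.
by rewrite ler_pdivrMr//; apply: le_trans; exact: ler_norm.
Qed.

Section kernel_paths.
Context (R : realType) (n d : nat) (f : 'M[R]_d -> R -> 'M[R]_(n, d)) (C1 C2 : 'M[R]_(n, d)).
Notation Mm := (@Mminus R d).
Notation leb := (@lebesgue_measure R).
Notation g := (kernel_derivative f).
Hypothesis mf : measurable_fun (Mm `*` [set: R]) (fun p => f p.1 p.2).
Hypothesis df : forall A s, Mm A -> s != 0 -> derivable (f A) s 1.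
Hypothesis f_left : forall A, Mm A -> f A s @[s --> 0^'-] --> C1.
Hypothesis f_right : forall A, Mm A -> f A s @[s --> 0^'+] --> C2.
Hypothesis cvg_g : forall A, Mm A -> cvg (derive1 (f A) s @[s --> 0^'+]).
Variable delta : R.
Hypothesis delta_gt0 : 0 < delta.
Notation good := (good f delta).

(** The value [C2] at 0 makes [t -> kernel_path A (t - s)] right continuous at the jump time [s];
    the value 0 off [good] extends the increment formula to every [A], and measurability to the
    whole space. *)
Definition kernel_path A s : 'M[R]_(n, d) :=
  if A \in good then (if s == 0 then C2 else f A s) else 0.
Definition kernel_slope A s : 'M[R]_(n, d) := if A \in good then g A s else 0.
Definition kernel_jump A : 'M[R]_(n, d) := if A \in good then C2 - C1 else 0.

Let mgoodX : measurable (good `*` [set: R]).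
Proof. by apply: measurableX => //; exact: measurable_good. Qed.

Let good_dom (p : 'M[R]_d * R) : p \in good `*` [set: R] -> p \in Mm `*` [set: R].
Proof. by rewrite !inE => -[/good_Mminus]. Qed.

Lemma measurable_kernel_path_coord i j :
  measurable_fun [set: 'M[R]_d * R] (fun p => kernel_path p.1 p.2 i j).
Proof.
rewrite (_ : (fun p => _) = (fun p => if p \in good `*` [set: R] then
    (if p.2 == 0 then C2 i j else
      (if p \in Mm `*` [set: R] then f p.1 p.2 i j else 0)) else 0)).
  apply: measurable_patch0 => //; apply: measurable_funTS.
  apply: measurable_fun_ifT => //; first exact: measurable_fun_eqr.
  exact: measurable_kernel_coord.
apply/funext => -[A s]; rewrite /kernel_path /= in_setX/= in_setT andbT.
case: ifPn => [Ag|_]; last by rewrite mxE.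
by case: ifPn => // _; rewrite mem_set//; split => //; exact: good_Mminus (set_mem Ag).
Qed.

Lemma measurable_kernel_slope_coord i j :
  measurable_fun [set: 'M[R]_d * R] (fun p => kernel_slope p.1 p.2 i j).
Proof.
rewrite (_ : (fun p => _) = (fun p => if p \in good `*` [set: R] then
    (if p \in Mm `*` [set: R] then g p.1 p.2 i j else 0) else 0)).
  apply: measurable_patch0 => //; apply: measurable_funTS.
  exact: measurable_kernel_derivative_coord.
apply/funext => -[A s]; rewrite /kernel_slope /= in_setX/= in_setT andbT.
case: ifPn => [Ag|_]; last by rewrite mxE.
by rewrite mem_set//; split => //; exact: good_Mminus (set_mem Ag).
Qed.

Lemma measurable_kernel_jump_coord i j :
  measurable_fun [set: 'M[R]_d] (fun A => kernel_jump A i j).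
Proof.
rewrite (_ : (fun p => _) = (fun A => if A \in good then (C2 - C1) i j else 0)).
  by apply: measurable_patch0 => //; exact: measurable_good.
by apply/funext => A; rewrite /kernel_jump; case: ifPn => // _; rewrite mxE.
Qed.

Let cvg_shift_right (s : R) : (t - s) @[t --> s^'+] --> (0 : R)^'+.
Proof.
move=> U [e /= e0 eU]; exists e => //= t /= st ts; apply: eU => /=.
  by rewrite sub0r normrN distrC.
by rewrite subr_gt0.
Qed.

Let cvg_shift_left (s : R) : (t - s) @[t --> s^'-] --> (0 : R)^'-.
Proof.
move=> U [e /= e0 eU]; exists e => //= t /= st ts; apply: eU => /=.
  by rewrite sub0r normrN distrC.
by rewrite subr_lt0.
Qed.

Let cvg_mulmx_coord (F : set_system R) {FF : Filter F} (h : R -> 'M[R]_(n, d))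
    (l : 'M[R]_(n, d)) (x : 'cV[R]_d) i :
  h @ F --> l -> (h t *m x) i 0 @[t --> F] --> (l *m x) i 0.
Proof.
move=> hl; rewrite mxE; under eq_fun do rewrite mxE.
apply: cvg_big => [|j _]; first exact: add_continuous.
apply: cvgM; last exact: cvg_cst.
exact: (cvg_comp _ _ hl (@coord_continuous _ n d i j l)).
Qed.

Lemma kernel_path_increment A (s : R) (x : 'cV[R]_d) i (a b : R) : a <= b ->
  leb.-integrable `[a, b] (fun u => ((kernel_slope A (u - s) *m x) i 0)%:E) /\
  (kernel_path A (b - s) *m x) i 0 - (kernel_path A (a - s) *m x) i 0 =
    (\int[leb]_(u in `[a, b]) (kernel_slope A (u - s) *m x) i 0)%R +
    (if a < s <= b then (kernel_jump A *m x) i 0 else 0).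
Proof.
move=> ab; rewrite /kernel_path /kernel_jump.
have mslope : measurable_fun [set: R] (fun u => (kernel_slope A (u - s) *m x) i 0).
  under eq_fun do rewrite mxE; apply: measurable_sum => j.
  apply: measurable_funM => //.
  have mp : measurable_fun [set: R] (fun u : R => (A, u - s)).
    by apply: measurable_fun_pair => //; exact: measurable_funB.
  exact: (measurableT_comp (measurable_kernel_slope_coord i j) mp).
have [Ag|Ag] := boolP (A \in good); last first.
  have s0 u : (kernel_slope A (u - s) *m x) i 0 = 0.
    by rewrite /kernel_slope (negbTE Ag) mul0mx mxE.
  split.
    apply: (@eq_integrable _ _ _ leb _ _ (cst 0%E)) => // [u _|]; first by rewrite s0.
    exact: integrable0.
  under eq_Rintegral do rewrite s0.
  by rewrite mul0mx mxE subrr if_same addr0 /Rintegral integral0.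
have gA := set_mem Ag; have MA := good_Mminus gA.
pose F t := ((if t - s == 0 then C2 else f A (t - s)) *m x) i 0.
have Fs : F s = (C2 *m x) i 0 by rewrite /F subrr eqxx.
have Fneq t : t != s -> F t = (f A (t - s) *m x) i 0.
  by move=> ts; rewrite /F subr_eq0 (negbTE ts).
(* This radius covers [t - s] for every [t] in []a - 1, b + 2[], the range that [FTC_with_jump] asks
   for. *)
have [K K0 HK] := good_bounded_derivative df delta_gt0 (`|a| + `|b| + 2 + `|s|) gA.
have dF t : t != s -> is_derive t (1 : R) F ((kernel_slope A (t - s) *m x) i 0).
  move=> ts; have ts0 : t - s != 0 by rewrite subr_eq0.
  apply: (@near_eq_is_derive _ _ _ (fun t => (f A (t - s) *m x) i 0)).
    near=> z; apply/esym/Fneq; near: z.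
    by apply: open_nbhs_nbhs; split; [exact: open_neq|].
  rewrite (_ : (fun t => _) = \sum_(j < d) (fun t => f A (t - s) i j * x j 0)); last first.
    by apply/funext => u; rewrite mxE fct_sumE.
  rewrite mxE; apply: is_derive_sum => j.
  have d1 := kernel_is_derive df i j MA ts0.
  have d2 : is_derive t (1 : R) (fun t => f A (t - s) i j) (g A (t - s) i j).
    have := @is_derive1_comp _ (fun t => f A t i j) (fun t => t - s) t (g A (t - s) i j) 1 d1 _.
    rewrite mulr1; apply.
    by apply: is_derive_eq; rewrite subr0.
  rewrite /kernel_slope Ag mulrC.
  rewrite (_ : (fun t => _) = (fun t => x j 0 *: f A (t - s) i j)); last first.
    by apply/funext => u; rewrite mulrC.
  exact: is_deriveZ.
have Fr : F t @[t --> s^'+] --> F s.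
  have h : (f A (t - s) *m x) i 0 @[t --> s^'+] --> (C2 *m x) i 0.
    apply: (@cvg_mulmx_coord (s^'+)).
    exact: (cvg_comp _ _ (cvg_shift_right s) (f_right MA)).
  rewrite Fs; apply: cvg_trans h; apply: near_eq_cvg; near=> t.
  by rewrite /= Fneq// gt_eqF.
have Fl : F t @[t --> s^'-] --> F s - ((C2 - C1) *m x) i 0.
  rewrite Fs mulmxBl !mxE opprB addrC subrK.
  have h : (f A (t - s) *m x) i 0 @[t --> s^'-] --> (C1 *m x) i 0.
    apply: (@cvg_mulmx_coord (s^'-)).
    exact: (cvg_comp _ _ (cvg_shift_left s) (f_left MA)).
  move: h; rewrite mxE => h; apply: cvg_trans h; apply: near_eq_cvg; near=> t.
  by rewrite /= Fneq// lt_eqF.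
have bound t : t \in `]a - 1, b + 2[ -> t != s ->
    `|(kernel_slope A (t - s) *m x) i 0| <= K * \sum_j `|x j 0|.
  move=> tab ts; rewrite mxE (le_trans (ler_norm_sum _ _ _))// mulr_sumr.
  apply: ler_sum => j _; rewrite normrM ler_wpM2r// /kernel_slope Ag HK//.
    move: tab; rewrite in_itv/= => /andP[t1 t2].
    apply: (le_lt_trans (ler_normB _ _)); rewrite ltrD2r ltr_norml.
    have := ler_norm b; have := ler_norm (- a); rewrite normrN => ha hb.
    by have := normr_ge0 a; have := normr_ge0 b => ? ?; apply/andP; split; lra.
  by rewrite subr_eq0.
have [] := FTC_with_jump ab _ mslope dF Fr Fl bound.
  by rewrite mulr_ge0// sumr_ge0.
by [].
Unshelve. all: by end_near. Qed.

End kernel_paths.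

(** * Sigma-finiteness and comparison of integrals *)

Section sigma_finite_copy.
Context (R : realType) dT (T : measurableType dT) (m : {measure set T -> \bar R}).

(** [N w] is sigma-finite for almost every [w] only, so sigma-finiteness comes as a hypothesis; the
    alias turns it into an instance that Fubini's theorem can use. *)
Definition with_sigma_finite (sf : sigma_finite [set: T] m) : set T -> \bar R := m.

Variable sf : sigma_finite [set: T] m.
HB.instance Definition _ := Measure.copy (with_sigma_finite sf) m.
HB.instance Definition _ := Measure_isSigmaFinite.Build _ _ _ (with_sigma_finite sf) sf.

End sigma_finite_copy.

Section integral_lemmas.
Context (R : realType).
Notation leb := (@lebesgue_measure R).

(** By Markov's inequality each [B k] has measure at most [k + 1] times a finite integral; together
    with the null set where [v] vanishes they cover the space. For [N w], the weight [v] is the jump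
    size and [s] the jump time. *)
Lemma sigma_finite_weight dT (T : measurableType dT) (m : {measure set T -> \bar R})
    (v s : T -> R) :
  measurable_fun [set: T] v -> measurable_fun [set: T] s -> (forall p, 0 <= v p) ->
  m [set p | v p = 0] = 0%E ->
  (forall k : nat, (\int[m]_p (if `|s p| <= k%:R then v p else 0)%:E < +oo)%E) ->
  sigma_finite [set: T] m.
Proof.
move=> mv ms v0 mv0 vfin.
pose B (k : nat) := [set p | `|s p| <= k%:R] `&` [set p | k.+1%:R^-1 <= v p].
have mB k : measurable (B k).
  apply: measurableI.
    rewrite (_ : [set p | _] = (fun p => `|s p|) @^-1` `]-oo, k%:R]); last first.
      by apply/seteqP; split => p /=; rewrite in_itv.
    by rewrite -[X in measurable X]setTI; apply: measurableT_comp.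
  rewrite (_ : [set p | _] = v @^-1` `[k.+1%:R^-1, +oo[); last first.
    by apply/seteqP; split => p /=; rewrite in_itv/= andbT.
  by rewrite -[X in measurable X]setTI; exact: mv.
have mZ : measurable [set p | v p = 0].
  by rewrite (_ : mkset _ = v @^-1` [set 0])// -[X in measurable X]setTI; exact: mv.
have Bfin k : (m (B k) < +oo)%E.
  have c0 : (0 < (k.+1%:R^-1 : R)%:E)%E by rewrite lte_fin invr_gt0.
  rewrite -(@lte_pmul2l _ (k.+1%:R^-1 : R)%:E)// gt0_muley//.
  apply: le_lt_trans (vfin k); rewrite -(setIT (B k)) -integral_indic//.
  rewrite -ge0_integralZl//; last first.
    by apply/measurable_EFinP; exact: measurable_indic.
  apply: le_lower_integral => p _; rewrite -EFinM lee_fin; first by rewrite mulr_ge0.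
  rewrite indicE; have [|_] := boolP (p \in _); last first.
    by rewrite mulr0; case: ifP.
  by rewrite inE => -[/= -> ?]; rewrite mulr1.
exists (fun k => [set p | v p = 0] `|` B k).
  apply/seteqP; split => // p _.
  have [p0|p0] := eqVneq (v p) 0; first by exists 0%N => //; left.
  pose k := Num.bound (Num.max `|s p| (v p)^-1).
  have vp : 0 < v p by rewrite lt_neqAle eq_sym p0 v0.
  have mk : Num.max `|s p| (v p)^-1 < k%:R by apply: archi_boundP; rewrite le_max normr_ge0.
  exists k => //; right; split => /=.
    by apply: le_trans (ltW mk); rewrite le_max lexx.
  rewrite -[leRHS]invrK lef_pV2 ?posrE ?invr_gt0//.
  apply: le_trans (_ : k%:R <= _); last by rewrite ler_nat.
  by apply: le_trans (ltW mk); rewrite le_max lexx orbT.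
move=> k; split; first exact: measurableU.
by apply: le_lt_trans (Bfin k); rewrite -[leRHS]add0e -mv0; exact: measureU2.
Qed.

Lemma Rintegral_eq_off_null dT (T : measurableType dT) (m : {measure set T -> \bar R})
    (D Z : set T) (h k : T -> R) :
  measurable D -> measurable Z -> m Z = 0%E ->
  measurable_fun D h -> measurable_fun [set: T] k ->
  (forall p, ~ Z p -> D p /\ h p = k p) ->
  (\int[m]_(p in D) h p = \int[m]_p k p)%R.
Proof.
move=> mD mZ Z0 mh mk hk; congr fine; rewrite integral_mkcond.
apply: ae_eq_integral => //.
- by apply/(measurable_restrictT _ mD)/measurable_EFinP.
- exact/measurable_EFinP.
exists Z; split => // p /= kp; apply: contrapT => Zp; apply: kp => _.
by have [Dp e] := hk p Zp; rewrite patchE mem_set// e.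
Qed.

Lemma Rintegral_sum_scale dT (T : measurableType dT) (m : {measure set T -> \bar R})
    (J : Type) (r : seq J) (c : J -> R) (h : J -> T -> R) :
  (forall j, m.-integrable [set: T] (EFin \o h j)) ->
  (\int[m]_p \sum_(j <- r) (c j * h j p) = \sum_(j <- r) c j * \int[m]_p h j p)%R.
Proof.
move=> ih.
have ich j : m.-integrable [set: T] (EFin \o (fun p => c j * h j p)).
  rewrite (_ : _ \o _ = (fun p => (c j)%:E * (h j p)%:E)%E)//.
  exact: (@integrableZl _ _ _ m _ measurableT (c j) _ (ih j)).
have isum (l : seq J) : m.-integrable [set: T] (EFin \o (fun p => \sum_(j <- l) (c j * h j p))).
  rewrite (_ : _ \o _ = (fun p => \sum_(j <- l) (c j * h j p)%:E)%E); last first.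
    by apply/funext => p /=; rewrite sumEFin.
  by apply: integrable_sum => // j _; exact: ich.
elim: r => [|j r IH].
  by under eq_Rintegral do rewrite big_nil; rewrite big_nil /Rintegral integral0.
under eq_Rintegral do rewrite big_cons.
by rewrite RintegralD// big_cons -IH RintegralZl.
Qed.

Lemma integral_itv_window dT (T : measurableType dT) (h : R -> T -> R) (a b : R) :
  measurable_fun [set: T * R] (fun q => h q.2 q.1) ->
  measurable_fun [set: T] (fun p => \int[leb]_(u in `[a, b]) (`|h u p|%R)%:E)%E.
Proof.
move=> mh; pose w (q : T * R) : \bar R := (`|h q.2 q.1| * \1_(`[a, b]) q.2)%:E.
have mw : measurable_fun [set: T * R] w.
  apply/measurable_EFinP; apply: measurable_funM; first exact: measurableT_comp.
  by apply: measurableT_comp => //; exact: measurable_indic.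
have w0 q : (0 <= w q)%E by rewrite lee_fin mulr_ge0.
have := measurable_fun_fubini_tonelli_F (m2 := leb) w mw w0.
congr measurable_fun; apply/funext => p; rewrite /fubini_F [RHS]integral_mkcond.
apply: eq_integral => u _; rewrite /w patchE /= indicE.
by case: (_ \in _); rewrite ?mulr1 ?mulr0.
Qed.

(** The hypotheses bound [f A s], whereas the process at time 0 involves [f A (- s)]. *)
Lemma integral_opp (G : R -> \bar R) : measurable_fun [set: R] G ->
  (forall s, 0 <= G s)%E -> (\int[leb]_s G s = \int[leb]_s G (- s)%R)%E.
Proof.
move=> mG G0.
have mopp : measurable_fun [set: measurableTypeR R] (-%R : _ -> measurableTypeR R).
  exact: oppr_measurable.
have := ge0_integral_pushforward mopp leb measurableT mG (fun s _ => G0 s).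
rewrite preimage_setT => <-.
apply: eq_measure_integral => B mB _; exact/esym/lebesgue_measureN.
Qed.

(** [h] may be non-measurable and is only compared with; the constant [c] is taken out of the
    integral of the measurable side, written as [c] times [F / c]. *)
Lemma le_lower_integral_scale dT (T : measurableType dT) (m : {measure set T -> \bar R})
    (F h : T -> \bar R) (c : R) : 0 < c -> measurable_fun [set: T] F ->
  (forall x, 0 <= F x)%E -> (forall x, F x <= c%:E * h x)%E ->
  (\int[m]_x F x <= c%:E * \int[m]_x h x)%E.
Proof.
move=> c0 mF F0 Fh.
have FE x : F x = (c%:E * (c^-1%:E * F x))%E by rewrite muleA -EFinM mulfV ?gt_eqF// mul1e.
have cF0 x : (0 <= c^-1%:E * F x)%E by rewrite mule_ge0// lee_fin invr_ge0 ltW.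
under eq_integral do rewrite FE.
rewrite ge0_integralZl//; last 2 first.
  by apply: emeasurable_funM.
  by rewrite lee_fin ltW.
rewrite lee_pmul2l//; apply: le_lower_integral => x _ //.
by rewrite -(@lee_pmul2l _ c%:E)// -FE.
Qed.

(** The drift term of [stoch_integral] is an iterated integral, while the superposition lemmas use
    the product measure. The exceptional [y] may depend on [x]; the [x] at which the section of [k]
    is not integrable lie in the further null set [W]. *)
Lemma iterated_Rintegral d1 d2 (T1 : measurableType d1) (T2 : measurableType d2)
    (m1 : {sigma_finite_measure set T1 -> \bar R})
    (m2 : {sigma_finite_measure set T2 -> \bar R}) (D Z : set T1) (h k : T1 * T2 -> R) :
  measurable D -> measurable Z -> m1 Z = 0%E ->
  measurable_fun (D `*` [set: T2]) h ->
  (m1 \x m2)%E.-integrable [set: T1 * T2] (EFin \o k) ->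
  (forall x, ~ Z x -> D x /\ exists Y, [/\ measurable Y, m2 Y = 0%E &
     forall y, ~ Y y -> h (x, y) = k (x, y)]) ->
  (\int[m1]_(x in D) \int[m2]_y h (x, y) = \int[(m1 \x m2)%E]_p k p)%R.
Proof.
move=> mD mZ Z0 mh ik hk.
have mDT : measurable (D `*` [set: T2]) by exact: measurableX.
pose hD p := if p \in D `*` [set: T2] then h p else 0.
have mhD : measurable_fun [set: T1 * T2] hD by exact: measurable_patch0.
have mk : measurable_fun [set: T1 * T2] k by apply/measurable_EFinP; exact: measurable_int ik.
have hDE x : D x -> (\int[m2]_y h (x, y) = \int[m2]_y hD (x, y))%R.
  by move=> Dx; apply: eq_Rintegral => y _; rewrite /hD mem_set.
have mI : measurable_fun [set: T1] (fun x => \int[m2]_y hD (x, y))%R.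
  apply: measurableT_comp => //.
  have me : measurable_fun [set: T1 * T2] (EFin \o hD) by exact/measurable_EFinP.
  rewrite (_ : (fun x => _) = (fun x => (\int[m2]_y ((EFin \o hD)^\+) (x, y)) -
     \int[m2]_y ((EFin \o hD)^\-) (x, y))%E); last first.
    apply/funext => x; rewrite [LHS]integralE.
    by congr (_ - _)%E; apply: eq_integral => y _; rewrite ?funeposE ?funenegE.
  apply: emeasurable_funB; apply: measurable_fun_fubini_tonelli_F => //.
    exact: measurable_funepos.
  exact: measurable_funeneg.
transitivity (\int[m1]_(x in D) \int[m2]_y hD (x, y))%R.
  by apply: eq_Rintegral => x /set_mem; exact: hDE.
have := ae_integrable1 ik => -[W [mW W0 HW]].
rewrite [RHS]/Rintegral -(integral12_prod_meas1 ik).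
congr fine; rewrite integral_mkcond; apply: ae_eq_integral => //.
- by apply/(measurable_restrictT _ mD)/measurable_funTS/measurable_EFinP.
- exact: measurable_fubini_F ik.
exists (Z `|` W); split; first exact: measurableU.
  exact: null_set_setU.
move=> x /= ne; apply: contrapT => /not_orP[nZ nW]; apply: ne => _.
have [Dx [Y [mY Y0 HY]]] := hk x nZ.
have ix : m2.-integrable [set: T2] (fun y => (EFin \o k) (x, y)).
  by apply: contrapT => nx; apply: nW; exact: HW.
rewrite patchE mem_set//= -hDE// /fubini_F -[RHS]fineK; last exact: integrable_fin_num ix.
congr EFin; apply: (Rintegral_eq_off_null (k := fun y => k (x, y)) _ mY Y0) => //.
- have := measurableT_comp mhD (measurable_pair1 x).
  by congr measurable_fun; apply/funext => y; rewrite /hD /= mem_set.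
- exact: (measurableT_comp mk (measurable_pair1 x)).
- by move=> y nY; split => //; exact: HY.
Qed.

End integral_lemmas.

Lemma cvg_cV (R : realType) (T : Type) (F : set_system T) (FF : Filter F) (k : nat)
    (h : T -> 'cV[R]_k) (l : 'cV[R]_k) :
  (forall i, h t i 0 @[t --> F] --> l i 0) -> h @ F --> l.
Proof.
move=> hl; apply/cvg_ballP => e e0.
have H : \forall t \near F, forall i, `|l i 0 - h t i 0| < e.
  by apply: filter_forall => i; move/cvgrPdist_lt: (hl i); exact.
apply: filterS H => t ht; split => // i j; rewrite !ord1; exact: ht.
Qed.

(** * Superpositions of kernel paths *)

Section kernel_noise.
Context (R : realType) (n d : nat) (f : 'M[R]_d -> R -> 'M[R]_(n, d)) (C1 C2 : 'M[R]_(n, d)).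
Notation Mm := (@Mminus R d).
Notation leb := (@lebesgue_measure R).
Notation g := (kernel_derivative f).
Hypothesis mf : measurable_fun (Mm `*` [set: R]) (fun p => f p.1 p.2).
Hypothesis df : forall A s, Mm A -> s != 0 -> derivable (f A) s 1.
Hypothesis f_left : forall A, Mm A -> f A s @[s --> 0^'-] --> C1.
Hypothesis f_right : forall A, Mm A -> f A s @[s --> 0^'+] --> C2.
Hypothesis cvg_g : forall A, Mm A -> cvg (derive1 (f A) s @[s --> 0^'+]).
Variable delta : R.
Hypothesis delta_gt0 : 0 < delta.

Context dT (T : measurableType dT) (x : T -> 'cV[R]_d) (a : T -> 'M[R]_d) (s : T -> R).
Hypotheses (mx : forall j, measurable_fun [set: T] (fun p => x p j 0))
  (ma : measurable_fun [set: T] a) (ms : measurable_fun [set: T] s).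

(** [x], [a] and [s] read a jump, a matrix and a time off a point of [T]: its coordinates in the
    case of [N w]; the constant drift vector and the two projections in the case of [pi \x leb]. *)
Definition noise_path i t p := (kernel_path f C2 delta (a p) (t - s p) *m x p) i 0.
Definition noise_slope i u p := (kernel_slope f delta (a p) (u - s p) *m x p) i 0.
Definition noise_jump i p := (kernel_jump f C1 C2 delta (a p) *m x p) i 0.

Lemma measurable_noise_path i t : measurable_fun [set: T] (noise_path i t).
Proof.
rewrite /noise_path; under eq_fun do rewrite mxE.
apply: measurable_sum => j; apply: measurable_funM => //.
have mp : measurable_fun [set: T] (fun p => (a p, t - s p)).
  by apply: measurable_fun_pair => //; exact: measurable_funB.
exact: (measurableT_comp (measurable_kernel_path_coord C2 mf delta i j) mp).
Qed.

Lemma measurable_noise_slope_joint i :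
  measurable_fun [set: T * R] (fun q => noise_slope i q.2 q.1).
Proof.
rewrite /noise_slope; under eq_fun do rewrite mxE.
apply: measurable_sum => j; apply: measurable_funM => //; last first.
  exact: (measurableT_comp (mx j) measurable_fst).
have mp : measurable_fun [set: T * R] (fun q => (a q.1, q.2 - s q.1)).
  apply: measurable_fun_pair; first exact: (measurableT_comp ma).
  by apply: measurable_funB => //; exact: (measurableT_comp ms).
exact: (measurableT_comp (measurable_kernel_slope_coord mf df cvg_g _ i j) mp).
Qed.

Lemma measurable_noise_slope i u : measurable_fun [set: T] (noise_slope i u).
Proof.
exact: (measurableT_comp (measurable_noise_slope_joint i) (measurable_pair2 u)).
Qed.

Lemma measurable_noise_jump i : measurable_fun [set: T] (noise_jump i).
Proof.
rewrite /noise_jump; under eq_fun do rewrite mxE.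
apply: measurable_sum => j; apply: measurable_funM => //.
exact: (measurableT_comp (measurable_kernel_jump_coord C1 C2 mf delta i j) ma).
Qed.

Lemma measurable_enorm_noise : measurable_fun [set: T] (fun p => enorm (x p)).
Proof.
by apply: (measurableT_comp (@measurable_enorm R d)); apply/measurable_fun_mx => i j; rewrite ord1.
Qed.

Notation eta := (Num.min delta 1).

Lemma noise_slope_le_kernel_sup i (t1 t2 u : R) p : u \in `[t1, t2] ->
  ((`|noise_slope i u p|%R)%:E <= kernel_sup g t1 t2 (a p) (s p) * (enorm (x p))%:E)%E.
Proof.
move=> ut; have t12 : t1 <= t2 by move: ut; rewrite in_itv/= => /andP[/le_trans]; exact.
rewrite /noise_slope /kernel_slope; case: ifP => _; last first.
  by rewrite mul0mx mxE normr0 mule_ge0// ?kernel_sup_ge0// lee_fin enorm_ge0.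
apply: (@le_trans _ _ ((opnorm (g (a p) (u - s p)))%:E * (enorm (x p))%:E)%E).
  by rewrite -EFinM lee_fin coord_mulmx_le.
apply: lee_wpmul2r; first by rewrite lee_fin enorm_ge0.
by apply: ereal_sup_ubound; exists u.
Qed.

Lemma integral_noise_slope_le_kernel_sup i (t1 t2 : R) p : t1 <= t2 -> t2 - t1 <= 1 ->
  (\int[leb]_(u in `[t1, t2]) (`|noise_slope i u p|%R)%:E <=
   kernel_sup g t1 t2 (a p) (s p) * (enorm (x p))%:E)%E.
Proof.
move=> t12 t1_; pose c := (kernel_sup g t1 t2 (a p) (s p) * (enorm (x p))%:E)%E.
have c0 : (0 <= c)%E by rewrite mule_ge0// ?kernel_sup_ge0// lee_fin enorm_ge0.
apply: (@le_trans _ _ (\int[leb]_(u in `[t1, t2]) cst c u)%E).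
  apply: le_lower_integral => u ut; first by rewrite lee_fin.
  exact: noise_slope_le_kernel_sup.
have -> : (\int[leb]_(u in `[t1, t2]) cst c u = c * leb `[t1, t2])%E by exact: integral_cst.
rewrite lebesgue_measure_itv/= -/c; case: ifP => _; last by rewrite mule0.
by rewrite muleC gee_pMl.
Qed.

(** These conditions on one measure give the superposition lemmas at every time. The windows are
    indexed by [nat], so that almost every [N w] qualifies through countably many almost sure
    statements. *)
Definition regular_noise (m : {measure set T -> \bar R}) : Prop :=
  [/\ sigma_finite [set: T] m,
      forall i, m.-integrable [set: T] (EFin \o noise_path i 0),
      forall i (k : nat),
        (\int[m]_p \int[leb]_(u in `[(k%:R * eta)%R, (k%:R * eta + eta)%R])
           (`|noise_slope i u p|%R)%:E < +oo)%E /\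
        (\int[m]_p \int[leb]_(u in `[(- (k%:R * eta + eta))%R, (- (k%:R * eta))%R])
           (`|noise_slope i u p|%R)%:E < +oo)%E &
      forall M : R, (\int[m]_p (if (`|s p| <= M)%R then (enorm (x p))%:E else 0) < +oo)%E].

Variables (m : {measure set T -> \bar R}) (rm : regular_noise m).

Let sf : sigma_finite [set: T] m. Proof. by have [] := rm. Qed.
Let m' : {sigma_finite_measure set T -> \bar R} := with_sigma_finite sf.

Let islope i (M : R) :
  (\int[m']_p \int[leb]_(u in `[(- M)%R, M]) (`|noise_slope i u p|%R)%:E < +oo)%E.
Proof.
have [_ _ H _] := rm; apply: (@integral_itv_pieces _ _ _ _ _ eta) => //; first by rewrite lt_min delta_gt0/=.
- move=> p; exact: (measurableT_comp (measurable_noise_slope_joint i) (measurable_pair1 p)).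
- by move=> b c; apply: integral_itv_window; exact: measurable_noise_slope_joint.
Qed.

Let ijump i (M : R) :
  (\int[m']_p (if (`|s p| <= M)%R then (`|noise_jump i p|%R)%:E else 0) < +oo)%E.
Proof.
have [_ _ _ H] := rm.
apply: (@le_lt_trans _ _ ((opnorm (C2 - C1))%:E *
    \int[m']_p (if (`|s p| <= M)%R then (enorm (x p))%:E else 0))%E).
  rewrite -ge0_integralZl//; last 3 first.
  - apply: measurable_fun_ifT => //; last exact/measurable_EFinP/measurable_enorm_noise.
    by apply: measurable_fun_ler => //; exact: measurableT_comp.
  - by move=> p _; case: ifP => _ //; rewrite lee_fin enorm_ge0.
  - by rewrite lee_fin opnorm_ge0.
  apply: le_lower_integral => p _; first by case: ifP => _ //; rewrite lee_fin.
  case: ifP => _; last by rewrite mule0.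
  rewrite -EFinM lee_fin /noise_jump /kernel_jump; case: ifP => _.
    exact: coord_mulmx_le.
  by rewrite mul0mx mxE normr0 mulr_ge0// ?opnorm_ge0 ?enorm_ge0.
by rewrite lte_mul_pinfty// ?lee_fin ?opnorm_ge0.
Qed.

Lemma noise_bounded_time_integrable (I : set R) (M : R) j : measurable I ->
  I `<=` `[- M, M] -> m.-integrable [set: T] (fun p => (\1_I (s p) * x p j 0)%:E).
Proof.
move=> mI IM; have [_ _ _ H] := rm.
apply/integrableP; split.
  apply/measurable_EFinP; apply: measurable_funM => //.
  by apply: measurableT_comp => //; exact: measurable_indic.
apply: le_lt_trans (H M); apply: le_lower_integral => p _ //.
rewrite indicE; have [|_] := boolP (s p \in I); last first.
  by rewrite mul0r abse0; case: ifP => // _; rewrite lee_fin enorm_ge0.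
rewrite inE => /IM/=; rewrite in_itv/= -ler_norml => ->.
by rewrite mul1r lee_fin coord_le_enorm.
Qed.

(** Pulling [C2 - C1] out of the jump integral leaves the increment of the driving process. The time
    set [I] that defines the latter may differ from []b, c]] at endpoints; [B] absorbs these times,
    as well as the matrices that are not [good], where [noise_jump] vanishes. *)
Lemma integral_noise_jump (B : set T) (I : set R) (M b c : R) i :
  measurable I -> I `<=` `[- M, M] -> measurable B -> m B = 0%E ->
  (forall p, ~ B p -> good f delta (a p) /\ (s p \in I) = (b < s p <= c)) ->
  (\int[m]_p (if b < s p <= c then noise_jump i p else 0) =
    ((C2 - C1) *m \col_j (\int[m]_p (\1_I (s p) * x p j 0))) i 0)%R.
Proof.
move=> mI IM mB B0 BI; have mind : measurable_fun [set: T] (fun p => \1_I (s p) : R).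
  by apply: measurableT_comp => //; exact: measurable_indic.
have ix j := noise_bounded_time_integrable j mI IM.
have -> : (((C2 - C1) *m \col_j (\int[m]_p (\1_I (s p) * x p j 0))) i 0 =
    \int[m]_p \sum_j ((C2 - C1) i j * (\1_I (s p) * x p j 0)))%R.
  rewrite mxE Rintegral_sum_scale//.
  by apply: eq_bigr => j _; congr (_ * _); rewrite mxE.
apply: (Rintegral_eq_off_null (k := fun p =>
  \sum_j ((C2 - C1) i j * (\1_I (s p) * x p j 0))) _ mB B0) => //.
- apply: measurable_fun_ifT => //; last exact: measurable_noise_jump.
  by apply: measurable_and; [exact: measurable_fun_ltr|exact: measurable_fun_ler].
- by apply: measurable_sum => j; apply: measurable_funM => //; exact: measurable_funM.
move=> p /BI[gp sI]; split => //.
rewrite indicE -sI; case: ifP => _; last by rewrite big1// => j _; rewrite mul0r mulr0.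
rewrite /noise_jump /kernel_jump mem_set// mxE.
by apply: eq_bigr => j _; rewrite mul1r.
Qed.

Let increment i p (b c : R) : b <= c ->
  leb.-integrable `[b, c] (fun u => (noise_slope i u p)%:E) /\
  noise_path i c p - noise_path i b p = (\int[leb]_(u in `[b, c]) noise_slope i u p)%R +
                      (if b < s p <= c then noise_jump i p else 0).
Proof. exact: kernel_path_increment. Qed.

Let ipath i : m'.-integrable [set: T] (EFin \o noise_path i 0).
Proof. by have [_ H _ _] := rm; exact: H. Qed.

Lemma noise_integrable i t : m.-integrable [set: T] (EFin \o noise_path i t).
Proof.
exact: (superposition_integrable (m := m')
  (measurable_noise_slope_joint i) ms (measurable_noise_jump i)
  (ipath i) (islope i) (ijump i) (increment i)).
Qed.

Lemma noise_slope_integrable i b c : b <= c ->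
  leb.-integrable `[b, c] (fun u => (\int[m]_p noise_slope i u p)%:E).
Proof.
exact: (superposition_derivative_integrable (m := m') (measurable_noise_slope_joint i)
  (islope i)).
Qed.

Lemma noise_increment i b c : b <= c ->
  (\int[m]_p noise_path i c p)%R - (\int[m]_p noise_path i b p)%R =
  (\int[leb]_(u in `[b, c]) \int[m]_p noise_slope i u p)%R +
  (\int[m]_p (if (b < s p <= c)%R then noise_jump i p else 0))%R.
Proof.
exact: (superposition_increment (m := m')
  (measurable_noise_slope_joint i) ms (measurable_noise_jump i)
  (ipath i) (islope i) (ijump i) (increment i)).
Qed.

Lemma noise_cadlag i t :
  (\int[m]_p noise_path i u p)%R @[u --> t^'+] --> (\int[m]_p noise_path i t p)%R /\
  cvg ((\int[m]_p noise_path i u p)%R @[u --> t^'-]).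
Proof.
exact: (superposition_cadlag (m := m')
  (measurable_noise_slope_joint i) ms (measurable_noise_jump i)
  (ipath i) (islope i) (ijump i) (increment i)).
Qed.

Lemma noise_bounded_variation i b c : b <= c ->
  bounded_variation b c (fun t => \int[m]_p noise_path i t p)%R.
Proof.
exact: (superposition_bounded_variation (m := m')
  (measurable_noise_slope_joint i) ms (measurable_noise_jump i)
  (ipath i) (islope i) (ijump i) (increment i)).
Qed.

End kernel_noise.

(** * The jump measure *)

(** Used with the identity map, to pass between the two measurable structures carried by the same
    product. *)
Lemma integral_image_measure (R : realType) d1 d2 (T1 : measurableType d1)
    (T2 : measurableType d2) (g : T1 -> T2) (m1 : {measure set T1 -> \bar R})
    (m2 : {measure set T2 -> \bar R}) (f : T2 -> \bar R) :
  measurable_fun [set: T1] g -> (forall B, measurable B -> m2 B = m1 (g @^-1` B)) ->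
  measurable_fun [set: T2] f -> (\int[m2]_y f y = \int[m1]_x f (g x))%E.
Proof.
move=> mg m12 mf.
have ge0 (h : T2 -> \bar R) : measurable_fun [set: T2] h -> (forall y, 0 <= h y)%E ->
    (\int[m2]_y h y = \int[m1]_x h (g x))%E.
  move=> mh h0; have := ge0_integral_pushforward mg m1 measurableT mh (fun y _ => h0 y).
  rewrite preimage_setT => <-; apply: eq_measure_integral => B mB _; exact: m12.
rewrite integralE [RHS]integralE; congr (_ - _)%E.
  rewrite (ge0 (f^\+)%E)//; last exact: measurable_funepos.
  by apply: eq_integral => x _; rewrite !funeposE.
rewrite (ge0 (f^\-)%E)//; last exact: measurable_funeneg.
by apply: eq_integral => x _; rewrite !funenegE.
Qed.

(* The Lebesgue measure lives on a copy of [R] with its own display: this gives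
   [pi \x leb] the structure of a measure on ['M[R]_d * R]. *)
Section base_measure.
Context (R : realType) (d : nat) (pi : probability 'M[R]_d R).
Let pl : {measure set _ -> \bar R} := (pi \x @lebesgue_measure R)%E.

HB.instance Definition _ := isMeasure.Build _ ('M[R]_d * R)%type R (base_measure pi)
  (measure0 pl) (measure_ge0 pl) (@measure_semi_sigma_additive _ _ _ pl).

Lemma sigma_finite_product_lebesgue : sigma_finite setT pl.
Proof.
exists (fun k : nat => [set: 'M[R]_d] `*` `[- k%:R, k%:R]).
  apply/seteqP; split => // -[A s] _.
  exists (Num.bound `|s|) => //; split => //=.
  by rewrite in_itv/= -ler_norml ltW// archi_boundP.
move=> k; split; first exact: measurableX.
have -> : (pl ([set: 'M[R]_d] `*` `[(- k%:R)%R, k%:R]) =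
    pi setT * @lebesgue_measure R `[(- k%:R)%R, k%:R])%E by exact: product_measure1E.
rewrite probability_setT mul1e lebesgue_measure_itv/=.
by case: ifP => _ //; rewrite -EFinD ltry.
Qed.

HB.instance Definition _ := Measure_isSigmaFinite.Build _ ('M[R]_d * R)%type R
  (base_measure pi) sigma_finite_product_lebesgue.

End base_measure.

Section poisson_noise.
Context (R : realType) (d : nat).
Variables (nu : {measure set 'cV[R]_d -> \bar R}) (pi : probability 'M[R]_d R).
Notation leb := (@lebesgue_measure R).
Notation E := ('cV[R]_d * ('M[R]_d * R))%type.
Hypotheses (nu0 : nu [set 0] = 0%E)
  (nu_sqr : (\int[nu]_x (Num.min 1 (enorm x ^+ 2))%:E < +oo)%E)
  (nu_small : (\int[nu]_(x in [set x : 'cV[R]_d | (enorm x <= 1)%R]) (enorm x)%:E < +oo)%E).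

Lemma levy_measure_sigma_finite : sigma_finite [set: 'cV[R]_d] nu.
Proof.
apply: (@sigma_finite_weight _ _ _ _ (fun x => Num.min 1 (enorm x ^+ 2)) (cst 0)) => //.
- apply: measurable_minr => //; apply: measurable_funX; exact: measurable_enorm.
- by move=> x; rewrite le_min ler01 sqr_ge0.
- rewrite -nu0; congr (nu _); apply/seteqP; split => x /=; last first.
    by move=> ->; rewrite enorm0 expr0n/= min_r.
  have [_ e|_ /eqP e] := leP 1 (enorm x ^+ 2).
    by have : (1 : R) != 0 by []; rewrite e eqxx.
  by apply: enorm_eq0; apply/eqP; rewrite -sqrf_eq0.
- by move=> k; under eq_integral do rewrite normr0 ler0n.
Qed.

(** Where [enorm x <= 1] the integrand is that of the small jumps; beyond, it equals
    [Num.min 1 (enorm x ^+ 2)], both being 1. *)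
Lemma integral_min_enorm : (\int[nu]_x (Num.min 1 (enorm x))%:E < +oo)%E.
Proof.
have menorm := @measurable_enorm R d.
have mB : measurable [set x : 'cV[R]_d | (enorm x <= 1)%R].
  rewrite (_ : mkset _ = @enorm R d @^-1` `]-oo, 1]); last first.
    by apply/seteqP; split => x /=; rewrite in_itv.
  by rewrite -[X in measurable X]setTI; exact: menorm.
have mres : measurable_fun [set: 'cV[R]_d]
    ((fun x : 'cV[R]_d => (enorm x)%:E) \_ [set x | (enorm x <= 1)%R]).
  by apply/(measurable_restrictT _ mB)/measurable_funTS/measurable_EFinP.
have min0 (x : 'cV[R]_d) : 0 <= Num.min 1 (enorm x ^+ 2) by rewrite le_min ler01 sqr_ge0.
apply: (@le_lt_trans _ _ (\int[nu]_x ((Num.min 1 (enorm x ^+ 2))%:E +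
    ((fun x : 'cV[R]_d => (enorm x)%:E) \_ [set x | (enorm x <= 1)%R]) x))%E).
  apply: le_lower_integral => x _; first by rewrite lee_fin le_min ler01 enorm_ge0.
  rewrite patchE; have [x1|x1] := leP (enorm x) 1.
    by rewrite mem_set// -EFinD lee_fin lerDr.
  rewrite ifF; last by apply/negbTE; rewrite notin_setE/=; apply/negP; rewrite -ltNge.
  rewrite [X in (_ + X)%E](_ : _ = 0%E)// adde0.
  by rewrite lee_fin !min_l// ?exprn_ege1// ltW.
rewrite ge0_integralD//; last 3 first.
- by move=> x _; rewrite lee_fin.
- apply/measurable_EFinP; apply: measurable_minr => //; exact: measurable_funX.
- by move=> x _; rewrite patchE; case: ifP => // _; rewrite lee_fin enorm_ge0.
by apply: lte_add_pinfty => //; rewrite -integral_mkcond.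
Qed.

Let nu' : {sigma_finite_measure set 'cV[R]_d -> \bar R} :=
  with_sigma_finite levy_measure_sigma_finite.
Let mu : {measure set E -> \bar R} := (nu' \x base_measure pi)%E.

Context dO (Omega : measurableType dO) (P : probability Omega R).
Variable N : Omega -> {measure set E -> \bar R}.
Hypothesis NP : poisson_random_measure P (nu \x base_measure pi)%E N.

Let NP' : poisson_random_measure P mu N. Proof. exact: NP. Qed.

(** The product with [nu] stays null even when [nu] is infinite, since [+oo * 0 = 0]. *)
Lemma ae_noise_null (B : set ('M[R]_d * R)) : measurable B -> (pi \x leb)%E B = 0%E ->
  {ae P, forall w, N w ([set: 'cV[R]_d] `*` B) = 0%E}.
Proof.
move=> mB B0; apply: (poisson_random_measure_null NP'); first exact: measurableX.
have -> : mu ([set: 'cV[R]_d] `*` B) = (nu' setT * base_measure pi B)%E.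
  exact: product_measure1E.
by rewrite [X in (_ * X)%E]B0 mule0.
Qed.

Lemma ae_noise_time_null (t : R) :
  {ae P, forall w, N w [set p | p.2.2 = t] = 0%E}.
Proof.
have m_t : measurable ([set: 'M[R]_d] `*` [set t]) by exact: measurableX.
have t0 : (pi \x leb)%E ([set: 'M[R]_d] `*` [set t]) = 0%E.
  have -> : ((pi \x leb) ([set: 'M[R]_d] `*` [set t]) = pi setT * leb [set t])%E.
    exact: product_measure1E.
  by rewrite lebesgue_measure_set1 mule0.
have := ae_noise_null m_t t0.
have -> : [set: 'cV[R]_d] `*` ([set: 'M[R]_d] `*` [set t]) = [set p : E | p.2.2 = t].
  by apply/seteqP; split => p //= [_ []].
by [].
Qed.

Lemma ae_noise_zero_jump_null : {ae P, forall w, N w [set p | p.1 = 0] = 0%E}.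
Proof.
have -> : [set p : E | p.1 = 0] = [set 0] `*` [set: 'M[R]_d * R].
  by apply/seteqP; split => p //= [].
have m0 : measurable [set (0 : 'cV[R]_d)].
  rewrite (_ : [set _] = @enorm R d @^-1` [set 0]); last first.
    by apply/seteqP; split => x /=; [move=> ->; rewrite enorm0|exact: enorm_eq0].
  by rewrite -[X in measurable X]setTI; exact: measurable_enorm.
apply: (poisson_random_measure_null NP'); first exact: measurableX.
have -> : mu ([set 0] `*` setT) = (nu' [set 0%R] * base_measure pi setT)%E.
  exact: product_measure1E.
by rewrite [X in (X * _)%E]nu0 mul0e.
Qed.

Lemma measurable_noise_Rintegral (F : E -> R) : measurable_fun [set: E] F ->
  measurable_fun [set: Omega] (fun w => \int[N w]_p F p)%R.
Proof.
move=> mF; have mE : measurable_fun [set: E] (EFin \o F) by exact/measurable_EFinP.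
apply: measurableT_comp => //.
rewrite (_ : (fun w => _) = (fun w => \int[N w]_p ((EFin \o F)^\+ p) -
    \int[N w]_p ((EFin \o F)^\- p))%E); last by apply/funext => w; rewrite [LHS]integralE.
apply: emeasurable_funB; apply: (measurable_integral_N NP') => //.
  exact: measurable_funepos.
exact: measurable_funeneg.
Qed.

(** [K] bounds the inner integrals in the order in which the hypotheses of the theorem iterate them;
    it may be non-measurable, as when it is built from [kernel_sup]. *)
Lemma ae_noise_integral_lt_pinfty (F : E -> R) (K : 'M[R]_d -> \bar R) :
  (forall p, 0 <= F p) -> measurable_fun [set: E] F ->
  (forall A, \int[leb]_s \int[nu]_x (Num.min 1 (F (x, (A, s))))%:E <= K A)%E ->
  (\int[pi]_A K A < +oo)%E ->
  {ae P, forall w, (\int[N w]_p (F p)%:E < +oo)%E}.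
Proof.
move=> F0 mF FK Kfin; apply: (poisson_integral_lt_pinfty NP') => //.
have min0 p : (0 <= (Num.min 1 (F p))%:E)%E by rewrite lee_fin le_min ler01 F0.
have mmin : measurable_fun [set: E] (fun p => (Num.min 1 (F p))%:E).
  by apply/measurable_EFinP; exact: measurable_minr.
rewrite [X in (X < _)%E](fubini_tonelli2 (m1 := nu') (m2 := base_measure pi))//.
rewrite (integral_image_measure (g := id : 'M[R]_d * measurableTypeR R -> 'M[R]_d * R)
  (m1 := (pi \x leb)%E))//; last exact: measurable_fun_fubini_tonelli_G.
have mG : measurable_fun [set: 'M[R]_d * R] (fubini_G nu' (fun p => (Num.min 1 (F p))%:E)).
  exact: measurable_fun_fubini_tonelli_G.
have G0 q : (0 <= fubini_G nu' (fun p => (Num.min 1 (F p))%:E) q)%E by exact: integral_ge0.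
rewrite [X in (X < _)%E](fubini_tonelli1 (m1 := pi) (m2 := leb) _ mG G0).
apply: le_lt_trans Kfin; apply: le_lower_integral => A _; last exact: FK.
by apply: integral_ge0 => s _; exact: integral_ge0.
Qed.

Lemma ae_noise_bounded_time (M : R) :
  {ae P, forall w, (\int[N w]_p (if (`|p.2.2| <= M)%R then (enorm p.1)%:E else 0) < +oo)%E}.
Proof.
have ms : measurable_fun [set: E] (fun p => p.2.2).
  exact: (measurableT_comp measurable_snd measurable_snd).
pose F (p : E) : R := if `|p.2.2| <= M then enorm p.1 else 0.
pose c := (\int[nu]_x (Num.min 1 (enorm x))%:E)%E.
have c0 : (0 <= c)%E.
  by apply: integral_ge0 => x _; rewrite lee_fin le_min ler01 enorm_ge0.
have cfin : c \is a fin_num by rewrite ge0_fin_numE//; exact: integral_min_enorm.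
have := @ae_noise_integral_lt_pinfty F (cst (c * leb `[(- M)%R, M])%E) _ _ _ _.
move=> H; have {}H : {ae P, forall w, (\int[N w]_p (F p)%:E < +oo)%E}.
  apply: H.
  - by move=> p; rewrite /F; case: ifP => // _; exact: enorm_ge0.
  - apply: measurable_fun_ifT => //; last exact: (measurableT_comp (@measurable_enorm R d)).
    by apply: measurable_fun_ler => //; exact: measurableT_comp.
  - move=> A; rewrite /F /=.
    have -> : (\int[leb]_s \int[nu]_x (Num.min 1 (if `|s| <= M then enorm x else 0)%R)%:E =
        \int[leb]_s ((fun=> c) \_ `[(- M)%R, M]) s)%E.
      apply: eq_integral => s _; rewrite patchE /= mem_setE in_itv/= -ler_norml.
      case: ifP => _ //; under eq_integral do rewrite min_r//.
      exact: integral0.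
    by rewrite -integral_mkcond integral_cst.
  - rewrite integral_cst// [X in (_ * X < _)%E]probability_setT mule1 lebesgue_measure_itv/=.
    by case: ifP => _; rewrite ?mule0// -EFinD lte_mul_pinfty// ltry.
by apply: filterS H => w; congr (_ < _)%E; apply: eq_integral => p _; rewrite /F; case: ifP.
Qed.

End poisson_noise.

Section regular_poisson_noise.
Context (R : realType) (n d : nat) (f : 'M[R]_d -> R -> 'M[R]_(n, d)) (C1 C2 : 'M[R]_(n, d)).
Notation Mm := (@Mminus R d).
Notation leb := (@lebesgue_measure R).
Notation g := (kernel_derivative f).
Notation E := ('cV[R]_d * ('M[R]_d * R))%type.
Hypothesis mf : measurable_fun (Mm `*` [set: R]) (fun p => f p.1 p.2).
Hypothesis df : forall A s, Mm A -> s != 0 -> derivable (f A) s 1.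
Hypothesis f_left : forall A, Mm A -> f A s @[s --> 0^'-] --> C1.
Hypothesis f_right : forall A, Mm A -> f A s @[s --> 0^'+] --> C2.
Hypothesis cvg_g : forall A, Mm A -> cvg (derive1 (f A) s @[s --> 0^'+]).
Variable delta : R.
Hypothesis delta_gt0 : 0 < delta.
Variables (nu : {measure set 'cV[R]_d -> \bar R}) (pi : probability 'M[R]_d R).
Hypotheses (nu0 : nu [set 0] = 0%E)
  (nu_sqr : (\int[nu]_x (Num.min 1 (enorm x ^+ 2))%:E < +oo)%E)
  (nu_small : (\int[nu]_(x in [set x : 'cV[R]_d | (enorm x <= 1)%R]) (enorm x)%:E < +oo)%E).
Context dO (Omega : measurableType dO) (P : probability Omega R).
Variable N : Omega -> {measure set E -> \bar R}.
Hypothesis NP : poisson_random_measure P (nu \x base_measure pi)%E N.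
Hypothesis int_sup_jumps : forall t1 t2 : R, t1 <= t2 -> t2 - t1 <= delta ->
  (\int[pi]_(A in Mm) \int[leb]_s
     \int[pushforward nu (@enorm R d)]_y mine 1 `|kernel_sup g t1 t2 A s * y%:E| < +oo)%E.
Hypothesis int_jumps : (\int[pi]_(A in Mm) \int[leb]_s
     \int[nu]_x (Num.min 1 (enorm (f A s *m x)))%:E < +oo)%E.

Notation x_ := (fun p : E => p.1).
Notation a_ := (fun p : E => p.2.1).
Notation s_ := (fun p : E => p.2.2).

Lemma measurable_jump_coord j : measurable_fun [set: E] (fun p => x_ p j 0).
Proof. exact: (measurableT_comp (measurable_coord j 0) measurable_fst). Qed.

Lemma measurable_jump_matrix : measurable_fun [set: E] a_.
Proof. exact: (measurableT_comp measurable_fst measurable_snd). Qed.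

Lemma measurable_jump_time : measurable_fun [set: E] s_.
Proof. exact: (measurableT_comp measurable_snd measurable_snd). Qed.

Notation slope := (noise_slope f delta x_ a_ s_).
Notation path := (noise_path f C2 delta x_ a_ s_).

Let mx := measurable_jump_coord.
Let ma := measurable_jump_matrix.
Let ms := measurable_jump_time.

(** The Poisson criterion is applied to the window integral [I], which is measurable in the point;
    the supremum enters only through [I p <= h * enorm x], which leads to the hypothesis on [nu]
    pushed forward by the norm. *)
Lemma ae_noise_slope (i : 'I_n) (t1 t2 : R) : t1 <= t2 -> t2 - t1 <= Num.min delta 1 ->
  {ae P, forall w,
    (\int[N w]_p \int[leb]_(u in `[t1, t2]) (`|slope i u p|%R)%:E < +oo)%E}.
Proof.
move=> t12; rewrite le_min => /andP[tdelta t1_].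
pose I (p : E) := (\int[leb]_(u in `[t1, t2]) (`|slope i u p|%R)%:E)%E.
have I0 p : (0 <= I p)%E by apply: integral_ge0.
have Ifin p : I p \is a fin_num.
  have [ip _] := kernel_path_increment mf df f_left f_right cvg_g delta_gt0
    p.2.1 p.2.2 p.1 i t12.
  by rewrite ge0_fin_numE//; have /integrableP[] := ip.
have mI : measurable_fun [set: E] I.
  by apply: integral_itv_window; exact: measurable_noise_slope_joint.
pose h A s := kernel_sup g t1 t2 A s.
have Ih p : (I p <= h p.2.1 p.2.2 * (enorm p.1)%:E)%E.
  by rewrite /I /h; exact: integral_noise_slope_le_kernel_sup.
have main := @ae_noise_integral_lt_pinfty _ _ nu pi nu0 nu_sqr _ _ _ _ NP (fun p => fine (I p))
  (fun A => if A \in Mm then (\int[leb]_s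
     \int[pushforward nu (@enorm R d)]_y mine 1 `|h A s * y%:E|)%E else 0%E).
have {main} : {ae P, forall w, (\int[N w]_p (fine (I p))%:E < +oo)%E}.
  apply: main.
  - by move=> p; exact: fine_ge0.
  - exact: measurableT_comp.
  - move=> A; have [AM|AM] := boolP (A \in Mm); last first.
      have FA s x : fine (I (x, (A, s))) = 0.
        rewrite /I (eq_integral (cst 0%E)) ?integral0// => u _.
        rewrite /noise_slope /kernel_slope ifF ?mul0mx ?mxE ?normr0//.
        by apply/negbTE; apply: contra AM; rewrite !inE; exact: good_Mminus.
      under eq_integral do under eq_integral do rewrite FA min_r//.
      by under eq_integral do rewrite integral0; rewrite integral0.
    apply: le_lower_integral => s _.
      by apply: integral_ge0 => x _; rewrite lee_fin le_min ler01 fine_ge0.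
    have mfun : measurable_fun [set: R] (fun y : R => mine 1 `|h A s * y%:E|)%E.
      apply: measurable_mine => //; apply: measurableT_comp => //.
      by apply: measurable_funeM; exact/measurable_EFinP.
    have fun0 y : (0 <= mine 1 `|h A s * y%:E|)%E by rewrite le_min lee01 abse_ge0.
    rewrite (ge0_integral_pushforward (@measurable_enorm R d) nu measurableT mfun (fun y _ => fun0 y)).
    rewrite preimage_setT; apply: le_lower_integral => x _.
      by rewrite lee_fin le_min ler01 fine_ge0.
    rewrite /= le_min lee_fin ge_min lexx/=.
    apply: (@le_trans _ _ (I (x, (A, s)))); last exact: le_trans (Ih _) (lee_abs _).
    by rewrite -[leRHS]fineK// lee_fin ge_min lexx orbT.
  - have := int_sup_jumps t12 tdelta; rewrite integral_mkcond.
    by congr (_ < _)%E; apply: eq_integral => A _; rewrite patchE.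
apply: filterS => w; congr (_ < _)%E; apply: eq_integral => p _.
by rewrite fineK.
Qed.

Lemma ae_noise_path_integrable (i : 'I_n) :
  {ae P, forall w, (N w).-integrable [set: E] (EFin \o path i 0)}.
Proof.
have mpath : measurable_fun [set: E] (path i 0) by exact: measurable_noise_path.
(* At jump time 0 the path has the value [C2], whereas the hypothesis speaks of [f A 0]; the points
   at time 0 are dropped, [N w] almost surely having none. *)
pose F (p : E) := if p.2.2 == 0 then 0 else `|path i 0 p|.
have F0 p : 0 <= F p by rewrite /F; case: ifP.
have mF : measurable_fun [set: E] F.
  apply: measurable_fun_ifT => //; last exact: measurableT_comp.
  by apply: measurable_fun_eqr.
have main := @ae_noise_integral_lt_pinfty _ _ nu pi nu0 nu_sqr _ _ _ _ NP F
  (fun A => if A \in Mm then (\int[leb]_s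
     \int[nu]_x (Num.min 1 (enorm (f A s *m x)))%:E)%E else 0%E).
have {}main : {ae P, forall w, (\int[N w]_p (F p)%:E < +oo)%E}.
  apply: main => //.
  - move=> A; have [AM|AM] := boolP (A \in Mm); last first.
      have FA s x : F (x, (A, s)) = 0.
        rewrite /F /=; case: ifP => // _.
        rewrite /noise_path /kernel_path ifF ?mul0mx ?mxE ?normr0//.
        by apply/negbTE; apply: contra AM; rewrite !inE; exact: good_Mminus.
      under eq_integral do under eq_integral do rewrite FA min_r//.
      by under eq_integral do rewrite integral0; rewrite integral0.
    pose G (s : R) := (\int[nu]_x (Num.min 1 (F (x, (A, s))))%:E)%E.
    have G0 s : (0 <= G s)%E by apply: integral_ge0 => x _; rewrite lee_fin le_min ler01 F0.
    have mG : measurable_fun [set: R] G.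
      pose nu' : {sigma_finite_measure set 'cV[R]_d -> \bar R} :=
        with_sigma_finite (levy_measure_sigma_finite nu0 nu_sqr).
      apply: (@measurable_fun_fubini_tonelli_G _ _ _ _ _ nu'
        (fun q : 'cV[R]_d * R => (Num.min 1 (F (q.1, (A, q.2))))%:E)).
        apply/measurable_EFinP; apply: measurable_minr => //.
        apply: (measurableT_comp mF); apply: measurable_fun_pair => //.
        by apply: measurable_fun_pair.
      by move=> q; rewrite lee_fin le_min ler01 F0.
    apply: (@le_trans _ _ (\int[leb]_s G (- s)%R)%E); first by rewrite -(integral_opp mG G0).
    apply: le_lower_integral => s _ //; apply: le_lower_integral => x _.
      by rewrite lee_fin le_min ler01 F0.
    rewrite lee_fin le_min ge_min lexx/= ge_min; apply/orP; right.
    rewrite /F /= oppr_eq0; case: ifPn => [_|s0]; first exact: enorm_ge0.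
    rewrite /noise_path /kernel_path sub0r opprK (negbTE s0); case: ifP => _.
      exact: coord_le_enorm.
    by rewrite mul0mx mxE normr0 enorm_ge0.
  - have := int_jumps; rewrite integral_mkcond.
    by congr (_ < _)%E; apply: eq_integral => A _; rewrite patchE.
have := ae_noise_time_null nu0 nu_sqr NP 0; move: main.
apply: (@filterS2 _ _ (ae_filter_ringOfSetsType P)) => w Fw w0.
apply/integrableP; split; first exact/measurable_EFinP.
apply: le_lt_trans Fw; rewrite le_eqVlt; apply/orP; left; apply/eqP.
apply: ae_eq_integral => //.
- by apply/measurable_EFinP/measurableT_comp.
- exact/measurable_EFinP.
exists [set p | p.2.2 = 0]; split => //.
  rewrite (_ : mkset _ = s_ @^-1` [set 0])// -[X in measurable X]setTI; exact: ms.
move=> p /= Fp; apply: contrapT => p0; apply: Fp => _.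
by rewrite /F ifF//; apply/eqP.
Qed.

Lemma ae_regular_noise :
  {ae P, forall w, regular_noise f C2 delta x_ a_ s_ (N w)}.
Proof.
have sfin : {ae P, forall w (k : nat),
    (\int[N w]_p (if (`|p.2.2| <= k%:R)%R then (enorm p.1)%:E else 0) < +oo)%E}.
  by apply/ae_foralln => k; exact: (ae_noise_bounded_time nu0 nu_sqr nu_small NP).
have slopes : {ae P, forall w (k : nat) i,
    (\int[N w]_p \int[leb]_(u in `[(k%:R * Num.min delta 1)%R,
        (k%:R * Num.min delta 1 + Num.min delta 1)%R]) (`|slope i u p|%R)%:E < +oo)%E /\
    (\int[N w]_p \int[leb]_(u in `[(- (k%:R * Num.min delta 1 + Num.min delta 1))%R,
        (- (k%:R * Num.min delta 1))%R]) (`|slope i u p|%R)%:E < +oo)%E}.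
  apply/ae_foralln => k; apply: (@filter_forall _ _ _ _ (ae_filter_ringOfSetsType P)) => i.
  have eta0 : 0 <= Num.min delta 1 by rewrite le_min (ltW delta_gt0)/=.
  move: (Num.min delta 1) eta0 (@ae_noise_slope i) => eta eta0 H.
  have h1 : k%:R * eta <= k%:R * eta + eta by rewrite lerDl.
  apply: (@filterI _ _ (ae_filter_ringOfSetsType P)); apply: H.
  - by [].
  - by rewrite addrAC subrr add0r.
  - by rewrite lerN2.
  - by rewrite opprK addrC addrAC subrr add0r.
have paths : {ae P, forall w i, (N w).-integrable [set: E] (EFin \o path i 0)}.
  apply: (@filter_forall _ _ _ _ (ae_filter_ringOfSetsType P)) => i.
  exact: ae_noise_path_integrable.
have zero := ae_noise_zero_jump_null nu0 nu_sqr NP.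
have H12 := @filterI _ _ (ae_filter_ringOfSetsType P) _ _ sfin slopes.
have := @filterI _ _ (ae_filter_ringOfSetsType P) _ _ paths zero; move: H12.
apply: (@filterS2 _ _ (ae_filter_ringOfSetsType P)) => w [H1 H2] [H3 H4].
split => //.
- apply: (@sigma_finite_weight _ _ _ _ (fun p => enorm p.1) s_) => //.
  + exact: measurable_enorm_noise.
  + by move=> p; exact: enorm_ge0.
  + rewrite -H4; congr (N w _); apply/seteqP; split => p /=; first exact: enorm_eq0.
    by move=> ->; rewrite enorm0.
  + move=> k; apply: le_lt_trans (H1 k); rewrite le_eqVlt; apply/orP; left; apply/eqP.
    by apply: eq_integral => p _; case: ifP.
- move=> M; have [k Mk] : exists k : nat, M <= k%:R.
    exists (Num.bound `|M|); apply: le_trans (ler_norm M) _.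
  by apply/ltW/archi_boundP; exact: normr_ge0.
  apply: le_lt_trans (H1 k); apply: le_lower_integral => p _.
    by case: ifP => // _; rewrite lee_fin enorm_ge0.
  case: ifP => [pM|_]; first by rewrite ifT// (le_trans pM).
  by case: ifP => // _; rewrite lee_fin enorm_ge0.
Qed.

End regular_poisson_noise.

(** * The drift as a superposition *)

Section regular_drift.
Context (R : realType) (n d : nat) (f : 'M[R]_d -> R -> 'M[R]_(n, d)) (C1 C2 : 'M[R]_(n, d)).
Notation Mm := (@Mminus R d).
Notation leb := (@lebesgue_measure R).
Notation g := (kernel_derivative f).
Hypothesis mf : measurable_fun (Mm `*` [set: R]) (fun p => f p.1 p.2).
Hypothesis df : forall A s, Mm A -> s != 0 -> derivable (f A) s 1.
Hypothesis f_left : forall A, Mm A -> f A s @[s --> 0^'-] --> C1.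
Hypothesis f_right : forall A, Mm A -> f A s @[s --> 0^'+] --> C2.
Hypothesis cvg_g : forall A, Mm A -> cvg (derive1 (f A) s @[s --> 0^'+]).
Variable delta : R.
Hypothesis delta_gt0 : 0 < delta.
Variable pi : probability 'M[R]_d R.
Hypothesis int_sup : forall t1 t2 : R, t1 <= t2 -> t2 - t1 <= delta ->
  (\int[pi]_(A in Mm) \int[leb]_s kernel_sup g t1 t2 A s < +oo)%E.
Hypothesis int_opnorm : (\int[pi]_(A in Mm) \int[leb]_s (opnorm (f A s))%:E < +oo)%E.
Variable c : 'cV[R]_d.

Notation T := ('M[R]_d * measurableTypeR R)%type.
Notation path := (noise_path f C2 delta (fun _ : T => c) fst snd).
Notation slope := (noise_slope f delta (fun _ : T => c) fst snd).

Let mc j : measurable_fun [set: T] (fun=> c j 0). Proof. exact: measurable_cst. Qed.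
Let m1 : measurable_fun [set: T] (fst : T -> 'M[R]_d). Proof. exact: measurable_fst. Qed.
Let m2 : measurable_fun [set: T] (snd : T -> R). Proof. exact: measurable_snd. Qed.

(** The added 1 keeps the constant positive when [c = 0], as [le_lower_integral_scale] requires. *)
Let K := enorm c + 1.
Let K_gt0 : 0 < K. Proof. by rewrite ltr_wpDl ?enorm_ge0. Qed.

Let drift_integrable (i : 'I_n) : (pi \x leb)%E.-integrable [set: T] (EFin \o path i 0).
Proof.
have mpath : measurable_fun [set: T] (path i 0) by exact: measurable_noise_path.
pose w (p : T) := (`|path i 0 p|%R)%:E.
have mw : measurable_fun [set: T] w by apply/measurable_EFinP/measurableT_comp.
have w0 p : (0 <= w p)%E by rewrite lee_fin.
apply/integrableP; split; first exact/measurable_EFinP.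
rewrite (fubini_tonelli1 (m1 := pi) (m2 := leb) _ mw w0).
have mF : measurable_fun [set: 'M[R]_d] (fubini_F leb w).
  exact: measurable_fun_fubini_tonelli_F.
pose h A := (if A \in Mm then \int[leb]_s (opnorm (f A s))%:E else 0)%E.
have hfin : (\int[pi]_A h A < +oo)%E.
  rewrite (_ : (\int[pi]_A h A = \int[pi]_(A in Mm) \int[leb]_s (opnorm (f A s))%:E)%E)//.
  by rewrite [RHS]integral_mkcond; apply: eq_integral => A _; rewrite patchE.
apply: (@le_lt_trans _ _ (K%:E * \int[pi]_A h A)%E); last first.
  by rewrite lte_mul_pinfty// ?lee_fin ?ltW//.
apply: le_lower_integral_scale => // [A|A]; first exact: integral_ge0.
rewrite /fubini_F /h; have [AM|AM] := boolP (A \in Mm); last first.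
  rewrite mule0 (eq_integral (cst 0%E)) ?integral0// => s _.
  rewrite /w /noise_path /kernel_path ifF ?mul0mx ?mxE ?normr0//.
  by apply/negbTE; apply: contra AM; rewrite !inE; exact: good_Mminus.
have mwA : measurable_fun [set: R] (fun s : R => w (A, s)).
  exact: (measurableT_comp mw (measurable_pair1 A)).
have mneg : measurable_fun [set: R] (fun s : R => w (A, - s)).
  by apply: (measurableT_comp mwA); exact: oppr_measurable.
rewrite (integral_opp mwA)//.
(* [C2] and [f A 0] may disagree at time 0, which is Lebesgue-null. *)
pose G (s : R) := if s == 0 then 0%E else w (A, (- s)%R).
have mG : measurable_fun [set: R] G.
  by apply: measurable_fun_ifT => //; exact: measurable_fun_eqr.
have -> : (\int[leb]_s w (A, (- s)%R) = \int[leb]_s G s)%E.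
  apply: ae_eq_integral => //.
  exists [set 0]; split => //; first exact: lebesgue_measure_set1.
  move=> s /= sG; apply: contrapT => s0; apply: sG => _.
  by rewrite /G ifF//; apply/eqP.
apply: le_lower_integral_scale => // s; rewrite /G; case: ifPn => [_|s0] //.
  by rewrite mule_ge0// lee_fin ?opnorm_ge0// ltW.
rewrite /w -EFinM lee_fin /noise_path /kernel_path /= sub0r opprK (negbTE s0).
case: ifP => _; last by rewrite mul0mx mxE normr0 mulr_ge0// ?opnorm_ge0// ltW.
apply: le_trans (coord_mulmx_le _ _ _) _; rewrite mulrC ler_wpM2r ?opnorm_ge0//.
by rewrite /K lerDl.
Qed.

Let slope_out i u (p : T) : p.1 \notin Mm -> slope i u p = 0.
Proof.
move=> AM; rewrite /noise_slope /kernel_slope ifF ?mul0mx ?mxE//.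
by apply/negbTE; apply: contra AM; rewrite !inE; exact: good_Mminus.
Qed.

Let dominated (I : T -> \bar R) (t1 t2 : R) : t1 <= t2 -> t2 - t1 <= delta ->
  measurable_fun [set: T] I -> (forall p, 0 <= I p)%E ->
  (forall p, p.1 \notin Mm -> I p = 0%E) ->
  (forall p, I p <= kernel_sup g t1 t2 p.1 p.2 * (enorm c)%:E)%E ->
  (\int[(pi \x leb)%E]_p I p < +oo)%E.
Proof.
move=> t12 tdelta mI I0 Iout Ih.
rewrite (fubini_tonelli1 (m1 := pi) (m2 := leb) _ mI I0).
have mF : measurable_fun [set: 'M[R]_d] (fubini_F leb I).
  exact: measurable_fun_fubini_tonelli_F.
pose h A := (if A \in Mm then \int[leb]_s kernel_sup g t1 t2 A s else 0)%E.
have hfin : (\int[pi]_A h A < +oo)%E.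
  rewrite (_ : (\int[pi]_A h A = \int[pi]_(A in Mm) \int[leb]_s kernel_sup g t1 t2 A s)%E).
    exact: int_sup.
  by rewrite [RHS]integral_mkcond; apply: eq_integral => A _; rewrite patchE.
apply: (@le_lt_trans _ _ (K%:E * \int[pi]_A h A)%E); last first.
  by rewrite lte_mul_pinfty// ?lee_fin ?ltW//.
apply: le_lower_integral_scale => // [A|A]; first exact: integral_ge0.
rewrite /fubini_F /h; have [AM|AM] := boolP (A \in Mm); last first.
  by rewrite mule0 (eq_integral (cst 0%E)) ?integral0// => s _; rewrite Iout.
apply: (@le_lower_integral_scale _ _ _ leb (fun s => I (A, s)) (kernel_sup g t1 t2 A) K K_gt0).
- exact: (measurableT_comp mI (measurable_pair1 A)).
- by move=> s; exact: I0.
move=> s; apply: (le_trans (Ih (A, s))).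
by rewrite muleC lee_wpmul2r ?kernel_sup_ge0// lee_fin /K lerDl.
Qed.

Let drift_slope (i : 'I_n) (t1 t2 : R) : t1 <= t2 -> t2 - t1 <= Num.min delta 1 ->
  (\int[(pi \x leb)%E]_p \int[leb]_(u in `[t1, t2]) (`|slope i u p|%R)%:E < +oo)%E.
Proof.
move=> t12; rewrite le_min => /andP[tdelta t1_].
apply: (dominated t12 tdelta).
- by apply: integral_itv_window; exact: measurable_noise_slope_joint.
- by move=> p; apply: integral_ge0.
- move=> p pM; rewrite (eq_integral (cst 0%E)) ?integral0// => u _.
  by rewrite slope_out// normr0.
- by move=> p; exact: integral_noise_slope_le_kernel_sup.
Qed.

(** The degenerate window [[u, u]] is allowed in the hypotheses, so the drift part of [Z] is
    integrable at every time and not just at almost every one. *)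
Lemma integrable_drift_slope (i : 'I_n) (u : R) :
  (pi \x leb)%E.-integrable [set: T] (EFin \o slope i u).
Proof.
have ms : measurable_fun [set: T] (slope i u) by exact: measurable_noise_slope.
apply/integrableP; split; first exact/measurable_EFinP.
apply: (@dominated (fun p => (`|slope i u p|%R)%:E) u u) => //.
- by rewrite subrr ltW.
- exact/measurable_EFinP/measurableT_comp.
- by move=> p pM; rewrite slope_out// normr0.
- by move=> p; apply: noise_slope_le_kernel_sup; rewrite in_itv/= lexx.
Qed.

Lemma regular_drift :
  regular_noise f C2 delta (fun _ : T => c) fst snd (pi \x leb)%E.
Proof.
have eta0 : 0 <= Num.min delta 1 by rewrite le_min (ltW delta_gt0)/=.
split => //.
- exact: sigma_finite_product_lebesgue.
- move=> i k; move: (Num.min delta 1) eta0 (@drift_slope i) => eta eta0 H.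
  have h1 : k%:R * eta <= k%:R * eta + eta by rewrite lerDl.
  split; apply: H.
  + by [].
  + by rewrite addrAC subrr add0r.
  + by rewrite lerN2.
  + by rewrite opprK addrC addrAC subrr add0r.
move=> M; pose h (p : T) := (if (`|(p.2 : R)| <= M)%R then (enorm c)%:E else 0)%E.
have h0 p : (0 <= h p)%E by rewrite /h; case: ifP => // _; rewrite lee_fin enorm_ge0.
have mh : measurable_fun [set: T] h.
  apply: measurable_fun_ifT => //; apply: measurable_fun_ler => //.
  exact: (measurableT_comp (@normr_measurable R setT)).
rewrite (fubini_tonelli1 (m1 := pi) (m2 := leb) _ mh h0) /fubini_F.
have -> : (fun A : 'M[R]_d => \int[leb]_s h (A, s))%E = cst ((enorm c)%:E * leb `[(- M)%R, M])%E.
  apply/funext => A; rewrite -integral_cst// [RHS]integral_mkcond.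
  by apply: eq_integral => s _; rewrite patchE /h /= mem_setE in_itv/= -ler_norml.
rewrite integral_cst// [X in (_ * X < _)%E]probability_setT mule1 lebesgue_measure_itv/=.
by case: ifP => _; rewrite ?mule0// -EFinD -EFinM ltry.
Qed.

End regular_drift.

(** * The process and its modification *)

(** A kernel [G] controlled on [Mminus] only is compared with a version [K] measurable everywhere.
    They agree off the matrices in [B] and the times in [S], which are null both for the drift and
    for [N w]. *)
Lemma stoch_integral_modification (R : realType) (n d : nat) (gamma : 'cV[R]_d)
    (nu : {measure set 'cV[R]_d -> \bar R}) (pi : probability 'M[R]_d R)
    dO (Omega : measurableType dO)
    (N : Omega -> {measure set ('cV[R]_d * ('M[R]_d * R)) -> \bar R}) (w : Omega)
    (G K : 'M[R]_d -> R -> 'M[R]_(n, d)) (B : set 'M[R]_d) (S : set R) (i : 'I_n) :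
  (forall i j, measurable_fun (@Mminus R d `*` [set: R]) (fun p => G p.1 p.2 i j)) ->
  (forall i j, measurable_fun [set: 'M[R]_d * R] (fun p => K p.1 p.2 i j)) ->
  measurable B -> pi B = 0%E -> N w ([set: 'cV[R]_d] `*` (B `*` [set: R])) = 0%E ->
  measurable S -> @lebesgue_measure R S = 0%E ->
  N w [set p | S p.2.2] = 0%E ->
  (forall A, ~ B A -> @Mminus R d A) ->
  (forall A s, ~ B A -> ~ S s -> G A s = K A s) ->
  (pi \x @lebesgue_measure R)%E.-integrable [set: 'M[R]_d * measurableTypeR R]
    (fun p => ((K p.1 p.2 *m drift gamma nu) i 0)%:E) ->
  stoch_integral gamma nu pi N G w i 0 =
    (\int[(pi \x @lebesgue_measure R)%E]_p (K p.1 p.2 *m drift gamma nu) i 0)%R +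
    (\int[N w]_p (K p.2.1 p.2.2 *m p.1) i 0)%R.
Proof.
move=> mG mK mB B0 NB mS S0 NS BM GK iK.
have mM := @measurable_Mminus R d.
rewrite /stoch_integral !mxE; congr (_ + _).
  apply: (@iterated_Rintegral _ _ _ _ _ pi (@lebesgue_measure R) (@Mminus R d) B
    (fun p => (G p.1 p.2 *m drift gamma nu) i 0)
    (fun p => (K p.1 p.2 *m drift gamma nu) i 0)) => //.
    under eq_fun do rewrite mxE; apply: measurable_sum => j.
    by apply: measurable_funM => //; exact: mG.
  move=> A nB; split; first exact: BM.
  by exists S; split => // s nS; rewrite /= GK.
pose D : set ('cV[R]_d * ('M[R]_d * R)) := [set: 'cV[R]_d] `*` (@Mminus R d `*` [set: R]).
have mD : measurable D by apply: measurableX => //; exact: measurableX.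
have mSt : measurable [set p : 'cV[R]_d * ('M[R]_d * R) | S p.2.2].
  rewrite (_ : mkset _ = (fun p : 'cV[R]_d * ('M[R]_d * R) => p.2.2) @^-1` S)//.
  by rewrite -[X in measurable X]setTI; exact: measurable_jump_time.
have mBt : measurable ([set: 'cV[R]_d] `*` (B `*` [set: R])).
  by apply: measurableX => //; exact: measurableX.
apply: (@Rintegral_eq_off_null _ _ _ (N w) D
  ([set: 'cV[R]_d] `*` (B `*` [set: R]) `|` [set p | S p.2.2])
  (fun p => (G p.2.1 p.2.2 *m p.1) i 0) (fun p => (K p.2.1 p.2.2 *m p.1) i 0)) => //.
- exact: measurableU.
- exact: null_set_setU.
- under eq_fun do rewrite mxE; apply: measurable_sum => j; apply: measurable_funM.
    apply: (@measurable_comp _ _ _ _ _ _ (@Mminus R d `*` [set: R])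
      (fun q : 'M[R]_d * R => G q.1 q.2 i j) D (fun p => p.2)) => //.
    + exact: measurableX.
    + by move=> _ [p [_ [pM _]] <-]; split.
    + by apply: measurable_funTS; exact: measurable_snd.
  by apply: measurable_funTS; exact: measurable_jump_coord.
- under eq_fun do rewrite mxE; apply: measurable_sum => j; apply: measurable_funM.
    exact: (measurableT_comp (mK i j) measurable_snd).
  exact: measurable_jump_coord.
move=> p /not_orP[nB nS]; have nBA : ~ B p.2.1 by move=> h; apply: nB; split.
by split; [split => //; split => //; exact: BM|rewrite GK].
Qed.

Section pathwise.
Context (R : realType) (n d : nat) (f : 'M[R]_d -> R -> 'M[R]_(n, d)) (C1 C2 : 'M[R]_(n, d)).
Notation Mm := (@Mminus R d).
Notation leb := (@lebesgue_measure R).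
Notation g := (kernel_derivative f).
Notation E := ('cV[R]_d * ('M[R]_d * R))%type.
Notation T := ('M[R]_d * measurableTypeR R)%type.
Hypothesis mf : measurable_fun (Mm `*` [set: R]) (fun p => f p.1 p.2).
Hypothesis df : forall A s, Mm A -> s != 0 -> derivable (f A) s 1.
Hypothesis f_left : forall A, Mm A -> f A s @[s --> 0^'-] --> C1.
Hypothesis f_right : forall A, Mm A -> f A s @[s --> 0^'+] --> C2.
Hypothesis cvg_g : forall A, Mm A -> cvg (derive1 (f A) s @[s --> 0^'+]).
Variable delta : R.
Hypothesis delta_gt0 : 0 < delta.
Variables (gamma : 'cV[R]_d) (nu : {measure set 'cV[R]_d -> \bar R}).
Variable pi : probability 'M[R]_d R.
Hypothesis piM : pi Mm = 1%E.
Hypothesis int_sup : forall t1 t2 : R, t1 <= t2 -> t2 - t1 <= delta ->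
  (\int[pi]_(A in Mm) \int[leb]_s kernel_sup g t1 t2 A s < +oo)%E.
Hypothesis int_opnorm : (\int[pi]_(A in Mm) \int[leb]_s (opnorm (f A s))%:E < +oo)%E.
Context dO (Omega : measurableType dO).
Variable N : Omega -> {measure set E -> \bar R}.
Variable w : Omega.

Notation c := (drift gamma nu).
Notation x_ := (fun p : E => p.1).
Notation a_ := (fun p : E => p.2.1).
Notation s_ := (fun p : E => p.2.2).
Notation bad := (~` good f delta).
Hypothesis regular_N : regular_noise f C2 delta x_ a_ s_ (N w).
Hypothesis N_bad : N w ([set: 'cV[R]_d] `*` (bad `*` [set: R])) = 0%E.

Let mx := @measurable_jump_coord R d.
Let ma := @measurable_jump_matrix R d.
Let ms := @measurable_jump_time R d.
Let mc j : measurable_fun [set: T] (fun=> c j 0). Proof. exact: measurable_cst. Qed.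
Let m1 : measurable_fun [set: T] (fst : T -> 'M[R]_d). Proof. exact: measurable_fst. Qed.
Let m2 : measurable_fun [set: T] (snd : T -> R). Proof. exact: measurable_snd. Qed.
Let regular_d := regular_drift C2 mf df cvg_g delta_gt0 int_sup int_opnorm c.

Let mbad : measurable bad. Proof. by apply: measurableC; exact: measurable_good. Qed.
Let pi_bad : pi bad = 0%E.
Proof.
apply: (null_not_good mf df delta_gt0 _ piM).
by apply: int_sup; rewrite ?subr0// ltW.
Qed.
Let bad_Mm A : ~ bad A -> Mm A.
Proof. by move=> /contrapT; exact: good_Mminus. Qed.

Notation dpath := (noise_path f C2 delta (fun _ : T => c) fst snd).
Notation dslope := (noise_slope f delta (fun _ : T => c) fst snd).
Notation djump := (noise_jump f C1 C2 delta (fun _ : T => c) fst).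
Notation npath := (noise_path f C2 delta x_ a_ s_).
Notation nslope := (noise_slope f delta x_ a_ s_).
Notation njump := (noise_jump f C1 C2 delta x_ a_).

Definition modified_path (t : R) : 'cV[R]_n :=
  \col_i ((\int[(pi \x leb)%E]_p dpath i t p)%R + (\int[N w]_p npath i t p)%R).

(** [S] holds the jump time at which the value of the kernel at 0 gets changed: [[set t]] in
    general, and the empty set when [f A 0 = C2]. *)
Lemma stoch_integral_path (t : R) (S : set R) : measurable S -> leb S = 0%E ->
  N w [set p | S p.2.2] = 0%E ->
  (forall A s, Mm A -> ~ S s -> t - s = 0 -> f A 0 = C2) ->
  stoch_integral gamma nu pi N (fun A s => f A (t - s)) w = modified_path t.
Proof.
move=> mS S0 NS fS; apply/colP => i; rewrite [RHS]mxE.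
apply: (@stoch_integral_modification _ _ _ gamma nu pi _ _ N w (fun A s => f A (t - s))
  (fun A s => kernel_path f C2 delta A (t - s)) bad S i) => //.
- move=> i' j; apply: (measurable_comp (F := Mm `*` [set: R]) (f := fun p => f p.1 p.2 i' j)
    (g := fun p : 'M[R]_d * R => (p.1, t - p.2))).
  + by apply: measurableX => //; exact: measurable_Mminus.
  + by move=> _ [p [pM _] <-]; split.
  + exact: (measurableT_comp (measurable_coord i' j) mf).
  + apply: measurable_funTS; apply: measurable_fun_pair => //.
    by apply: measurable_funB => //; exact: measurable_snd.
- move=> i' j; have mp : measurable_fun [set: 'M[R]_d * R] (fun p : 'M[R]_d * R => (p.1, t - p.2)).
    by apply: measurable_fun_pair => //; apply: measurable_funB => //; exact: measurable_snd.
  exact: (measurableT_comp (measurable_kernel_path_coord C2 mf delta i' j) mp).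
- move=> A s /contrapT gA nS; rewrite /kernel_path mem_set//.
  have [ts|//] := eqVneq (t - s) 0; rewrite ts.
  exact: fS (good_Mminus gA) nS ts.
- exact: (noise_integrable mf df f_left f_right cvg_g delta_gt0 mc m1 m2 regular_d i t).
Qed.

Lemma stoch_integral_slope (u : R) i :
  stoch_integral gamma nu pi N (fun A s => g A (u - s)) w i 0 =
    (\int[(pi \x leb)%E]_p dslope i u p)%R + (\int[N w]_p nslope i u p)%R.
Proof.
apply: (@stoch_integral_modification _ _ _ gamma nu pi _ _ N w (fun A s => g A (u - s))
  (fun A s => kernel_slope f delta A (u - s)) bad set0 i) => //.
- move=> i' j; apply: (measurable_comp (F := Mm `*` [set: R]) (f := fun p => g p.1 p.2 i' j)
    (g := fun p : 'M[R]_d * R => (p.1, u - p.2))).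
  + by apply: measurableX => //; exact: measurable_Mminus.
  + by move=> _ [p [pM _] <-]; split.
  + have := measurable_funTS (D := Mm `*` [set: R])
      (measurable_kernel_derivative_coord mf df cvg_g i' j).
    by apply: eq_measurable_fun => p pM; rewrite pM.
  + apply: measurable_funTS; apply: measurable_fun_pair => //.
    by apply: measurable_funB => //; exact: measurable_snd.
- move=> i' j; have mp : measurable_fun [set: 'M[R]_d * R] (fun p : 'M[R]_d * R => (p.1, u - p.2)).
    by apply: measurable_fun_pair => //; apply: measurable_funB => //; exact: measurable_snd.
  exact: (measurableT_comp (measurable_kernel_slope_coord mf df cvg_g delta i' j) mp).
- by rewrite (_ : [set p | _] = set0)//; apply/seteqP; split.
- by move=> A s /contrapT gA _; rewrite /kernel_slope mem_set.
- exact: (integrable_drift_slope mf df cvg_g delta_gt0 int_sup c i u).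
Qed.

Lemma stoch_integral_indicator (I : set R) (M : R) : measurable I -> I `<=` `[- M, M] ->
  stoch_integral gamma nu pi N (fun _ s => (\1_I s)%:M) w =
    \col_j (\int[(pi \x leb)%E]_p (\1_I p.2 * c j 0))%R +
    \col_j (\int[N w]_p (\1_I p.2.2 * p.1 j 0))%R.
Proof.
move=> mI IM; apply/colP => j; rewrite [RHS]mxE [X in _ = X + _]mxE [X in _ = _ + X]mxE.
have mind : measurable_fun [set: R] (\1_I : R -> R) by exact: measurable_indic.
have mK i' j' : measurable_fun [set: 'M[R]_d * R]
    (fun p : 'M[R]_d * R => ((\1_I p.2)%:M : 'M[R]_d) i' j').
  under eq_fun do rewrite mxE; case: (i' == j').
    by under eq_fun do rewrite mulr1n; exact: (measurableT_comp mind measurable_snd).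
  by under eq_fun do rewrite mulr0n; exact: measurable_cst.
have e (v : 'cV[R]_d) (s : R) : ((\1_I s)%:M *m v) j 0 = \1_I s * v j 0.
  by rewrite mul_scalar_mx mxE.
rewrite (@stoch_integral_modification _ _ _ gamma nu pi _ _ N w (fun _ s => (\1_I s)%:M)
  (fun _ s => (\1_I s)%:M) bad set0 j) => //.
- by congr (_ + _); apply: eq_Rintegral => p _; rewrite e.
- by move=> i' j'; apply: measurable_funTS; exact: mK.
- by rewrite (_ : [set p | _] = set0)//; apply/seteqP; split.
- have := noise_bounded_time_integrable mc m2 regular_d j mI IM.
  by apply: eq_integrable => // p _; rewrite e.
Qed.

Lemma integrable_slope i b e : b <= e -> leb.-integrable `[b, e]
  (fun u => (stoch_integral gamma nu pi N (fun A s => g A (u - s)) w i 0)%:E).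
Proof.
move=> be.
have sd := noise_slope_integrable mf df cvg_g delta_gt0 mc m1 m2 regular_d i be.
have sn := noise_slope_integrable mf df cvg_g delta_gt0 mx ma ms regular_N i be.
have mbe : measurable (`[b, e] : set (measurableTypeR R)) by [].
have := integrableD mbe sd sn.
by apply: eq_integrable => // u _; rewrite /= stoch_integral_slope.
Qed.

(** The increments of the drift and of the jumps are added. [S] absorbs the endpoints of [I]: it
    will be empty for nonnegative times, and consist of [t] and 0 for a negative time [t]. *)
Lemma modified_path_increment (b e M : R) (I S : set R) : b <= e ->
  measurable I -> I `<=` `[- M, M] -> measurable S -> leb S = 0%E ->
  N w [set p | S p.2.2] = 0%E -> (forall s, ~ S s -> (s \in I) = (b < s <= e)) ->
  modified_path e = modified_path b +
    vintegral leb `[b, e] (fun u => stoch_integral gamma nu pi N (fun A s => g A (u - s)) w) +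
    (C2 - C1) *m stoch_integral gamma nu pi N (fun _ s => (\1_I s)%:M) w.
Proof.
move=> be mI IM mS S0 NS SI; apply/colP => i.
rewrite (stoch_integral_indicator mI IM) mulmxDr.
have addE (u v : 'cV[R]_n) : (u + v) i 0 = u i 0 + v i 0 by rewrite mxE.
have pathE t : modified_path t i 0 =
  (\int[(pi \x leb)%E]_p dpath i t p)%R + (\int[N w]_p npath i t p)%R by rewrite mxE.
have mSt : measurable [set p : E | S p.2.2].
  by rewrite (_ : mkset _ = s_ @^-1` S)// -[X in measurable X]setTI; exact: ms.
have mBt : measurable ([set: 'cV[R]_d] `*` (bad `*` [set: R])).
  by apply: measurableX => //; exact: measurableX.
have offn (p : E) : ~ ([set: 'cV[R]_d] `*` (bad `*` [set: R]) `|` [set p | S p.2.2]) p ->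
    good f delta p.2.1 /\ (p.2.2 \in I) = (b < p.2.2 <= e).
  move=> /not_orP[nB nS]; split; last exact: SI.
  by apply: contrapT => h; apply: nB; split.
have offd (p : T) : ~ (bad `*` [set: measurableTypeR R] `|` [set: 'M[R]_d] `*` S) p ->
    good f delta p.1 /\ ((p.2 : R) \in I) = (b < (p.2 : R) <= e).
  move=> /not_orP[nB nS]; split; first by apply: contrapT => h; apply: nB; split.
  by apply: SI => h; apply: nS; split.
have Jn := @integral_noise_jump _ _ _ f C1 C2 mf delta _ _ x_ a_ s_ mx ma ms (N w) regular_N
  ([set: 'cV[R]_d] `*` (bad `*` [set: R]) `|` [set p | S p.2.2]) I M b e i mI IM
  (measurableU _ _ mBt mSt) (null_set_setU mBt mSt N_bad NS) offn.
have mSd : measurable ([set: 'M[R]_d] `*` S : set T) by exact: measurableX.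
have mBd : measurable (bad `*` [set: measurableTypeR R] : set T) by exact: measurableX.
have B0 : (pi \x leb)%E (bad `*` [set: measurableTypeR R]) = 0%E.
  have -> : ((pi \x leb) (bad `*` [set: measurableTypeR R]) = pi bad * leb setT)%E.
    exact: product_measure1E.
  by rewrite pi_bad mul0e.
have S0' : (pi \x leb)%E ([set: 'M[R]_d] `*` S) = 0%E.
  have -> : ((pi \x leb) ([set: 'M[R]_d] `*` S) = pi setT * leb S)%E.
    exact: product_measure1E.
  by rewrite S0 mule0.
have Jd := @integral_noise_jump _ _ _ f C1 C2 mf delta _ _ (fun _ : T => c) fst snd mc m1 m2
  (pi \x leb)%E regular_d (bad `*` [set: measurableTypeR R] `|` [set: 'M[R]_d] `*` S) I M b e i mI IM
  (measurableU _ _ mBd mSd) (null_set_setU mBd mSd B0 S0') offd.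
have Id := noise_increment mf df f_left f_right cvg_g delta_gt0 mc m1 m2 regular_d i be.
have In := noise_increment mf df f_left f_right cvg_g delta_gt0 mx ma ms regular_N i be.
have sd := noise_slope_integrable mf df cvg_g delta_gt0 mc m1 m2 regular_d i be.
have sn := noise_slope_integrable mf df cvg_g delta_gt0 mx ma ms regular_N i be.
have ZE : vintegral leb `[b, e]
      (fun u => stoch_integral gamma nu pi N (fun A s => g A (u - s)) w) i 0 =
    (\int[leb]_(u in `[b, e]) (\int[(pi \x leb)%E]_p dslope i u p))%R +
    (\int[leb]_(u in `[b, e]) (\int[N w]_p nslope i u p))%R.
  rewrite mxE -RintegralD//; apply: eq_Rintegral => u _; exact: stoch_integral_slope.
rewrite !addE !pathE ZE -Jn -Jd.
by move: Id In => /eqP + /eqP; rewrite !subr_eq => /eqP-> /eqP->; ring.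
Qed.

Lemma modified_path_cadlag : cadlag modified_path.
Proof.
move=> t; have cd i := noise_cadlag mf df f_left f_right cvg_g delta_gt0 mc m1 m2 regular_d i t.
have cn i := noise_cadlag mf df f_left f_right cvg_g delta_gt0 mx ma ms regular_N i t.
split.
  apply: cvg_cV => i; rewrite mxE; under eq_fun do rewrite mxE.
  by apply: cvgD; [have [] := cd i|have [] := cn i].
apply/cvg_ex; exists (\col_i (lim ((\int[(pi \x leb)%E]_p dpath i u p)%R @[u --> t^'-]) +
  lim ((\int[N w]_p npath i u p)%R @[u --> t^'-]))).
apply: cvg_cV => i; rewrite mxE; under eq_fun do rewrite mxE.
by apply: cvgD; [have [] := cd i|have [] := cn i].
Qed.

Lemma modified_path_finite_variation : finite_variation_on_compacts modified_path.
Proof.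
move=> b e i be.
rewrite (_ : (fun t => modified_path t i 0) =
  (fun t => \int[(pi \x leb)%E]_p dpath i t p)%R \+ (fun t => \int[N w]_p npath i t p)%R).
  have [->|ltbe] := eqVneq b e; first exact: bounded_variationxx.
  apply: bounded_variationD; first by rewrite lt_neqAle ltbe.
    exact: (noise_bounded_variation mf df f_left f_right cvg_g delta_gt0 mc m1 m2 regular_d i be).
  exact: (noise_bounded_variation mf df f_left f_right cvg_g delta_gt0 mx ma ms regular_N i be).
by apply/funext => t; rewrite mxE.
Qed.

End pathwise.

Theorem theorem3p1 (R : realType) (n d : nat)
    (dO : measure_display) (Omega : measurableType dO) (P : probability Omega R)
    (gamma : 'cV[R]_d) (nu : {measure set 'cV[R]_d -> \bar R})
    (pi : probability 'M[R]_d R)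
    (Lambda : set ('M[R]_d * R) -> Omega -> 'cV[R]_d)
    (N : Omega -> {measure set ('cV[R]_d * ('M[R]_d * R)) -> \bar R})
    (f : 'M[R]_d -> R -> 'M[R]_(n, d)) (C1 C2 : 'M[R]_(n, d)) (delta : R) :
  levy_basis gamma 0 nu pi P Lambda ->
  (\int[nu]_(x in [set x : 'cV[R]_d | (enorm x <= 1)%R]) (enorm x)%:E < +oo)%E ->
  levy_ito gamma nu pi P Lambda N ->
  measurable_fun (@Mminus R d `*` [set: R]) (fun p => f p.1 p.2) ->
  (forall A s, Mminus A -> s != 0 ->
     {for s, continuous (f A)} /\ derivable (f A) s 1) ->
  (forall A, Mminus A -> f A s @[s --> 0^'-] --> C1) ->
  (forall A, Mminus A -> f A s @[s --> 0^'+] --> C2) ->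
  (forall A, Mminus A -> cvg (derive1 (f A) s @[s --> 0^'+])) ->
  0 < delta ->
  (forall t1 t2 : R, t1 <= t2 -> t2 - t1 <= delta ->
     let h := kernel_sup (kernel_derivative f) t1 t2 in
     (\int[pi]_(A in @Mminus R d) \int[@lebesgue_measure R]_s h A s < +oo)%E /\
     (\int[pi]_(A in @Mminus R d) \int[@lebesgue_measure R]_s
        \int[pushforward nu (@enorm R d)]_y mine 1 `|h A s * y%:E| < +oo)%E) ->
  (\int[pi]_(A in @Mminus R d) \int[@lebesgue_measure R]_s
     (opnorm (f A s))%:E < +oo)%E ->
  (\int[pi]_(A in @Mminus R d) \int[@lebesgue_measure R]_s
     \int[nu]_x (Num.min 1 (enorm (f A s *m x)))%:E < +oo)%E ->
  let X t := stoch_integral gamma nu pi N (fun A s => f A (t - s)) in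
  let Z t := stoch_integral gamma nu pi N
               (fun A s => kernel_derivative f A (t - s)) in
  let L := levy_process gamma nu pi N in
  [/\ forall t : R, {ae P, forall w,
        (forall i, (@lebesgue_measure R).-integrable
                     `[Num.min 0 t, Num.max 0 t]
                     (fun u => (Z u w i 0)%:E)) /\
        X t w = X 0 w + time_integral (Z ^~ w) t
                + (if 0 <= t then C2 - C1 else C1 - C2) *m L t w},
      exists Y : R -> Omega -> 'cV[R]_n,
        [/\ forall t, measurable_fun [set: Omega] (Y t),
            forall t, {ae P, forall w, Y t w = X t w} &
            forall w, cadlag (Y ^~ w) /\ finite_variation_on_compacts (Y ^~ w)] &
      (forall A, Mminus A -> f A 0 = C2) ->
        {ae P, forall w,
          (forall t : R, 0 <= t ->
             X t w = X 0 w + time_integral (Z ^~ w) t + (C2 - C1) *m L t w) /\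
          cadlag (X ^~ w) /\ finite_variation_on_compacts (X ^~ w)}].
Proof.
move=> [[[_ _ nu0 nu_sqr] piM] _ _ _ _] nu_small [NP _] mf hdf f_left f_right cvg_g
  delta_gt0 int_h int_opnorm int_jumps X Z L.
have df A s : Mminus A -> s != 0 -> derivable (f A) s 1 by move=> MA /(hdf A s MA)[].
have int_sup t1 t2 h1 h2 := (int_h t1 t2 h1 h2).1.
have int_sup_jumps t1 t2 h1 h2 := (int_h t1 t2 h1 h2).2.
pose bad := ~` good f delta.
have mbad : measurable bad by apply: measurableC; exact: measurable_good.
have pi_bad : pi bad = 0%E.
  apply: (null_not_good mf df delta_gt0 _ piM).
  by apply: int_sup; rewrite ?subr0// ltW.
(* A single condition, free of [t], under which all the pathwise lemmas apply. *)
pose W w := regular_noise f C2 delta (fun p => p.1) (fun p => p.2.1) (fun p => p.2.2) (N w) /\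
  N w ([set: 'cV[R]_d] `*` (bad `*` [set: R])) = 0%E.
have aeW : {ae P, forall w, W w}.
  apply: (@filterI _ _ (ae_filter_ringOfSetsType P)).
    exact: (ae_regular_noise mf df f_left f_right cvg_g delta_gt0 nu0 nu_sqr nu_small NP
      int_sup_jumps int_jumps).
  apply: (ae_noise_null nu0 nu_sqr NP); first exact: measurableX.
  have -> : ((pi \x @lebesgue_measure R) (bad `*` setT) = pi bad * @lebesgue_measure R setT)%E.
    exact: product_measure1E.
  by rewrite pi_bad mul0e.
have aeN := ae_noise_time_null nu0 nu_sqr NP.
pose V w := modified_path f C2 delta gamma nu pi N w.
have null0 w : N w [set p | set0 p.2.2] = 0%E.
  by rewrite (_ : [set p | _] = set0)//; apply/seteqP; split.
have XV (t : R) w : W w -> N w [set p | p.2.2 = t] = 0%E -> X t w = V w t.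
  move=> [rw Nw] Nt; rewrite /X /V; apply: (@stoch_integral_path _ _ _ _ C1 C2 mf df f_left f_right cvg_g
    _ delta_gt0 gamma nu _ piM int_sup int_opnorm _ _ _ _ Nw t [set t]) => //.
    exact: lebesgue_measure_set1.
  by move=> A s _ /= st /eqP; rewrite subr_eq0 => /eqP ts; case: st.
(* When [f A 0 = C2] the kernel is already right continuous at 0, no jump time has to be excluded,
   and the null set is the same for all [t]. *)
have XV_all (t : R) w : (forall A, Mminus A -> f A 0 = C2) -> W w -> X t w = V w t.
  move=> fC2 [rw Nw]; rewrite /X /V; apply: (@stoch_integral_path _ _ _ _ C1 C2 mf df f_left f_right cvg_g
    _ delta_gt0 gamma nu _ piM int_sup int_opnorm _ _ _ _ Nw t set0) => //.
  by move=> A s /fC2.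
have V_increment w (b e M : R) (I S : set R) (Ww : W w) := @modified_path_increment _ _ _ _ _ _ mf df
  f_left f_right cvg_g _ delta_gt0 gamma nu _ piM int_sup int_opnorm _ _ _ _ Ww.1 Ww.2 b e M I S.
have V_pos w (t : R) : W w -> 0 <= t ->
    V w t = V w 0 + time_integral (Z ^~ w) t + (C2 - C1) *m L t w.
  move=> Ww t0; rewrite /time_integral /L /levy_process t0 /V /Z.
  have sub : `]0, t] `<=` `[- t, t].
    by apply: subset_itv; rewrite bnd_simp// oppr_le0.
  have It s : ~ set0 s -> (s \in `]0, t]%classic) = (0 < s <= t).
    by move=> _; rewrite mem_setE in_itv.
  have := V_increment w 0 t t `]0, t]%classic set0 Ww t0 (measurable_itv _) sub measurable0
    (measure0 _) (null0 w) It.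
  by [].
(* For [t < 0] the slab of [L] is [[t, 0[], whereas the increment counts the jumps in []t, 0]]: the
   two endpoints must carry none. The identity from [t] to 0 is then solved for [V w t], hence the
   opposite sign. *)
have V_neg w (t : R) : W w -> t < 0 -> N w [set p | p.2.2 = t] = 0%E -> N w [set p | p.2.2 = 0] = 0%E ->
    V w t = V w 0 + time_integral (Z ^~ w) t + (C1 - C2) *m L t w.
  move=> Ww t0 Nt N0; rewrite /time_integral /L /levy_process leNgt t0/= /V /Z.
  have m2 (r : R) : measurable [set p : 'cV[R]_d * ('M[R]_d * R) | p.2.2 = r].
    rewrite (_ : mkset _ = (fun p : 'cV[R]_d * ('M[R]_d * R) => p.2.2) @^-1` [set r])//.
    by rewrite -[X in measurable X]setTI; exact: measurable_jump_time.
  have sub : `[t, 0[ `<=` `[- - t, - t].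
    by apply: subset_itv; rewrite bnd_simp ?opprK// oppr_ge0 ltW.
  have It s : ~ ([set t] `|` [set 0]) s -> (s \in `[t, 0[%classic) = (t < s <= 0).
    move=> /not_orP[/eqP st /eqP s0]; rewrite mem_setE in_itv/= [t <= s]le_eqVlt eq_sym (negbTE st).
    by rewrite [s <= 0]le_eqVlt (negbTE s0).
  have leb0 : @lebesgue_measure R ([set t] `|` [set 0]) = 0%E.
    by apply: null_set_setU => //; exact: lebesgue_measure_set1.
  have Nt0 : N w [set p | ([set t] `|` [set 0]) p.2.2] = 0%E.
    rewrite (_ : mkset _ = [set p | p.2.2 = t] `|` [set p | p.2.2 = 0])//.
    exact: null_set_setU.
  have H := V_increment w t 0 (- t) `[t, 0[%classic ([set t] `|` [set 0]) Ww (ltW t0)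
    (measurable_itv _) sub (measurableU _ _ (measurable_set1 _) (measurable_set1 _)) leb0 Nt0 It.
  by rewrite H -(opprB C2) mulNmx addrAC addrK addrK.
have Z_integrable w i b e : W w -> b <= e ->
    (@lebesgue_measure R).-integrable `[b, e] (fun u => (Z u w i 0)%:E).
  by move=> [rw Nw]; exact: (integrable_slope mf df cvg_g delta_gt0 gamma nu piM
    int_sup int_opnorm rw Nw).
have V_cadlag w : W w -> cadlag (V w).
  by move=> [rw Nw]; exact: (modified_path_cadlag mf df f_left f_right cvg_g delta_gt0
    gamma nu int_sup int_opnorm rw).
have V_fv w : W w -> finite_variation_on_compacts (V w).
  by move=> [rw Nw]; exact: (modified_path_finite_variation mf df f_left f_right cvg_g delta_gt0
    gamma nu int_sup int_opnorm rw).
split.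
- move=> t; have := @filterI _ _ (ae_filter_ringOfSetsType P) _ _ (aeN t) (aeN 0); move: aeW.
  apply: (@filterS2 _ _ (ae_filter_ringOfSetsType P)) => w Ww [Nt N0]; split.
    by move=> i; apply: Z_integrable => //; rewrite ge_min le_max lexx.
  rewrite !XV//; case: ifPn => t0; first exact: V_pos.
  by apply: V_neg => //; rewrite ltNge.
(* [Q] is a measurable null set outside which [W] holds; setting the modification to 0 on it makes
   its paths regular for every [w] and keeps it measurable at each time. *)
- have [Q [mQ PQ QW]] := aeW.
  have WQ w : ~ Q w -> W w by move=> nQ; apply: contrapT => nW; apply: nQ; exact: QW.
  exists (fun t w => if w \in ~` Q then V w t else 0); split.
  + move=> t; apply/measurable_fun_mx => i j; rewrite ord1.
    rewrite (_ : (fun w => _) = (fun w => if w \in ~` Q then V w t i 0 else 0)); last first.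
      by apply/funext => w; case: ifP => // _; rewrite mxE.
    apply: measurable_patch0; first exact: measurableC.
    apply: measurable_funTS.
    rewrite /V /modified_path; under eq_fun do rewrite mxE.
    apply: measurable_funD => //; apply: (measurable_noise_Rintegral nu0 nu_sqr NP).
    apply: measurable_noise_path => //; [exact: measurable_jump_coord|
      exact: measurable_jump_matrix|exact: measurable_jump_time].
  + move=> t; have aeQ : {ae P, forall w, ~ Q w}.
      by exists Q; split => // w /= /contrapT.
    move: aeQ (aeN t); apply: (@filterS2 _ _ (ae_filter_ringOfSetsType P)) => w nQ Nt.
    by rewrite mem_set// XV//; exact: WQ.
  + move=> w; have [Qw|nQ] := pselect (Q w).
      have -> : (fun t => if w \in ~` Q then V w t else 0) = cst 0.
        by apply/funext => t; rewrite memNset// => /(_ Qw).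
      split; first by move=> t; split; [exact: cvg_cst|exact: is_cvg_cst].
      move=> a b i ab; apply: (@bounded_variation_increment _ _ (cst 0)) => // r s _ _ _.
      by rewrite /= !mxE !subrr normr0.
    have -> : (fun t => if w \in ~` Q then V w t else 0) = V w.
      by apply/funext => t; rewrite mem_set.
    by split; [exact/V_cadlag/WQ|exact/V_fv/WQ].
- move=> fC2; apply: (@filterS _ _ (ae_filter_ringOfSetsType P)) aeW => w Ww.
  have XVw : X ^~ w = V w by apply/funext => t; exact: XV_all.
  split; last by rewrite XVw; split; [exact: V_cadlag|exact: V_fv].
  by move=> t t0; rewrite !XV_all//; exact: V_pos.
Qed.
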